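(* Let $(X_i)_{i\ge1}$ be i.i.d. random variables taking values in a measurable space $\mathcal{X}$, let $u:\mathcal{X}^2\to\mathbb{R}$ be a symmetric, bounded, measurable function, and let $$U_n:=\frac{1}{\sqrt n\,(n-1)}\sum_{1\le i\ne j\le n}\big(u(X_i,X_j)-\mathbb{E}[u(X_i,X_j)]\big).$$ Suppose that $U_n$ admits first- and second-order score functions $\mathfrak{s}_{U_n}, I_{U_n}\in L^2(U_n)$, that $|u(X_1,X_2)|\le R$ almost surely, and that $4\,\mathrm{Cov}(u(X_1,X_2),u(X_1,X_3))=1$. Let $\alpha:=e^{19/300}\pi^{1/4}$ and let $Z$ be a standard normal random variable. Then, for all $n\ge2$, $$\begin{aligned}H(U_n,Z)\le{}&\frac{3\alpha R^3}{\sqrt{2n}}\Big(R+\frac{R\log(4\sqrt n)}{2\sqrt n}+\frac{4}{n^{1/4}}\Big)e^{\frac{2R^2}{\sqrt n}}+\frac{\log(n)}{\sqrt2\sqrt{n-1}}\|u(X_1,X_2)\|_4^2\Big(16+2\sqrt2+\frac{8}{\sqrt{n-1}}\Big)\\&-\frac{1}{2\sqrt2}\log\Big(1-\frac{1}{\sqrt n}\Big)\big(1+\|\mathfrak{s}_{U_n}(U_n)U_n\|_2\big)+\frac{1}{\sqrt2(\sqrt n-1)}\|I_{U_n}(U_n)\|_2+\frac{1}{3\sqrt2(\sqrt n-1)^{3/2}}\|\mathfrak{s}_{U_n}(U_n)\|_2 .\end{aligned}$$ Hence, if $\max\big(\|\mathfrak{s}_{U_n}(U_n)\|_2,\|I_{U_n}(U_n)\|_2,\|U_n\mathfrak{s}_{U_n}(U_n)\|_2\big)=O(\log(n))$,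 then $$H(U_n,Z)\lessapprox\frac{\log(n)}{\sqrt n}\|u(X_1,X_2)\|_4^2\,(8\sqrt2+2).$$
   Context: For a random variable $W$ and $p\ge1$, $\|W\|_p:=\mathbb{E}[|W|^p]^{1/p}$, and $L^p(S):=\{f:\mathbb{R}\to\mathbb{R}\text{ measurable}:\mathbb{E}[|f(S)|^p]<\infty\}$. $C_c^\infty$ is the set of infinitely differentiable compactly supported functions $\mathbb{R}\to\mathbb{R}$. A random variable $S$ admits a (first-order) score function $\mathfrak{s}_S$, respectively a second-order score function $I_S$, if $\mathfrak{s}_S\in L^1(S)$, respectively $I_S\in L^1(S)$, satisfies $\mathbb{E}[\mathfrak{s}_S(S)\Psi(S)]=-\mathbb{E}[\Psi'(S)]$, respectively $\mathbb{E}[I_S(S)\Psi(S)]=\mathbb{E}[\Psi''(S)]$, for all $\Psi\in C_c^\infty$. For $S$ with Lebesgue density $f_S$ and $\varphi$ the standard normal density, the Hellinger distance is $H(S,Z):=\big(\frac12\int_{\mathbb{R}}(\sqrt{f_S(x)}-\sqrt{\varphi(x)})^2dx\big)^{1/2}$. $a_n\lessapprox b_n$ means $a_n\le b_n+o(b_n)$ as $n\to\infty$. *)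

(* Defs.v *)
From HB Require Import structures.
From mathcomp Require Import all_boot all_order all_algebra.
From mathcomp Require Import all_classical all_reals all_analysis.
Set Implicit Arguments.
Unset Strict Implicit.
Unset Printing Implicit Defensive.
Import Order.TTheory GRing.Theory Num.Theory.
Import numFieldNormedType.Exports.
Local Open Scope classical_set_scope.
Local Open Scope ring_scope.

Definition mutually_independent (d d' : measure_display)
    (W : measurableType d) (T : measurableType d') (R : realType)
    (P : probability W R) (X : nat -> {RV P >-> T}) : Prop :=
  forall (J : seq nat) (A : nat -> set T), uniq J ->
    (forall i, measurable (A i)) ->
    P (\bigcap_(i in [set` J]) (X i @^-1` A i))
      = (\prod_(i <- J) P (X i @^-1` A i))%E.

Definition identically_distributed (d d' : measure_display)
    (W : measurableType d) (T : measurableType d') (R : realType)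
    (P : probability W R) (X : nat -> {RV P >-> T}) : Prop :=
  forall (i j : nat) (A : set T), measurable A ->
    distribution P (X i) A = distribution P (X j) A.

Definition iid (d d' : measure_display)
    (W : measurableType d) (T : measurableType d') (R : realType)
    (P : probability W R) (X : nat -> {RV P >-> T}) : Prop :=
  mutually_independent X /\ identically_distributed X.

(* The variables X_1, X_2, ... are indexed from 0: the sample of size n is
   X 0, ..., X n.-1. *)
Definition Ustat (d d' : measure_display)
    (W : measurableType d) (T : measurableType d') (R : realType)
    (P : probability W R) (X : nat -> {RV P >-> T}) (u : T * T -> R)
    (n : nat) (w : W) : R :=
  (Num.sqrt n%:R * (n%:R - 1))^-1 *
  \sum_(i < n) \sum_(j < n | i != j)
    (u (X i w, X j w) - fine 'E_P[fun w' => u (X i w', X j w')]).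

Definition pnorm (d : measure_display) (W : measurableType d) (R : realType)
    (P : probability W R) (p : R) (Y : W -> R) : R :=
  fine ('N[P]_p%:E[EFin \o Y])%E.

(* f is in L^p(S): measurability is that of f on R, not only of f \o S. *)
Definition in_Lp_of (d : measure_display) (W : measurableType d)
    (R : realType) (P : probability W R) (S : W -> R) (p : R) (f : R -> R)
    : Prop :=
  measurable_fun [set: R] f /\ ('E_P[fun w => (`|f (S w)| `^ p)%R] < +oo)%E.

Definition Cc_infty (R : realType) (Psi : R -> R) : Prop :=
  (forall (k : nat) (x : R), derivable (derive1n k Psi) x 1) /\
  compact (closure [set x | Psi x != 0]).

Definition is_score (d : measure_display) (W : measurableType d)
    (R : realType) (P : probability W R) (S : W -> R) (s : R -> R) : Prop :=
  in_Lp_of P S 1 s /\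
  forall Psi : R -> R, Cc_infty Psi ->
    ('E_P[fun w => (s (S w) * Psi (S w))%R]
       = - 'E_P[fun w => derive1 Psi (S w)])%E.

Definition is_score2 (d : measure_display) (W : measurableType d)
    (R : realType) (P : probability W R) (S : W -> R) (I : R -> R) : Prop :=
  in_Lp_of P S 1 I /\
  forall Psi : R -> R, Cc_infty Psi ->
    ('E_P[fun w => (I (S w) * Psi (S w))%R]
       = 'E_P[fun w => derive1n 2 Psi (S w)])%E.

Definition is_density (d : measure_display) (W : measurableType d)
    (R : realType) (P : probability W R) (S : W -> R) (f : R -> R) : Prop :=
  [/\ measurable_fun [set: R] f, (forall x, 0 <= f x) &
      forall A : set R, measurable A ->
        P (S @^-1` A) = (\int[lebesgue_measure]_(x in A) (f x)%:E)%E].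

(* A density is unique up to Lebesgue-null sets, so that hellingerZ does not
   depend on the version chosen here. The value of density is unspecified when S
   has no density; a variable with a first-order score always has one. *)
Definition density (d : measure_display) (W : measurableType d)
    (R : realType) (P : probability W R) (S : W -> R) : R -> R :=
  get (is_density P S).

(* H(S, Z) for Z standard normal. *)
Definition hellingerZ (d : measure_display) (W : measurableType d)
    (R : realType) (P : probability W R) (S : W -> R) : R :=
  Num.sqrt (2^-1 * \int[lebesgue_measure]_x
    (Num.sqrt (density P S x) - Num.sqrt (normal_pdf 0 1 x)) ^+ 2).

Definition lessapprox (R : realType) (a b : nat -> R) : Prop :=
  exists2 e : nat -> R, e =o_\oo b & \forall n \near \oo, a n <= b n + e n.

(* Main.v *)
(* Let f_r be the density of r U + sqrt (1 - r^2) Z, so that f_0 is the normal density and f_r tends to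
   the density of U as r -> 1. If the integral of (d f_r / dr)^2 / f_r is at most w(r)^2, then the
   Cauchy-Schwarz inequality along the path bounds the L^2 norm of sqrt f_b - sqrt f_a by half the
   integral of w over [a, b]. Two such bounds are combined.
   - Near r = 1 the scores give d f_r / dr = - E[(I(U) + 1 + s(U) U) g] / r, where g is the Gaussian
     kernel, hence w(r) = (|I(U)|_2 + 1 + |s(U) U|_2) / r.
   - For r <= 1 - rho, d f_r / dr = - E[U G(U) - G'(U)] with G the derivative of the kernel. Replacing
     one sample point by an independent copy and applying the trapezoidal rule, whose error is of
     third order in the increment, turns this into the degenerate part of U, the fluctuation of a
     Stein kernel and a remainder; each has an explicit Gaussian weighted norm. This gives
     w(r) = C |u|_4^2 / (sqrt n (1 - r)) + C' b^3 / (n (1 - r)^2).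
   Integration yields a bound with terms in - ln rho, 1 / (n rho) and - ln (1 - rho). The explicit
   estimate is rho = 1 / sqrt n, and the asymptotic one is rho = eps / sqrt n with eps small. When
   8 b^2 > sqrt n the explicit bound exceeds 1 and there is nothing to prove. *)
Require Import Defs.
From HB Require Import structures.
From mathcomp Require Import all_boot all_order all_algebra.
From mathcomp Require Import perm.
From mathcomp Require Import ring lra.
From mathcomp Require Import all_classical all_reals all_analysis.
From mathcomp Require Import measurable_realfun.
Set Implicit Arguments.
Unset Strict Implicit.
Unset Printing Implicit Defensive.
Import Order.TTheory GRing.Theory Num.Theory.
Import numFieldNormedType.Exports.
Local Open Scope classical_set_scope.
Local Open Scope ring_scope.

(** * Expectations of bounded measurable functions *)

(** The weight 1 / f_r in the speed of the path involves an unknown mixture. It is removed by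
    writing each part of d f_r / dr as E[B l g], with g the Gaussian kernel: then E[B l g]^2 / E[g]
    <= E[B^2 l^2 g], and only explicit Gaussian integrals of l^2 g remain. These integrals blow up
    as r -> 1, and the rate 1 / (1 - r) is what produces the logarithm. The scores give nothing
    small in n, but they keep the speed bounded there. The trapezoidal rule matters: a one-sided
    expansion has an error of second order, of norm about (1 - r)^(-3/2) / sqrt n, which integrates
    to n^(-1/4) on [0, 1 - 1 / sqrt n]. The third order gives 1 / sqrt n. The normalisation of the
    covariance forces |u|_4^2 >= 1/2; this lower bound absorbs the terms that do not carry the
    factor |u|_4^2. A density of U must first be produced: the score identity bounds d f_r / dr by a
    multiple of (1 - r)^(-1/2), which is integrable, so the mixtures converge uniformly. *)

Lemma le_of_eq d (T : porderType d) (x y : T) : x = y -> (x <= y)%O.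
Proof. by move=> ->. Qed.

Section Expectation.
Context d (W : measurableType d) (R : realType) (P : probability W R).
Implicit Types f g : W -> R.

Definition Ex f : R := \int[P]_w f w.

(** Bounded measurable functions form an algebra contained in every L^p of a probability, so
    integrability of the polynomial expressions below needs no separate argument. *)
Definition bmf f := measurable_fun [set: W] f /\ exists M : R, forall w, `|f w| <= M.

Lemma bmf_int f : bmf f -> P.-integrable [set: W] (EFin \o f).
Proof.
move=> [mf [M fM]]; apply: (@le_integrable _ _ _ P setT _ _ (EFin \o cst M)) => //.
- exact/measurable_EFinP.
- by move=> w _ /=; rewrite lee_fin (le_trans (fM w))// ler_norm.
- exact: finite_measure_integrable_cst.
Qed.

Lemma bmf_cst c : bmf (fun=> c).
Proof. by split; [exact: measurable_cst | exists `|c|]. Qed.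

Lemma bmfN f : bmf f -> bmf (fun w => - f w).
Proof.
move=> [mf [M fM]]; split; first exact: measurable_funN.
by exists M => w; rewrite normrN.
Qed.

Lemma bmfD f g : bmf f -> bmf g -> bmf (fun w => f w + g w).
Proof.
move=> [mf [M fM]] [mg [N gN]]; split; first exact: measurable_funD.
by exists (M + N) => w; rewrite (le_trans (ler_normD _ _))// lerD.
Qed.

Lemma bmfB f g : bmf f -> bmf g -> bmf (fun w => f w - g w).
Proof. by move=> ? ?; apply: bmfD => //; exact: bmfN. Qed.

Lemma bmfM f g : bmf f -> bmf g -> bmf (fun w => f w * g w).
Proof.
move=> [mf [M fM]] [mg [N gN]]; split; first exact: measurable_funM.
by exists (M * N) => w; rewrite normrM ler_pM.
Qed.

Lemma bmfX f n : bmf f -> bmf (fun w => f w ^+ n).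
Proof.
move=> [mf [M fM]]; split; first exact: measurable_funX.
by exists (M ^+ n) => w; rewrite normrX lerXn2r// nnegrE// (le_trans _ (fM w)).
Qed.

Lemma bmf_sum (I : Type) (s : seq I) (Q : pred I) (F : I -> W -> R) :
  (forall i, bmf (F i)) -> bmf (fun w => \sum_(i <- s | Q i) F i w).
Proof.
move=> bF; elim: s => [|i s IH].
  by under eq_fun do rewrite big_nil; exact: bmf_cst.
by under eq_fun do rewrite big_cons; case: (Q i) => //; exact: bmfD.
Qed.

Lemma integrableM_bmf f g : P.-integrable [set: W] (EFin \o f) -> bmf g ->
  P.-integrable [set: W] (EFin \o (fun w => f w * g w)).
Proof.
move=> intf [mg [M gM]].
have mf : measurable_fun [set: W] f by exact/measurable_EFinP/(measurable_int P).
apply: (@le_integrable _ _ _ P setT _ _ (EFin \o (fun w => M * `|f w|))) => //.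
- by apply/measurable_EFinP; exact: measurable_funM.
- move=> w _ /=; rewrite lee_fin !normrM mulrC normr_id.
  by rewrite ler_wpM2r// (le_trans (gM w))// ler_norm.
- have -> : EFin \o (fun w => M * `|f w|) = (fun w => M%:E * (abse \o (EFin \o f)) w)%E.
    by apply/funext => w /=; rewrite EFinM.
  by apply: integrableZl => //; exact: integrable_abse.
Qed.

Lemma ExD f g : P.-integrable [set: W] (EFin \o f) ->
    P.-integrable [set: W] (EFin \o g) ->
  Ex (fun w => f w + g w) = Ex f + Ex g.
Proof. by move=> ? ?; rewrite /Ex RintegralD. Qed.

Lemma ExB f g : P.-integrable [set: W] (EFin \o f) ->
    P.-integrable [set: W] (EFin \o g) ->
  Ex (fun w => f w - g w) = Ex f - Ex g.
Proof. by move=> ? ?; rewrite /Ex RintegralB. Qed.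

Lemma ExZ c f : P.-integrable [set: W] (EFin \o f) -> Ex (fun w => c * f w) = c * Ex f.
Proof. by move=> ?; rewrite /Ex RintegralZl. Qed.

Lemma ExN f : P.-integrable [set: W] (EFin \o f) -> Ex (fun w => - f w) = - Ex f.
Proof.
move=> ?; rewrite -mulN1r -ExZ//; congr Ex; apply/funext => w.
by rewrite mulN1r.
Qed.

Lemma Ex_cst c : Ex (fun=> c) = c.
Proof. by rewrite /Ex Rintegral_cst//= probability_setT/= mulr1. Qed.

Lemma Ex_ge0 f : (forall w, 0 <= f w) -> 0 <= Ex f.
Proof. by move=> f0; apply: Rintegral_ge0. Qed.

Lemma Ex_sum (I : Type) (s : seq I) (Q : pred I) (F : I -> W -> R) :
    (forall i, P.-integrable [set: W] (EFin \o F i)) ->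
  Ex (fun w => \sum_(i <- s | Q i) F i w) = \sum_(i <- s | Q i) Ex (F i).
Proof.
move=> iF; elim: s => [|i s IH].
  by rewrite big_nil -[RHS]Ex_cst; congr Ex; apply/funext => w; rewrite big_nil.
rewrite big_cons -IH; under eq_fun do rewrite big_cons; case: (Q i) => //.
rewrite ExD//.
have -> : EFin \o (fun w => \sum_(j <- s | Q j) F j w) =
    (fun w => \sum_(j <- s | Q j) (EFin \o F j) w)%E.
  by apply/funext => w; rewrite /= -sumEFin.
exact: integrable_sum.
Qed.

Lemma le_Ex f g : P.-integrable [set: W] (EFin \o f) ->
    P.-integrable [set: W] (EFin \o g) ->
  (forall w, f w <= g w) -> Ex f <= Ex g.
Proof. by move=> ? ? fg; apply: le_Rintegral. Qed.

Lemma norm_Ex f : P.-integrable [set: W] (EFin \o f) -> `|Ex f| <= Ex (fun w => `|f w|).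
Proof. by move=> ?; apply: le_normr_Rintegral. Qed.

Lemma EFin_Ex f : P.-integrable [set: W] (EFin \o f) ->
  (Ex f)%:E = (\int[P]_w (f w)%:E)%E.
Proof. by move=> ?; rewrite /Ex /Rintegral fineK//; exact: integrable_fin_num. Qed.

Lemma integral_cst_probability c : (\int[P]_w c%:E = c%:E)%E.
Proof. by rewrite -(EFin_Ex (bmf_int (bmf_cst c))) Ex_cst. Qed.

Lemma Ex_gt0 f : bmf f -> (forall w, 0 < f w) -> 0 < Ex f.
Proof.
move=> bf f0; rewrite lt_neqAle Ex_ge0 ?andbT; last by move=> w; exact: ltW.
apply/eqP => Ef0.
have : (\int[P]_w `|(f w)%:E| = 0)%E.
  under eq_integral do rewrite gee0_abs ?lee_fin ?(ltW (f0 _))//.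
  by rewrite -EFin_Ex ?bmf_int// -Ef0.
move/ae_eq_integral_abs => /=.
have mf : measurable_fun setT (EFin \o f) by apply/measurable_EFinP; case: bf.
move=> /(_ measurableT mf) [N [mN N0 sub]].
have : N = setT.
  apply/seteqP; split => // w _; apply: sub => /= /(_ I) [fw0].
  by have := f0 w; rewrite fw0 ltxx.
by move=> NT; have := probability_setT P; rewrite -NT N0 => /eqP; rewrite eq_sym onee_eq0.
Qed.

(* The nonnegativity of [E[(A - c)^2 g]] for [c = E[A g] / E[g]]. *)
Lemma weighted_CS (A g : W -> R) : measurable_fun [set: W] A -> bmf g -> (forall w, 0 <= g w) ->
    P.-integrable [set: W] (EFin \o (fun w => A w * g w)) ->
    P.-integrable [set: W] (EFin \o (fun w => A w ^+ 2 * g w)) -> 0 < Ex g ->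
  Ex (fun w => A w * g w) ^+ 2 / Ex g <= Ex (fun w => A w ^+ 2 * g w).
Proof.
move=> mA bg g0 iA iA2 Eg0.
set c := Ex (fun w => A w * g w) / Ex g.
have ig := bmf_int bg.
have iZ (k : R) h : P.-integrable [set: W] (EFin \o h) ->
    P.-integrable [set: W] (EFin \o (fun w => k * h w)).
  move=> ih; have -> : EFin \o (fun w => k * h w) = (fun w => k%:E * (EFin \o h) w)%E.
    by apply/funext => w /=; rewrite EFinM.
  exact: integrableZl.
have iB h k : P.-integrable [set: W] (EFin \o h) -> P.-integrable [set: W] (EFin \o k) ->
    P.-integrable [set: W] (EFin \o (fun w => h w - k w)).
  move=> ih ik; have -> : EFin \o (fun w => h w - k w) = ((EFin \o h) \- (EFin \o k))%E.
    by apply/funext => w /=; rewrite EFinB.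
  exact: integrableB.
have : 0 <= Ex (fun w => (A w - c) ^+ 2 * g w).
  by apply: Ex_ge0 => w; rewrite mulr_ge0// sqr_ge0.
have -> : (fun w => (A w - c) ^+ 2 * g w) =
    (fun w => A w ^+ 2 * g w - (2 * c * (A w * g w) - c ^+ 2 * g w)).
  by apply/funext => w; ring.
rewrite ExB//; last by apply: iB; exact: iZ.
rewrite ExB ?ExZ//; try exact: iZ.
rewrite subr_ge0; apply: le_trans.
apply: le_of_eq; rewrite /c.
by field; rewrite gt_eqF.
Qed.

End Expectation.

Section ParametricExpectation.
Context d1 d2 (T1 : measurableType d1) (T2 : measurableType d2) (R : realType).
Context (Q : probability T1 R).

(** Tonelli applies to the positive and negative parts separately, and [fine] gives a value even
    where the integral is infinite, so no integrability enters. *)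
Lemma measurable_Ex (f : T1 * T2 -> R) : measurable_fun [set: T1 * T2] f ->
  measurable_fun [set: T2] (fun y => Ex Q (fun x => f (x, y))).
Proof.
move=> mf; rewrite /Ex /Rintegral.
apply: (@measurableT_comp _ _ _ _ _ _ fine).
  exact: fine_measurable.
have mf' : measurable_fun [set: T1 * T2] (EFin \o f) by exact/measurable_EFinP.
under eq_fun do rewrite integralE.
have E (g : T1 * T2 -> \bar R) : measurable_fun [set: T1 * T2] g ->
    (forall z, 0 <= g z)%E -> measurable_fun [set: T2] (fun y => \int[Q]_x g (x, y))%E.
  by move=> mg g0; exact: (@measurable_fun_fubini_tonelli_G _ _ T1 T2 R Q g mg g0).
apply: emeasurable_funB.
- have := E ((EFin \o f)^\+)%E (measurable_funepos mf') (fun z => funepos_ge0 _ _).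
  by congr measurable_fun; apply/funext => y; apply: eq_integral => x _; rewrite !funeposE.
- have := E ((EFin \o f)^\-)%E (measurable_funeneg mf') (fun z => funeneg_ge0 _ _).
  by congr measurable_fun; apply/funext => y; apply: eq_integral => x _; rewrite !funenegE.
Qed.

Lemma bmf_pair1 (f : T1 * T2 -> R) y : bmf f -> bmf (fun x => f (x, y)).
Proof.
move=> [mf [M fM]]; split; last by exists M => x; exact: fM.
exact: measurable_fun_pair1.
Qed.

Lemma bmf_Ex (f : T1 * T2 -> R) : bmf f -> bmf (fun y => Ex Q (fun x => f (x, y))).
Proof.
move=> bf; case: (bf) => mf [M fM]; split; first exact: measurable_Ex.
exists M => y; have bfy := bmf_pair1 y bf.
rewrite (le_trans (norm_Ex (bmf_int Q bfy)))// -[leRHS](Ex_cst Q).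
apply: le_Ex => //; apply: bmf_int; last exact: bmf_cst.
by case: bfy => mfy [M' fM']; split; [exact: measurableT_comp|exists M' => x; rewrite normr_id].
Qed.

End ParametricExpectation.

Lemma Ex_pushforward d d' (W : measurableType d) (T : measurableType d') (R : realType)
    (P : probability W R) (Y : {RV P >-> T}) (f : T -> R) :
  bmf f -> Ex (distribution P Y) f = Ex P (fun w => f (Y w)).
Proof.
move=> bf; rewrite /Ex /Rintegral (@integral_distribution _ _ _ _ _ P Y (EFin \o f))//.
  by apply/measurable_EFinP; case: bf.
apply: (@bmf_int _ _ _ P (fun w => f (Y w))).
case: bf => mf [M fM]; split; last by exists M => w; exact: fM.
by apply: measurableT_comp.
Qed.

(** * Samples *)

Section Box.
Context d (T : measurableType d) (N : nat).

Definition box (A : 'I_N -> set T) : set (N.-tuple T) :=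
  [set t | forall i, A i (tnth t i)].

Lemma measurable_box (A : 'I_N -> set T) :
  (forall i, measurable (A i)) -> measurable (box A).
Proof.
move=> mA; rewrite (_ : box A = \bigcap_(i in [set: 'I_N]) ((@tnth N T)^~ i @^-1` A i)).
  apply: fin_bigcap_measurable; first exact: finite_finset.
  by move=> i _; rewrite -[_ @^-1` _]setTI; exact: measurable_tnth.
by apply/seteqP; split => [t At i _|t At i]; apply: At.
Qed.

(** The coordinate cylinders that define the structure are not stable under intersection; boxes are,
    and a cylinder is a box with full sides elsewhere. Boxes can then serve in the uniqueness
    theorem for measures. *)
Lemma tuple_measurable_boxE : @measurable _ (N.-tuple T) =
  <<s [set B | exists2 A, (forall i, measurable (A i)) & B = box A] >>.
Proof.
apply/seteqP; split.
- apply: smallest_sub; first exact: smallest_sigma_algebra.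
  set G := <<s _ >>.
  apply: (big_ind (fun S => S `<=` G)) => [//|A B AG BG C [/AG//|/BG//]|i _ _ [C mC <-]].
  apply: sub_gen_smallest; exists (fun j => if j == i then C else setT).
    by move=> j; case: ifP.
  apply/seteqP; split => [t [_ Ct] j|t Ct].
    by case: ifPn => // /eqP ->.
  by split => //; have := Ct i; rewrite eqxx.
- apply: smallest_sub; first exact: sigma_algebra_measurable.
  by move=> _ [A mA ->]; exact: measurable_box.
Qed.

Lemma tuple_measure_unique (R : realType) (m1 m2 : {measure set (N.-tuple T) -> \bar R}) :
    (m1 setT < +oo)%E ->
    (forall A, (forall i, measurable (A i)) -> m1 (box A) = m2 (box A)) ->
  forall B, measurable B -> m1 B = m2 B.
Proof.
move=> m1oo m12 B mB.
apply: (@measure_unique _ R _ _ (fun=> setT) tuple_measurable_boxE) => //.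
- move=> _ _ [A mA ->] [C mC ->]; exists (fun i => A i `&` C i).
    by move=> i; exact: measurableI.
  by apply/seteqP; split => [t [At Ct] i|t ACt]; [|split => i; case: (ACt i)].
- by move=> _; exists (fun=> setT) => //; apply/seteqP; split.
- by rewrite bigcup_const.
- by move=> _ [A mA ->]; exact: m12.
Qed.

End Box.

Section Sample.
Context d d' (W : measurableType d) (T : measurableType d') (R : realType).
Context (P : probability W R) (X : nat -> {RV P >-> T}).
Hypothesis iidX : iid X.

Notation mu := (distribution P (X 0%N)).

(** The free index map [s] covers permuted samples and samples that avoid a given index. *)
Definition sample N (s : 'I_N -> nat) (w : W) : N.-tuple T := [tuple X (s i) w | i < N].

Lemma measurable_sample N (s : 'I_N -> nat) : measurable_fun [set: W] (sample s).
Proof.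
apply/measurable_fun_tnthP => i.
rewrite (_ : _ \o _ = X (s i)); first exact: measurable_funPT.
by apply/funext => w /=; rewrite tnth_mktuple.
Qed.

HB.instance Definition _ N (s : 'I_N -> nat) :=
  isMeasurableFun.Build _ _ _ _ (sample s) (measurable_sample s).

Lemma sample_box N (s : 'I_N -> nat) (A : 'I_N -> set T) : injective s ->
    (forall i, measurable (A i)) ->
  P (sample s @^-1` box A) = (\prod_(i < N) mu (A i))%E.
Proof.
(* [mutually_independent] takes sets indexed by all of [nat]: transport [A] along [s] and use the
   whole space off its range. *)
move=> injs mA; pose A' k := if [pick i | s i == k] is Some i then A i else setT.
have A's i : A' (s i) = A i.
  rewrite /A'; case: pickP => [j /eqP /injs ->//|/(_ i)].
  by rewrite eqxx.
have mA' k : measurable (A' k) by rewrite /A'; case: pickP.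
have [indX idX] := iidX.
have := indX [seq s i | i <- enum 'I_N] A' _ mA'.
rewrite map_inj_uniq// enum_uniq => /(_ isT).
rewrite big_map big_enum /= => PE.
transitivity (\prod_(i < N) P (X (s i) @^-1` A' (s i)))%E; last first.
  by apply: eq_bigr => i _; rewrite A's; exact: idX.
rewrite -PE; congr (P _); apply/seteqP; split => w.
  by move=> Aw k /= /mapP[i _ ->]; rewrite A's; have := Aw i; rewrite tnth_mktuple.
by move=> Aw i; rewrite tnth_mktuple -A's; apply: Aw => /=; apply: map_f; rewrite mem_enum.
Qed.

Lemma sample_law N (s s' : 'I_N -> nat) B : injective s -> injective s' ->
  measurable B -> P (sample s @^-1` B) = P (sample s' @^-1` B).
Proof.
move=> injs injs' mB.
apply: (@tuple_measure_unique _ _ _ _ (distribution P (sample s)) (distribution P (sample s'))) => //.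
  by rewrite /= /distribution /pushforward preimage_setT probability_setT ltry.
by move=> A mA; rewrite /= /distribution /pushforward !sample_box.
Qed.

Lemma sample_indep N (s : 'I_N -> nat) k A B : injective s -> (forall i, s i != k) ->
    measurable A -> measurable B ->
  P (X k @^-1` A `&` sample s @^-1` B) = (mu A * P (sample s @^-1` B))%E.
Proof.
move=> injs sk mA mB.
have mXA : measurable (X k @^-1` A) by rewrite -[_ @^-1` _]setTI; exact: measurable_funPT.
have muA0 : 0 <= fine (mu A) by exact: fine_ge0.
(* For fixed [A] both sides are finite measures in [B], so they need only be compared on boxes. *)
have [m1 m1E] : exists m : {measure set (N.-tuple T) -> \bar R},
    forall C, m C = P (sample s @^-1` C `&` X k @^-1` A).
  unshelve eexists (pushforward (mrestr P mXA) (sample s)).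
    exact: measurable_sample.
  by [].
pose m2 := [the {measure set (N.-tuple T) -> \bar R} of
  mscale (NngNum muA0) (distribution P (sample s))].
have m2E C : m2 C = (mu A * P (sample s @^-1` C))%E.
  by rewrite /m2 /= /mscale /= fineK ?fin_num_measure.
suff : m1 B = m2 B by rewrite m1E m2E setIC.
apply: tuple_measure_unique => //.
  by rewrite m1E preimage_setT setTI (le_lt_trans (probability_le1 _ _))// ltry.
move=> C mC; rewrite m1E m2E.
rewrite sample_box//.
(* Prepending index [k] turns the joint event into a single box event for a sample of size N + 1. *)
pose s' (i : 'I_N.+1) := if unlift ord0 i is Some j then s j else k.
pose C' (i : 'I_N.+1) := if unlift ord0 i is Some j then C j else A.
have s's i : s' (lift ord0 i) = s i by rewrite /s' liftK.
have s'0 : s' ord0 = k by rewrite /s' unlift_none.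
have injs' : injective s'.
  move=> i j; case: (unliftP ord0 i) => [i'|] ->; case: (unliftP ord0 j) => [j'|] -> //.
  - by rewrite !s's => /injs ->.
  - by rewrite s's s'0 => /eqP; rewrite (negbTE (sk _)).
  - by rewrite s's s'0 => /esym /eqP; rewrite (negbTE (sk _)).
have mC' i : measurable (C' i) by rewrite /C'; case: unliftP.
have C'0 : C' ord0 = A by rewrite /C' unlift_none.
have C'l i : C' (lift ord0 i) = C i by rewrite /C' liftK.
have := sample_box injs' mC'; rewrite big_ord_recl C'0.
under eq_bigr do rewrite C'l.
move=> <-; congr (P _); apply/seteqP; split => [w [Cw Aw] i|w Cw].
  rewrite tnth_mktuple; case: (unliftP ord0 i) => [i'|] ->.
    by rewrite s's C'l; have := Cw i'; rewrite tnth_mktuple.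
  by rewrite s'0 C'0.
split => [i|]; last by have := Cw ord0; rewrite tnth_mktuple s'0 C'0.
by have := Cw (lift ord0 i); rewrite !tnth_mktuple s's C'l.
Qed.

Lemma Ex_sample N (s s' : 'I_N -> nat) (F : N.-tuple T -> R) : injective s -> injective s' ->
  bmf F -> Ex P (fun w => F (sample s w)) = Ex P (fun w => F (sample s' w)).
Proof.
move=> injs injs' bF.
rewrite -(@Ex_pushforward _ _ _ _ _ P (sample s))// -(@Ex_pushforward _ _ _ _ _ P (sample s'))//.
rewrite /Ex /Rintegral; congr fine.
by apply: eq_measure_integral => A mA _; exact: sample_law.
Qed.

(** The joint law agrees with the product of the marginals on rectangles, hence is that product;
    Fubini then integrates out the single variable first. *)
Lemma Ex_indep N (s : 'I_N -> nat) k (F : T * N.-tuple T -> R) : injective s ->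
    (forall i, s i != k) -> bmf F ->
  Ex P (fun w => F (X k w, sample s w)) =
  Ex P (fun w => Ex mu (fun y => F (y, sample s w))).
Proof.
move=> injs sk bF; have [mF [M FM]] := bF.
have mY : measurable_fun [set: W] (fun w => (X k w, sample s w)).
  by apply: measurable_fun_pair; [exact: measurable_funPT|exact: measurable_sample].
pose Y : {RV P >-> (T * N.-tuple T)%type} := mfun_Sub (mem_set mY).
rewrite -[LHS](@Ex_pushforward _ _ _ _ _ P Y)//.
rewrite -[RHS](@Ex_pushforward _ _ _ _ _ P (sample s) (fun t => Ex mu (fun y => F (y, t)))); last exact: bmf_Ex.
have E : Ex (distribution P Y) F =
    fine (\int[mu \x distribution P (sample s)]_z (F z)%:E)%E.
  rewrite /Ex /Rintegral; congr fine; apply: eq_measure_integral => A mA _.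
  apply/esym.
  apply: (@product_measure_unique _ _ T (N.-tuple T) R mu (distribution P (sample s))
    (distribution P Y)) => //.
  move=> B C mB mC; rewrite /= /distribution /pushforward.
  by rewrite -(sample_indep injs sk mB mC).
rewrite E -(integral21_prod_meas1 (f := EFin \o F)); last first.
  apply/integrable21ltyP; first exact/measurable_EFinP.
  apply: (@le_lt_trans _ _ (\int[distribution P (sample s)]_y \int[mu]_x M%:E)%E).
    apply: ge0_le_integral => //=.
    - by move=> y _; apply: integral_ge0.
    - apply: (@measurable_fun_fubini_tonelli_G _ _ T (N.-tuple T) R mu (fun z => `|(F z)%:E|%E)) => //.
      by apply: measurableT_comp => //; exact/measurable_EFinP.
    - move=> y _; apply: ge0_le_integral => //=.
      + by apply/measurable_EFinP/measurableT_comp => //; exact: measurable_fun_pair1.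
      + by move=> x _; rewrite lee_fin.
  by rewrite integral_cst_probability integral_cst_probability ltry.
rewrite /Ex /Rintegral; congr fine; apply: eq_integral => t _ /=.
exact: (esym (EFin_Ex (bmf_int mu (bmf_pair1 t bF)))).
Qed.

End Sample.

(** * Gaussian integrals *)

Section Gaussian.
Context (R : realType).
Notation mu := (@lebesgue_measure R).

Lemma integral_derive_eq0 (F f : R -> R) : (forall x : R, is_derive x 1 F (f x)) ->
    continuous f -> mu.-integrable setT (EFin \o f) ->
    F n%:R @[n --> \oo] --> 0 -> F (- n%:R) @[n --> \oo] --> 0 ->
  (\int[mu]_x (f x)%:E = 0)%E.
Proof.
move=> dF cf intf Fy FNy.
pose I n := `[- n%:R, n%:R]%classic : set R.
have mI n : measurable (I n) by exact: measurable_itv.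
have mf : measurable_fun setT (EFin \o f) by exact: (measurable_int mu).
(* The shift to n + 1 keeps the interval nondegenerate, as the fundamental theorem of calculus
   demands. *)
have FTC n : (\int[mu]_(x in I n.+1) (f x)%:E = (F n.+1%:R - F (- n.+1%:R))%:E)%E.
  rewrite EFinB; apply: continuous_FTC2.
  - by rewrite gtrN.
  - by apply: continuous_subspaceT.
  - have cF x : {for x, continuous F}.
      by apply/differentiable_continuous/derivable1_diffP; case: (dF x).
    split.
    + by move=> x _; case: (dF x).
    + exact/cvg_at_right_filter/cF.
    + exact/cvg_at_left_filter/cF.
  - by move=> x _; rewrite derive1E; case: (dF x).
have : (\int[mu]_x (f x * \1_(I n.+1) x)%:E)%E @[n --> \oo] --> (\int[mu]_x (f x)%:E)%E.
  apply: (@dominated_cvg _ _ _ mu setT measurableT (fun n x => (f x * \1_(I n.+1) x)%:E) _ (fun x => `|(f x)%:E|)%E).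
  - move=> n; apply/measurable_EFinP/measurable_funM; first exact/measurable_EFinP.
    by apply: measurable_indic; exact: mI.
  - move=> x _; apply: cvg_EFin; first exact: nearW.
    apply: cvg_near_cst; near=> n.
    rewrite /= indicE mem_set ?mulr1// /I /= in_itv/= -ler_norml.
    rewrite (@le_trans _ _ n%:R)//; last by rewrite ler_nat.
    by near: n; exact: nbhs_infty_ger.
  - by move=> x _; rewrite abse_EFin.
  - exact: integrable_abse.
  - move=> n x _; rewrite abse_EFin lee_fin normrM ler_piMr//.
    by rewrite indicE; case: (_ \in _); rewrite ?normr1 ?normr0.
have -> : (fun n => \int[mu]_x (f x * \1_(I n.+1) x)%:E)%E = (fun n => (F n.+1%:R - F (- n.+1%:R))%:E).
  apply/funext => n; rewrite -FTC [RHS]integral_mkcond; apply: eq_integral => x _.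
  by rewrite patchE indicE; case: ifP; rewrite ?mulr1 ?mulr0.
move=> H; apply: (cvg_unique _ H) => //.
apply: cvg_EFin; first exact: nearW.
rewrite /comp -[X in _ --> X](subr0 0).
apply: cvgB.
  by have := Fy; rewrite -(cvg_shiftS (fun n => F n%:R)).
by have := FNy; rewrite -(cvg_shiftS (fun n => F (- n%:R))).
Unshelve. all: end_near.
Qed.

Section pdf.
Variables (m s : R).
Hypothesis s0 : 0 < s.
Let n := normal_pdf m s.
Let z (x : R) := (x - m) / s.

Lemma normal_pdf_gt0 x : 0 < n x.
Proof. by rewrite /n normal_pdfE ?gt_eqF// mulr_gt0 ?expR_gt0// normal_peak_gt0// gt_eqF. Qed.

Lemma normal_pdf_zE x : n x = normal_peak s * expR (- (z x ^+ 2 / 2)).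
Proof.
rewrite /n normal_pdfE ?gt_eqF// /normal_fun /z; congr (_ * expR _).
by rewrite -mulr_natr; field; rewrite gt_eqF.
Qed.

Lemma is_derive_normal_pdf (x : R) : is_derive x 1 n (- (z x / s) * n x).
Proof.
have -> : n = (fun x => normal_peak s * expR (- (z x ^+ 2 / 2))).
  by apply/funext => y; exact: normal_pdf_zE.
rewrite /z; apply: is_derive_eq.
by rewrite /GRing.scale/=; field; rewrite gt_eqF.
Qed.

Lemma continuous_normal_pdf_gt0 : continuous n.
Proof. by apply: continuous_normal_pdf; rewrite gt_eqF. Qed.

(** Half of the Gaussian exponent absorbs the power of z; the other half is the exponent of the
    normal density of deviation sqrt 2 s. The constant is crude: 64 sqrt 2 < 100. *)
Lemma quartic_normal_le k x : (k <= 4)%N ->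
  `|z x| ^+ k * n x <= 100 * normal_pdf m (Num.sqrt 2 * s) x.
Proof.
move=> k4.
have s2 : 0 < Num.sqrt 2 * s by rewrite mulr_gt0// sqrtr_gt0.
have E2 : Num.sqrt 2 ^+ 2 = 2 :> R by rewrite sqr_sqrtr.
have -> : normal_pdf m (Num.sqrt 2 * s) x =
    (Num.sqrt 2)^-1 * normal_peak s * expR (- (z x ^+ 2 / 4)).
  rewrite normal_pdfE ?gt_eqF//; congr (_ * expR _); last first.
    rewrite exprMn E2 /z -mulr_natr; field.
    by rewrite gt_eqF.
  rewrite /normal_peak exprMn E2 (_ : _ *+ 2 = 2 * (s ^+ 2 * pi *+ 2)); last by ring.
  by rewrite sqrtrM// invfM.
have E : expR (- (z x ^+ 2 / 2)) = expR (- (z x ^+ 2 / 4)) / expR (z x ^+ 2 / 8) ^+ 2.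
  rewrite -expRM_natl -expRN -expRD; congr expR.
  by field.
rewrite normal_pdf_zE E.
have p0 : 0 < normal_peak s by rewrite normal_peak_gt0// gt_eqF.
have e0 : 0 < expR (- (z x ^+ 2 / 4)) by exact: expR_gt0.
set e := expR (- _) in e0 *; set p := normal_peak s in p0 *.
(* [1 + |z|^4 <= (8 + z^2)^2 = 64 (1 + z^2 / 8)^2], and [1 + z^2 / 8] is at most its exponential
   counterpart. *)
have : `|z x| ^+ k <= 64 * expR (z x ^+ 2 / 8) ^+ 2.
  apply: (@le_trans _ _ (1 + `|z x| ^+ 4)).
    have [z1|z1] := leP `|z x| 1.
      by rewrite (le_trans (exprn_ile1 _ _ z1))// lerDl exprn_ge0.
    by rewrite (le_trans (ler_weXn2l _ k4))// ?(ltW z1)// lerDr.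
  have h : 1 + z x ^+ 2 / 8 <= expR (z x ^+ 2 / 8) by exact: expR_ge1Dx.
  have h0 : 0 <= z x ^+ 2 by exact: sqr_ge0.
  have -> : `|z x| ^+ 4 = (z x ^+ 2) ^+ 2.
    by rewrite -(real_normK (num_real (z x))) -exprM.
  have : (1 + z x ^+ 2 / 8) ^+ 2 <= expR (z x ^+ 2 / 8) ^+ 2.
    by rewrite lerXn2r// ?nnegrE ?expR_ge0// addr_ge0// divr_ge0.
  by move: h0; set y := z x ^+ 2; set q := expR _ ^+ 2 => y0; nra.
move: (expR_gt0 (z x ^+ 2 / 8)); set q := expR _ => q0 zq.
have q2 : 0 < q ^+ 2 by rewrite exprn_gt0.
have s32 : 1 <= 3 / 2 * (Num.sqrt 2)^-1 :> R.
  rewrite ler_pdivlMr ?sqrtr_gt0// mul1r.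
  by rewrite -(@ler_pXn2r _ 2)// ?nnegrE ?sqrtr_ge0// E2; lra.
rewrite [leLHS](_ : _ = (`|z x| ^+ k / q ^+ 2) * (p * e)); last by field; rewrite gt_eqF.
have : `|z x| ^+ k / q ^+ 2 <= 64 by rewrite ler_pdivrMr.
move=> /(ler_wpM2r (ltW (mulr_gt0 p0 e0))) /le_trans; apply.
rewrite [leRHS](_ : _ = 100 * (Num.sqrt 2)^-1 * (p * e)); last by ring.
by rewrite ler_pM2r ?mulr_gt0//; lra.
Qed.

(** Degree four is enough: the weighted norms below square polynomials of degree at most two in the
    standardised variable. *)
Definition quart (c0 c1 c2 c3 c4 t : R) := c0 + c1 * t + c2 * t ^+ 2 + c3 * t ^+ 3 + c4 * t ^+ 4.

Lemma quart_normal_le c0 c1 c2 c3 c4 x : `|quart c0 c1 c2 c3 c4 (z x) * n x| <=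
  (`|c0| + `|c1| + `|c2| + `|c3| + `|c4|) * (100 * normal_pdf m (Num.sqrt 2 * s) x).
Proof.
have B c k : (k <= 4)%N ->
    `|c * z x ^+ k * n x| <= `|c| * (100 * normal_pdf m (Num.sqrt 2 * s) x).
  move=> k4; rewrite !normrM normrX -mulrA ler_wpM2l//.
  by rewrite (ger0_norm (ltW (normal_pdf_gt0 x))) quartic_normal_le.
rewrite /quart; have := B c0 0%N isT; have := B c1 1%N isT; have := B c2 2%N isT.
have := B c3 3%N isT; have := B c4 4%N isT; rewrite expr0 expr1 mulr1.
set b := 100 * _ => b4 b3 b2 b1 b0; rewrite !mulrDl.
by do 4 (apply: (le_trans (ler_normD _ _)); apply: lerD => //).
Qed.

Lemma continuous_quart_normal c0 c1 c2 c3 c4 :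
  continuous (fun x => quart c0 c1 c2 c3 c4 (z x) * n x).
Proof.
move=> x; apply: cvgM; last exact: continuous_normal_pdf_gt0.
have cz : {for x, continuous z} by apply: cvgM; [apply: cvgB; [exact: cvg_id|exact: cvg_cst]|exact: cvg_cst].
have cX c k : (c * z x0 ^+ k) @[x0 --> x] --> c * z x ^+ k.
  by apply: cvgM; [exact: cvg_cst|exact: continuous_comp cz (@exprn_continuous _ k _)].
rewrite /quart; apply: cvgD => //; apply: cvgD => //; apply: cvgD => //.
by apply: cvgD; [exact: cvg_cst|apply: cvgM cz; exact: cvg_cst].
Qed.

Lemma integrable_quart c0 c1 c2 c3 c4 :
  mu.-integrable setT (fun x => (quart c0 c1 c2 c3 c4 (z x) * n x)%:E).
Proof.
set C := `|c0| + `|c1| + `|c2| + `|c3| + `|c4|.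
have mq : measurable_fun [set: R] (fun x => quart c0 c1 c2 c3 c4 (z x) * n x).
  by apply: continuous_measurable_fun; exact: continuous_quart_normal.
apply: (@le_integrable _ _ _ mu setT _ _
    (fun x => (C * 100)%:E * (normal_pdf m (Num.sqrt 2 * s) x)%:E)%E) => //.
- exact/measurable_EFinP.
- move=> x _; rewrite -[((C * 100)%:E * _)%E]EFinM !abse_EFin lee_fin.
  by rewrite (le_trans (quart_normal_le _ _ _ _ _ _))// mulrA ler_norm.
- by apply: integrableZl => //; exact: integrable_normal_pdf.
Qed.

(** These are the Gaussian moments 1, 0, 1, 0, 3. After subtracting the claimed value times the
    density, the integrand is the derivative of [F], a cubic polynomial times the density, which
    vanishes at infinity. *)
Lemma integral_quart c0 c1 c2 c3 c4 :
  (\int[mu]_x (quart c0 c1 c2 c3 c4 (z x) * n x)%:E = (c0 + c2 + 3 * c4)%:E)%E.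
Proof.
pose F (x : R) := - s * n x * (c1 + 2 * c3 + (c2 + 3 * c4) * z x + c3 * z x ^+ 2 + c4 * z x ^+ 3).
pose f (x : R) := quart (- c2 - 3 * c4) c1 c2 c3 c4 (z x) * n x.
have dF (x : R) : is_derive x 1 F (f x).
  have dn := is_derive_normal_pdf x.
  rewrite /F /z; apply: is_derive_eq.
  rewrite /f /quart /z /GRing.scale/=; field.
  by rewrite gt_eqF.
(* A bound on F times the distance to m gives decay at rate 1 / |x - m|, without limits of
   exponentials. *)
have B x : `|F x * (x - m)| <=
    s ^+ 2 * ((`|c1 + 2 * c3| + `|c2 + 3 * c4| + `|c3| + `|c4|) * (100 * normal_peak (Num.sqrt 2 * s))).
  have -> : F x * (x - m) = - (s ^+ 2 * (quart 0 (c1 + 2 * c3) (c2 + 3 * c4) c3 c4 (z x) * n x)).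
    by rewrite /F /quart /z; field; rewrite gt_eqF.
  rewrite normrN normrM ger0_norm ?sqr_ge0// ler_wpM2l ?sqr_ge0//.
  rewrite (le_trans (quart_normal_le _ _ _ _ _ _))// normr0 add0r.
  rewrite ler_wpM2l// ?addr_ge0// ler_wpM2l// normal_pdf_ub// gt_eqF// mulr_gt0// sqrtr_gt0.
set K := s ^+ 2 * _ in B.
have K0 : 0 <= K by exact: le_trans (B 0).
have lim (e : R) : 0 < e -> exists N : nat, forall k : nat, (N <= k)%N ->
    `|F k%:R| < e /\ `|F (- k%:R)| < e.
  move=> e0; exists (Num.truncn (`|m| + (K + 1) / e)).+1 => k Nk.
  have Q x : `|m| + (K + 1) / e < `|x| -> `|F x| < e.
    move=> hx; have h : (K + 1) / e < `|x - m|.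
      by have := ler_normB x (- m); have := lerB_normD x (- m); rewrite normrN; lra.
    have h0 : 0 < `|x - m| by apply: lt_trans h; rewrite divr_gt0// ltr_wpDl.
    rewrite -(ltr_pM2r h0) -normrM (le_lt_trans (B x))//.
    by move: h; rewrite ltr_pdivrMr// => h; rewrite mulrC; apply: lt_trans h; lra.
  have k_gt : `|m| + (K + 1) / e < k%:R.
    apply: (@lt_le_trans _ _ (Num.truncn (`|m| + (K + 1) / e)).+1%:R); last by rewrite ler_nat.
    by apply: truncnS_gt.
  by split; apply: Q; rewrite ?normrN normr_nat.
have fI : (\int[mu]_x (f x)%:E = 0)%E.
  apply: (@integral_derive_eq0 F f dF).
  - exact: continuous_quart_normal.
  - exact: integrable_quart.
  - apply/cvgrPdist_lt => e /lim[N HN]; near=> k.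
    by rewrite sub0r normrN; apply: (HN k _).1; near: k; exact: nbhs_infty_ge.
  - apply/cvgrPdist_lt => e /lim[N HN]; near=> k.
    by rewrite sub0r normrN; apply: (HN k _).2; near: k; exact: nbhs_infty_ge.
have -> : (fun x => (quart c0 c1 c2 c3 c4 (z x) * n x)%:E) =
    (fun x => ((EFin \o f) x + (c0 + c2 + 3 * c4)%:E * (n x)%:E)%E).
  by apply/funext => x; rewrite /= -EFinM -EFinD; congr EFin; rewrite /f /quart; ring.
rewrite integralD//; last 2 first.
- exact: integrable_quart.
- by apply: integrableZl => //; exact: integrable_normal_pdf.
rewrite fI add0e integralZl//; last exact: integrable_normal_pdf.
by rewrite integral_normal_pdf mule1.
Unshelve. all: end_near.
Qed.

End pdf.
End Gaussian.

(** * Weighted Gaussian norms and the error of the trapezoidal rule *)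

Section GaussianNorms.
Context (R : realType).
Notation mu := (@lebesgue_measure R).
Implicit Types c s e x : R.

(* First and second derivatives of the normal density in x. *)
Definition npdf1 c s x := - ((x - c) / s / s) * normal_pdf c s x.
Definition npdf2 c s x := (((x - c) / s) ^+ 2 - 1) / s ^+ 2 * normal_pdf c s x.

Lemma integral_npdf1_sqr c s : 0 < s ->
  (\int[mu]_x (npdf1 c s x ^+ 2 / normal_pdf c s x)%:E = (s ^- 2)%:E)%E.
Proof.
move=> s0.
transitivity (\int[mu]_x (quart 0 0 (s ^- 2) 0 0 ((x - c) / s) * normal_pdf c s x)%:E)%E.
  apply: eq_integral => x _; congr EFin; rewrite /quart /npdf1.
  by field; rewrite !gt_eqF// normal_pdf_gt0.
by rewrite integral_quart// !mulr0 add0r addr0.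
Qed.

Lemma integral_npdf2_sqr c s : 0 < s ->
  (\int[mu]_x (npdf2 c s x ^+ 2 / normal_pdf c s x)%:E = (2 * s ^- 4)%:E)%E.
Proof.
move=> s0.
transitivity (\int[mu]_x (quart (s ^- 4) 0 (-2 * s ^- 4) 0 (s ^- 4) ((x - c) / s) * normal_pdf c s x)%:E)%E.
  apply: eq_integral => x _; congr EFin; rewrite /quart /npdf2.
  by field; rewrite !gt_eqF// normal_pdf_gt0.
by rewrite integral_quart//; congr EFin; ring.
Qed.

(* Error of the trapezoidal rule for the derivative of the normal density
   between the centers c - e and c. *)
Definition trapez c s e x := npdf1 c s x - npdf1 (c - e) s x
  + e / 2 * (npdf2 c s x + npdf2 (c - e) s x).

Lemma normal_pdf_shift c s e x : 0 < s ->
  normal_pdf (c - e) s x =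
    normal_pdf c s x * expR (- ((x - c) / s * (e / s)) - (e / s) ^+ 2 / 2).
Proof.
move=> s0; rewrite !normal_pdf_zE// -[RHS]mulrA -expRD; congr (_ * expR _).
by field; rewrite gt_eqF.
Qed.

Lemma quadM (a0 a1 a2 b0 b1 b2 t : R) :
  (a0 + a1 * t + a2 * t ^+ 2) * (b0 + b1 * t + b2 * t ^+ 2) =
  quart (a0 * b0) (a0 * b1 + a1 * b0) (a0 * b2 + a1 * b1 + a2 * b0)
        (a1 * b2 + a2 * b1) (a2 * b2) t.
Proof. by rewrite /quart; ring. Qed.

(** Expanding the square over the density at c gives three terms, carried by the density at c, the
    density at c - e, and the quotient n(c - e)^2 / n(c), which is exp q times the density at c - 2
    e. In the variable standardised at its own centre each has a quartic coefficient ([q1], [q2],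
    [q3]), so Gaussian moments finish. *)
Lemma integral_trapez_sqr c s e : 0 < s -> let q := (e / s) ^+ 2 in
  (\int[mu]_x (trapez c s e x ^+ 2 / normal_pdf c s x)%:E =
   (s ^- 2 * (expR q * (1 - q / 2 + q ^+ 3 / 4) - 1 - q / 2))%:E)%E.
Proof.
move=> s0 q; pose t := e / s.
have n0 d x : normal_pdf d s x != 0 by rewrite gt_eqF// normal_pdf_gt0.
pose q1 (y : R) := (- (t / 2) + -1 * y + t / 2 * y ^+ 2) * (- (t / 2) + -1 * y + t / 2 * y ^+ 2).
pose q2 (y : R) := (t / 2 + t ^+ 3 / 2 + (-1 - t ^+ 2) * y + t / 2 * y ^+ 2)
   * (- (t / 2) + 1 * y + t / 2 * y ^+ 2).
pose q3 (y : R) := (- (3 / 2 * t) + t ^+ 3 / 2 + (1 - t ^+ 2) * y + t / 2 * y ^+ 2)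
   * (- (3 / 2 * t) + t ^+ 3 / 2 + (1 - t ^+ 2) * y + t / 2 * y ^+ 2).
have E x : trapez c s e x ^+ 2 / normal_pdf c s x = s ^- 2 *
    (q1 ((x - c) / s) * normal_pdf c s x
     + 2 * (q2 ((x - (c - e)) / s) * normal_pdf (c - e) s x)
     + expR q * (q3 ((x - (c - 2 * e)) / s) * normal_pdf (c - 2 * e) s x)).
  have -> : normal_pdf (c - 2 * e) s x = normal_pdf (c - e) s x ^+ 2 / normal_pdf c s x / expR q.
    rewrite (normal_pdf_shift c (2 * e))// (normal_pdf_shift c e)//.
    have -> : expR (- ((x - c) / s * (2 * e / s)) - (2 * e / s) ^+ 2 / 2) =
        expR (- ((x - c) / s * (e / s)) - (e / s) ^+ 2 / 2) ^+ 2 / expR q.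
      rewrite -expRM_natl -expRN -expRD; congr expR; rewrite /q; field.
      by rewrite gt_eqF.
    by field; rewrite n0 gt_eqF// expR_gt0.
  rewrite /trapez /npdf1 /npdf2 /q1 /q2 /q3 /t; field.
  by rewrite n0 !gt_eqF ?expR_gt0.
under eq_integral do rewrite E.
pose I d := fun c0 c1 c2 c3 c4 => @integrable_quart R d s s0 c0 c1 c2 c3 c4.
have IZ (k : R) (f : R -> R) : mu.-integrable setT (fun x => (f x)%:E) ->
    mu.-integrable setT (fun x => (k * f x)%:E).
  by move=> If; under eq_fun do rewrite EFinM; exact: integrableZl.
have JZ (k : R) (f : R -> R) : mu.-integrable setT (fun x => (f x)%:E) ->
    (\int[mu]_x (k * f x)%:E = k%:E * \int[mu]_x (f x)%:E)%E.
  by move=> If; under eq_integral do rewrite EFinM; exact: integralZl.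
have JD (f g : R -> R) : mu.-integrable setT (fun x => (f x)%:E) ->
    mu.-integrable setT (fun x => (g x)%:E) ->
    (\int[mu]_x (f x + g x)%:E = \int[mu]_x (f x)%:E + \int[mu]_x (g x)%:E)%E.
  by move=> If Ig; under eq_integral do rewrite EFinD; exact: integralD.
have ID (f g : R -> R) : mu.-integrable setT (fun x => (f x)%:E) ->
    mu.-integrable setT (fun x => (g x)%:E) -> mu.-integrable setT (fun x => (f x + g x)%:E).
  by move=> If Ig; under eq_fun do rewrite EFinD; exact: integrableD.
have I1 : mu.-integrable setT (fun x => (q1 ((x - c) / s) * normal_pdf c s x)%:E).
  by under eq_fun do rewrite /q1 quadM; exact: I.
have I2 : mu.-integrable setT (fun x => (q2 ((x - (c - e)) / s) * normal_pdf (c - e) s x)%:E).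
  by under eq_fun do rewrite /q2 quadM; exact: I.
have I3 : mu.-integrable setT (fun x => (q3 ((x - (c - 2 * e)) / s) * normal_pdf (c - 2 * e) s x)%:E).
  by under eq_fun do rewrite /q3 quadM; exact: I.
have I12 := ID _ _ I1 (IZ 2 _ I2).
have I123 := ID _ _ I12 (IZ (expR q) _ I3).
rewrite (JZ _ _ I123) (JD _ _ I12 (IZ (expR q) _ I3)) (JD _ _ I1 (IZ 2 _ I2)).
rewrite (JZ _ _ I2) (JZ _ _ I3).
have -> : (\int[mu]_x (q1 ((x - c) / s) * normal_pdf c s x)%:E = (1 + t ^+ 2 / 2)%:E)%E.
  by under eq_integral do rewrite /q1 quadM; rewrite integral_quart//; congr EFin; field.
have -> : (\int[mu]_x (q2 ((x - (c - e)) / s) * normal_pdf (c - e) s x)%:E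
    = (- 1 - t ^+ 2 / 2)%:E)%E.
  by under eq_integral do rewrite /q2 quadM; rewrite integral_quart//; congr EFin; field.
have -> : (\int[mu]_x (q3 ((x - (c - 2 * e)) / s) * normal_pdf (c - 2 * e) s x)%:E
    = (1 - t ^+ 2 / 2 + t ^+ 6 / 4)%:E)%E.
  by under eq_integral do rewrite /q3 quadM; rewrite integral_quart//; congr EFin; field.
transitivity ((s ^- 2 * (1 + t ^+ 2 / 2 + 2 * (- 1 - t ^+ 2 / 2)
  + expR q * (1 - t ^+ 2 / 2 + t ^+ 6 / 4)))%:E); first by [].
by congr (_ * _)%:E; rewrite /q -/t; field.
Qed.

Lemma ge0_is_derive_le (f df : R -> R) (a b : R) : a <= b ->
    (forall x : R, a <= x <= b -> is_derive x 1 f (df x)) ->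
    (forall x, a <= x <= b -> 0 <= df x) -> f a <= f b.
Proof.
move=> ab dfE df0.
have sub x : x \in `]a, b[ -> a <= x <= b.
  by rewrite in_itv/= => /andP[/ltW -> /ltW ->].
have cf : {within `[a, b], continuous f}.
  apply: derivable_within_continuous => x; rewrite in_itv/= => xab.
  by case: (dfE x xab).
have [c cab E] := MVT_segment ab (fun x xab => dfE x (sub x xab)) cf.
by rewrite -subr_ge0 E mulr_ge0 ?subr_ge0// df0//; move: cab; rewrite in_itv.
Qed.

(** With 1/18 in place of the Taylor coefficient 1/24, the polynomial times exp (- x) has derivative
    exp (- x) x^3 (1 - x) / 18, nonnegative exactly on the range of interest. *)
Lemma expR_le_quart (q : R) : 0 <= q <= 1 ->
  expR q <= 1 + q + q ^+ 2 / 2 + q ^+ 3 / 6 + q ^+ 4 / 18.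
Proof.
move=> /andP[q0 q1].
pose p (x : R) := expR (- x) * (1 + x + x ^+ 2 / 2 + x ^+ 3 / 6 + x ^+ 4 / 18).
have : p 0 <= p q.
  apply: (@ge0_is_derive_le p (fun x => expR (- x) * (x ^+ 3 * ((1 - x) / 18)))) => //.
    move=> x _; rewrite /p; apply: is_derive_eq.
    by rewrite /GRing.scale/=; field.
  move=> x /andP[x0 xq]; rewrite mulr_ge0 ?expR_ge0// mulr_ge0 ?exprn_ge0//.
  by rewrite divr_ge0// subr_ge0 (le_trans xq).
rewrite {1}/p oppr0 expR0 !expr0n/= !mul0r !addr0 mulr1 /p => h.
by rewrite -(ler_pM2l (expR_gt0 (- q))) [leLHS]mulrC expRxMexpNx_1.
Qed.

(* The Taylor expansion at 0 starts with q^3 / 6. *)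
Lemma trapez_norm_le (q : R) : 0 <= q <= 1 ->
  expR q * (1 - q / 2 + q ^+ 3 / 4) - 1 - q / 2 <= 3 / 5 * q ^+ 3.
Proof.
move=> /andP[q0 q1].
have := expR_le_quart (introT andP (conj q0 q1)).
have c0 : 0 <= 1 - q / 2 + q ^+ 3 / 4.
  by rewrite addr_ge0 ?divr_ge0 ?exprn_ge0// subr_ge0; lra.
move=> /(ler_wpM2r c0) h; rewrite -subr_ge0.
have {}h : expR q * (1 - q / 2 + q ^+ 3 / 4) - 1 - q / 2 <=
    q ^+ 3 * (1 / 6 + 2 / 9 * q + 7 / 72 * q ^+ 2 + q ^+ 3 / 24 + q ^+ 4 / 72).
  by apply: (le_trans (lerB (lerB h (lexx 1)) (lexx (q / 2)))); apply: le_of_eq; field.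
rewrite subr_ge0 (le_trans h)// mulrC ler_wpM2r ?exprn_ge0//.
(* On [0, 1] the bracket is at most the sum of its coefficients, 39/72 < 3/5. *)
have q2 : q ^+ 2 <= 1 by rewrite expr_le1.
have q3 : q ^+ 3 <= 1 by rewrite expr_le1.
have q4 : q ^+ 4 <= 1 by rewrite expr_le1.
by lra.
Qed.

End GaussianNorms.

(** * Hellinger distance along a path of densities *)

Section HellingerPath.
Context (R : realType).
Notation mu := (@lebesgue_measure R).

(** Inversion is not continuous at 0, but [powR] is measurable; g times the power -1 of g^2 equals
    the inverse of g, both sides being 0 where g vanishes. *)
Lemma measurable_funV d (T : measurableType d) (g : T -> R) :
  measurable_fun [set: T] g -> measurable_fun [set: T] (fun x => (g x)^-1).
Proof.
move=> mg; have -> : (fun x => (g x)^-1) = (fun x => g x * (g x ^+ 2) `^ (-1)).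
  apply/funext => x; rewrite powR_inv1 ?sqr_ge0//.
  have [->|gx0] := eqVneq (g x) 0; first by rewrite invr0 mul0r.
  by field.
apply: measurable_funM => //; apply: (measurableT_comp (measurable_powR _)).
exact: measurable_funX.
Qed.

Lemma measurable_fun_sqrt d (T : measurableType d) (g : T -> R) :
  measurable_fun [set: T] g -> measurable_fun [set: T] (fun x => Num.sqrt (g x)).
Proof.
move=> mg; apply: measurableT_comp mg; apply: continuous_measurable_fun.
exact: sqrt_continuous.
Qed.

(** Cauchy-Schwarz for the integral of f' / (2 sqrt f) with weight w, obtained pointwise. For any
    constant c the function [2 c sqrt f - c^2 Om] has derivative at most f'^2 / (4 f w), by
    completing a square; integrating and taking the optimal c, the increment of sqrt f over that of
    Om, gives the claim. *)
Lemma sqrt_increment_le (f df w Om : R -> R) (a b : R) : a < b ->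
    (forall r, a <= r <= b -> 0 < f r) ->
    (forall r : R, a <= r <= b -> is_derive r 1 f (df r)) ->
    (forall r, a <= r <= b -> {for r, continuous df}) ->
    (forall r, a <= r <= b -> 0 < w r) ->
    (forall r : R, a <= r <= b -> is_derive r 1 Om (w r)) ->
    (forall r, a <= r <= b -> {for r, continuous w}) ->
  (((Num.sqrt (f b) - Num.sqrt (f a)) ^+ 2)%:E <=
   (Om b - Om a)%:E * \int[mu]_(r in `[a, b]) (df r ^+ 2 / (4 * f r * w r))%:E)%E.
Proof.
move=> ab f0 Hf cdf w0 HOm cw.
have inab x : x \in `]a, b[ -> a <= x <= b.
  by rewrite in_itv/= => /andP[/ltW -> /ltW ->].
have inabc x : x \in `[a, b]%classic -> a <= x <= b.
  by rewrite inE/= in_itv.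
have within (g : R -> R) : (forall r, a <= r <= b -> {for r, continuous g}) ->
    {within `[a, b], continuous g}.
  by move=> cg; apply: continuous_in_subspaceT => x /inabc; exact: cg.
have dc (g : R -> R) (dg : R) (r : R) : is_derive r 1 g dg -> {for r, continuous g}.
  by move=> [dg1 _]; exact/differentiable_continuous/derivable1_diffP.
have cOm : {within `[a, b], continuous Om} by apply: within => r /HOm /dc.
have Omlt : Om a < Om b.
  have [c cab E] := MVT_segment (ltW ab) (fun x xab => HOm x (inab x xab)) cOm.
  by rewrite -subr_gt0 E mulr_gt0 ?subr_gt0// w0//; move: cab; rewrite in_itv.
set De := Num.sqrt (f b) - Num.sqrt (f a).
set O := Om b - Om a.
have O0 : 0 < O by rewrite subr_gt0.
pose c : R := De / O.
pose z (r : R) : R := 2 * c * Num.sqrt (f r) - c ^+ 2 * Om r.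
pose dz (r : R) : R := c * (df r / Num.sqrt (f r)) - c ^+ 2 * w r.
have Hz (r : R) : a <= r <= b -> is_derive r 1 z (dz r).
  move=> rab; have s0 := f0 r rab.
  have sq0 : Num.sqrt (f r) != 0 by rewrite gt_eqF// sqrtr_gt0.
  have d1 : is_derive r 1 (fun r => Num.sqrt (f r)) ((2 * Num.sqrt (f r))^-1 * df r).
    exact: (@is_derive1_comp R Num.sqrt f r _ _ (is_derive1_sqrt s0) (Hf r rab)).
  have d2 := HOm r rab.
  rewrite /z; apply: is_derive_eq.
  by rewrite /dz /GRing.scale/=; field; rewrite sq0.
have csqrt (r : R) : a <= r <= b -> {for r, continuous (fun r => Num.sqrt (f r))}.
  by move=> rab; apply: continuous_comp; [exact: dc (Hf r rab)|exact: sqrt_continuous].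
have cdz : {within `[a, b], continuous dz}.
  apply: within => r rab; apply: cvgB; apply: cvgM; try exact: cvg_cst; last exact: cw.
  apply: cvgM; first exact: cdf.
  by apply: cvgV; [rewrite gt_eqF// sqrtr_gt0 f0|exact: csqrt].
have cz : {within `[a, b], continuous z} by apply: within => r /Hz /dc.
have FTC : (\int[mu]_(r in `[a, b]) (dz r)%:E = (z b)%:E - (z a)%:E)%E.
  apply: continuous_FTC2 => //.
    split.
    + by move=> x /inab /Hz [].
    + by apply: cvg_at_right_filter; apply: dc (Hz a _); rewrite lexx ltW.
    + by apply: cvg_at_left_filter; apply: dc (Hz b _); rewrite lexx ltW.
  by move=> x xab; rewrite derive1E; case: (Hz x (inab x xab)).
have Ek : ((z b)%:E - (z a)%:E = (De ^+ 2 / O)%:E)%E.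
  rewrite -EFinB; congr EFin; rewrite /z.
  transitivity (2 * c * De - c ^+ 2 * O); first by rewrite /De /O; ring.
  by rewrite /c; field; rewrite gt_eqF.
pose k r := df r ^+ 2 / (4 * f r * w r).
have cint : {within `[a, b], continuous k}.
  apply: within => r rab; apply: cvgM.
    by apply: continuous_comp (cdf r rab) (@exprn_continuous _ 2 _).
  apply: cvgV; first by rewrite gt_eqF// !mulr_gt0 ?f0 ?w0.
  apply: cvgM; last exact: cw.
  by apply: cvgM; [exact: cvg_cst|exact: dc (Hf r rab)].
have Eint : ((De ^+ 2 / O)%:E <= \int[mu]_(r in `[a, b]) (k r)%:E)%E.
  rewrite -Ek -FTC; apply: le_integral => //.
  - by apply: continuous_compact_integrable => //; exact: segment_compact.
  - by apply: continuous_compact_integrable => //; exact: segment_compact.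
  - move=> r /inabc rab; rewrite lee_fin /dz /k -subr_ge0.
    have s0 : 0 < Num.sqrt (f r) by rewrite sqrtr_gt0 f0.
    have -> : df r ^+ 2 / (4 * f r * w r) = df r ^+ 2 / (4 * Num.sqrt (f r) ^+ 2 * w r).
      by rewrite sqr_sqrtr// ltW// f0.
    rewrite (_ : _ - _ = (df r / (2 * Num.sqrt (f r)) - c * w r) ^+ 2 / w r).
      by rewrite divr_ge0 ?sqr_ge0 ?ltW ?w0.
    by field; rewrite !gt_eqF ?w0.
have -> : (De ^+ 2)%:E = (O%:E * (De ^+ 2 / O)%:E)%E.
  by rewrite -EFinM; congr EFin; field; rewrite gt_eqF.
by rewrite lee_wpmul2l// lee_fin ltW.
Qed.

(** Integrate [sqrt_increment_le] over x and exchange the integrals: the inner one is at most w^2 /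
    (4 w) = w / 4, whose integral is a quarter of the increment of Om. *)
Lemma hellinger_path (F D : R -> R -> R) (w Om : R -> R) (a b : R) : a < b ->
    (forall r x, a <= r <= b -> 0 < F r x) ->
    (forall r x : R, a <= r <= b -> is_derive r 1 (F^~ x) (D r x)) ->
    (forall r x, a <= r <= b -> {for r, continuous (D^~ x)}) ->
    measurable_fun [set: R * R] (fun p => F p.1 p.2) ->
    measurable_fun [set: R * R] (fun p => D p.1 p.2) ->
    (forall r, a <= r <= b -> 0 < w r) ->
    (forall r : R, a <= r <= b -> is_derive r 1 Om (w r)) ->
    (forall r, a <= r <= b -> {for r, continuous w}) ->
    measurable_fun [set: R] w ->
    (forall r, a <= r <= b ->
      (\int[mu]_x (D r x ^+ 2 / F r x)%:E <= (w r ^+ 2)%:E)%E) ->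
  (\int[mu]_x ((Num.sqrt (F b x) - Num.sqrt (F a x)) ^+ 2)%:E <=
   (((Om b - Om a) / 2) ^+ 2)%:E)%E.
Proof.
move=> ab F0 HF cD mF mD w0 HOm cw mw bound.
have inabc x : x \in `[a, b]%classic -> a <= x <= b by rewrite inE/= in_itv.
(* The indicator makes the integrand nonnegative on the whole plane, where nothing is known outside
   [a, b]; Tonelli then applies to full products. *)
pose K (p : R * R) : \bar R :=
  (D p.1 p.2 ^+ 2 / (4 * F p.1 p.2 * w p.1) * \1_(`[a, b]%classic) p.1)%:E.
have mw1 : measurable_fun [set: R * R] (fun p => w p.1).
  by apply: measurableT_comp mw _; exact: measurable_fst.
have mK : measurable_fun [set: R * R] K.
  apply/measurable_EFinP/measurable_funM.
    apply: measurable_funM; first exact: measurable_funX.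
    apply: measurable_funV; apply: measurable_funM mw1.
    by apply: measurable_funM mF; exact: measurable_cst.
  have m1 : measurable_fun [set: R] (fun r : R => \1_(`[a, b]%classic) r : R).
    by apply: measurable_indic; exact: measurable_itv.
  exact: (measurableT_comp m1 measurable_fst).
have K0 p : (0 <= K p)%E.
  rewrite lee_fin /K indicE; case: (boolP (p.1 \in _)) => [/inabc pab|_].
    by rewrite mulr1 divr_ge0 ?sqr_ge0// !mulr_ge0// ltW ?F0 ?w0.
  by rewrite mulr0.
have Om_ab : 0 <= Om b - Om a.
  rewrite subr_ge0; apply: (@ge0_is_derive_le R Om w) => //; first exact: ltW.
  by move=> x /w0 /ltW.
have mKr : measurable_fun [set: R] (fun x => \int[mu]_r K (r, x))%E.
  exact: (@measurable_fun_fubini_tonelli_G _ _ _ _ R mu K mK K0).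
have mKx : measurable_fun [set: R] (fun r => \int[mu]_x K (r, x))%E.
  exact: (@measurable_fun_fubini_tonelli_F _ _ _ _ R mu K mK K0).
have mFr r : measurable_fun [set: R] (F r).
  exact: (@measurable_fun_pair2 _ _ _ _ _ _ (fun p : R * R => F p.1 p.2) r mF).
have mDr r : measurable_fun [set: R] (D r).
  exact: (@measurable_fun_pair2 _ _ _ _ _ _ (fun p : R * R => D p.1 p.2) r mD).
apply: (@le_trans _ _ (\int[mu]_x ((Om b - Om a)%:E * \int[mu]_r K (r, x)))%E).
  apply: ge0_le_integral => //.
  - by move=> x _; rewrite lee_fin sqr_ge0.
  - apply/measurable_EFinP/measurable_funX/measurable_funB; apply: measurable_fun_sqrt; exact: mFr.
  - exact: measurable_funeM.
  - move=> x _.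
    have := @sqrt_increment_le (F^~ x) (D^~ x) w Om a b ab (fun r => F0 r x) (fun r => HF r x)
      (fun r => cD r x) w0 HOm cw.
    move=> /le_trans; apply; rewrite lee_wpmul2l// ?lee_fin//.
    rewrite integral_mkcond; apply: le_of_eq.
    apply: eq_integral => r _; rewrite /K/= indicE patchE.
    by case: ifP; rewrite ?mulr1 ?mulr0.
rewrite ge0_integralZl//; last by move=> x _; apply: integral_ge0.
have -> : (\int[mu]_x \int[mu]_r K (r, x) = \int[mu]_r \int[mu]_x K (r, x))%E.
  by apply/esym; exact: (@fubini_tonelli _ _ _ _ R mu mu K mK K0).
have FTC : (\int[mu]_(r in `[a, b]) (w r / 4)%:E = ((Om b - Om a) / 4)%:E)%E.
  have dOm4 (r : R) : a <= r <= b -> is_derive r 1 (fun r => Om r / 4) (w r / 4).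
    move=> rab; have d1 := HOm r rab; apply: is_derive_eq.
    by rewrite /GRing.scale/=; field.
  have cOm4 (r : R) : a <= r <= b -> {for r, continuous (fun r => Om r / 4)}.
    by move=> /dOm4 [d1 _]; exact/differentiable_continuous/derivable1_diffP.
  rewrite (@continuous_FTC2 _ _ (fun r => Om r / 4))//.
  - by rewrite -EFinB -mulrBl.
  - apply: continuous_in_subspaceT => x /inabc xab.
    by apply: cvgM; [exact: cw|exact: cvg_cst].
  - split.
    + by move=> x; rewrite in_itv/= => /andP[/ltW ax /ltW xb]; case: (dOm4 x); rewrite ?ax.
    + by apply: cvg_at_right_filter; apply: cOm4; rewrite lexx ltW.
    + by apply: cvg_at_left_filter; apply: cOm4; rewrite lexx ltW.
  - move=> x; rewrite in_itv/= => /andP[/ltW ax /ltW xb]; rewrite derive1E.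
    by case: (dOm4 x) => //; rewrite ax.
apply: (@le_trans _ _ ((Om b - Om a)%:E * \int[mu]_(r in `[a, b]) (w r / 4)%:E)%E).
  rewrite lee_wpmul2l// ?lee_fin//.
  rewrite [leRHS]integral_mkcond; apply: ge0_le_integral => //.
  - by move=> r _; apply: integral_ge0.
  - apply/(measurable_restrictT _ _).1 => //.
    by apply/measurable_EFinP/measurable_funM => //; exact: measurable_funTS.
  - move=> r _; rewrite patchE /K/= indicE; case: ifPn => rab; last first.
      by under eq_integral do rewrite mulr0; rewrite integral0.
    have {}rab := inabc _ rab.
    under eq_integral do rewrite mulr1.
    have -> : (\int[mu]_x (D r x ^+ 2 / (4 * F r x * w r))%:E =
       ((4 * w r)^-1)%:E * \int[mu]_x (D r x ^+ 2 / F r x)%:E)%E.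
      rewrite -ge0_integralZl//.
      + apply: eq_integral => x _; rewrite -EFinM; congr EFin; field.
        by rewrite !gt_eqF ?F0 ?w0.
      + apply/measurable_EFinP/measurable_funM.
          by apply: measurable_funX; exact: mDr.
        by apply: measurable_funV; exact: mFr.
      + by move=> x _; rewrite lee_fin divr_ge0 ?sqr_ge0// ltW ?F0.
      + by rewrite lee_fin invr_ge0 mulr_ge0// ltW ?w0.
    apply: (@le_trans _ _ (((4 * w r)^-1)%:E * (w r ^+ 2)%:E)%E).
      by rewrite lee_wpmul2l ?bound// lee_fin invr_ge0 mulr_ge0// ltW ?w0.
    rewrite -EFinM lee_fin; apply: le_of_eq; field.
    by rewrite gt_eqF ?w0.
rewrite FTC -EFinM lee_fin; apply: le_of_eq.
by field.
Qed.

End HellingerPath.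

(** * Gaussian mixtures *)

Section DerivativeUnderExpectation.
Context d (W : measurableType d) (R : realType) (P : probability W R).

Lemma is_derive_Ex (f df : R -> W -> R) (a l h M : R) : l < a < h ->
    (forall r, l < r < h -> bmf (f r)) ->
    (forall (r : R) w, l < r < h -> is_derive r 1 (f^~ w) (df r w)) ->
    (forall r w, l < r < h -> `|df r w| <= M) ->
  is_derive a 1 (fun r => Ex P (f r)) (Ex P (df a)).
Proof.
move=> alh bf Hf dfM.
have inlh (x : R) : `]l, h[%classic x -> l < x < h by rewrite /= in_itv.
have Ia : `]l, h[%classic a by rewrite /= in_itv.
have E x w : `]l, h[%classic x -> partial1of2 f x w = df x w.
  by move=> /inlh xlh; rewrite /partial1of2 derive1E; case: (Hf x w xlh).
have H1 x : `]l, h[%classic x -> P.-integrable [set: W] (EFin \o f x).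
  by move=> /inlh xlh; apply: bmf_int; exact: bf.
have H2 x y : `]l, h[%classic x -> [set: W] y -> derivable (f ^~ y) x 1.
  by move=> /inlh xlh _; case: (Hf x y xlh).
have M0 : 0 <= `|M| by [].
have H3 x y : `]l, h[%classic x -> [set: W] y -> `|partial1of2 f x y| <= `|M|.
  by move=> xI _; rewrite E// (le_trans (dfM x y (inlh _ xI)))// ler_norm.
have iM := bmf_int P (bmf_cst W `|M|).
split.
  exact: (@derivable_under_integral R _ W P f setT measurableT a l h Ia H1 H2 (fun=> `|M|) (fun=> M0) iM H3).
have := @differentiation_under_integral R _ W P f setT measurableT a l h Ia H1 H2 (fun=> `|M|) (fun=> M0) iM H3.
rewrite derive1E => ->; apply: eq_Rintegral => w _.
exact: E.
Qed.

Lemma continuous_Ex (f : R -> W -> R) (a l h M : R) : l < a < h ->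
    (forall r, l < r < h -> bmf (f r)) ->
    (forall r w, l < r < h -> {for r, continuous (f^~ w)}) ->
    (forall r w, l < r < h -> `|f r w| <= M) ->
  {for a, continuous (fun r => Ex P (f r))}.
Proof.
move=> alh bf cf fM.
have inlh (x : R) : `]l, h[%classic x -> l < x < h by rewrite /= in_itv.
have Ia : a \in `]l, h[%classic by rewrite inE /= in_itv.
have H1 x : `]l, h[%classic x -> P.-integrable [set: W] (EFin \o f x).
  by move=> /inlh xlh; apply: bmf_int; exact: bf.
have H2 : {ae P, forall y, [set: W] y -> {in `]l, h[%classic, continuous (f ^~ y)}}.
  by apply: aeW => y _ x; rewrite inE => /inlh xlh; exact: cf.
have H3 x : `]l, h[%classic x -> {ae P, forall y, [set: W] y -> `|f x y| <= M}.
  by move=> /inlh xlh; apply: aeW => y _; exact: fM.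
exact: (@continuity_under_integral R _ W P f setT measurableT l h H1 H2 (fun=> M) (bmf_int P (bmf_cst W M)) H3 a Ia).
Qed.

End DerivativeUnderExpectation.

Section Kernel.
Context (R : realType).
Implicit Types r u x m s : R.

(* Density at x of r u + sqrt (1 - r^2) Z, for -1 < r < 1. *)
Definition gk r u x := (Num.sqrt (2 * pi * (1 - r ^+ 2)))^-1 *
  expR (- ((x - r * u) ^+ 2 / (2 * (1 - r ^+ 2)))).

Definition sg r := Num.sqrt (1 - r ^+ 2).

Lemma onem_sqr_gt0 r : -1 < r < 1 -> 0 < 1 - r ^+ 2.
Proof. by move=> /andP[r1 r2]; nra. Qed.

Lemma sg_gt0 r : -1 < r < 1 -> 0 < sg r.
Proof. by move=> /onem_sqr_gt0; rewrite sqrtr_gt0. Qed.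

Lemma sqr_sgE r : -1 < r < 1 -> sg r ^+ 2 = 1 - r ^+ 2.
Proof. by move=> /onem_sqr_gt0 /ltW; exact: sqr_sqrtr. Qed.

Lemma gkE r u x : -1 < r < 1 -> gk r u x = normal_pdf (r * u) (sg r) x.
Proof.
move=> r1; have s0 := sg_gt0 r1.
rewrite normal_pdfE ?gt_eqF// /normal_peak /normal_fun /gk sqr_sgE//.
congr ((Num.sqrt _)^-1 * expR _); first by rewrite -[in RHS]mulr_natr; ring.
rewrite -[in RHS]mulr_natr; field.
by rewrite gt_eqF// onem_sqr_gt0.
Qed.

(** Chain rule for the normal density of mean r u and variance 1 - r^2: its derivative in the mean
    is [- npdf1], and by the heat equation its derivative in the variance is [npdf2 / 2]. *)
Definition dgk r u x := - u * npdf1 (r * u) (sg r) x - r * npdf2 (r * u) (sg r) x.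

Lemma dgkE r u x : -1 < r < 1 -> dgk r u x = gk r u x *
  (u * (x - r * u) / (1 - r ^+ 2)
   - r * ((x - r * u) ^+ 2 - (1 - r ^+ 2)) / (1 - r ^+ 2) ^+ 2).
Proof.
move=> r1; rewrite gkE// /dgk /npdf1 /npdf2 -!sqr_sgE//; field.
by rewrite gt_eqF// sg_gt0.
Qed.

Lemma is_derive_gk r u x : -1 < r < 1 -> is_derive r 1 (fun r => gk r u x) (dgk r u x).
Proof.
move=> r1; have v0 := onem_sqr_gt0 r1.
have c0 : 0 < 2 * pi * (1 - r ^+ 2) by rewrite !mulr_gt0// pi_gt0.
have sq0 : Num.sqrt (2 * pi * (1 - r ^+ 2)) != 0 by rewrite gt_eqF// sqrtr_gt0.
have d0 : is_derive r 1 (fun r => 2 * pi * (1 - r ^+ 2)) (- (4 * pi * r)).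
  by apply: is_derive_eq; rewrite /GRing.scale/=; ring.
have d1 : is_derive r 1 (fun r => Num.sqrt (2 * pi * (1 - r ^+ 2)))
    ((2 * Num.sqrt (2 * pi * (1 - r ^+ 2)))^-1 * - (4 * pi * r)).
  exact: (@is_derive1_comp R Num.sqrt _ r _ _ (is_derive1_sqrt c0) d0).
have d2 := @is_deriveV R (fun r => Num.sqrt (2 * pi * (1 - r ^+ 2))) r _ 1 sq0 d1.
have d3 : is_derive r 1 (fun r => 2 * (1 - r ^+ 2)) (- (4 * r)).
  by apply: is_derive_eq; rewrite /GRing.scale/=; ring.
have v20 : 2 * (1 - r ^+ 2) != 0 by rewrite mulf_neq0// gt_eqF.
have d4 := @is_deriveV R (fun r => 2 * (1 - r ^+ 2)) r _ 1 v20 d3.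
have d5 : is_derive r 1 (fun r => expR (- ((x - r * u) ^+ 2 * (2 * (1 - r ^+ 2))^-1)))
   (expR (- ((x - r * u) ^+ 2 * (2 * (1 - r ^+ 2))^-1)) *
    (u * (x - r * u) / (1 - r ^+ 2) - r * (x - r * u) ^+ 2 / (1 - r ^+ 2) ^+ 2)).
  apply: is_derive_eq; rewrite /GRing.scale/=; field.
  by rewrite gt_eqF.
rewrite dgkE// /gk; apply: is_derive_eq.
rewrite /GRing.scale/=.
have : Num.sqrt (2 * pi * (1 - r ^+ 2)) ^+ 2 = 2 * pi * (1 - r ^+ 2).
  by rewrite sqr_sqrtr// ltW.
move: sq0; set S := Num.sqrt _ => sq0 E.
have -> : 4 * pi * r = 2 * S ^+ 2 / (1 - r ^+ 2) * r.
  by rewrite E; field; rewrite gt_eqF.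
by field; rewrite sq0 gt_eqF.
Qed.

Lemma zpow_normal_pdf_le k m s x : 0 < s -> (k <= 4)%N ->
  `|(x - m) / s| ^+ k * normal_pdf m s x <= 100 / s.
Proof.
move=> s0 k4; apply: (le_trans (quartic_normal_le m s0 x k4)).
rewrite ler_wpM2l//.
have s2 : 0 < Num.sqrt 2 * s by rewrite mulr_gt0// sqrtr_gt0.
apply: (le_trans (normal_pdf_ub m x _)); first by rewrite gt_eqF.
rewrite /normal_peak lef_pV2 ?posrE//; last first.
  by rewrite sqrtr_gt0 mulrn_wgt0// mulr_gt0 ?pi_gt0// exprn_gt0.
rewrite -[leLHS](ger0_norm (ltW s0)) -sqrtr_sqr ler_wsqrtr// exprMn sqr_sqrtr//.
have ss0 := sqr_ge0 s; have p2 : 2 <= pi :> R by exact: pi_ge2.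
by rewrite -mulr_natr; nra.
Qed.

Lemma npdf1_le m s x : 0 < s -> `|npdf1 m s x| <= 100 / s ^+ 2.
Proof.
move=> s0; have := zpow_normal_pdf_le m x s0 (isT : (1 <= 4)%N).
rewrite expr1 => h; rewrite /npdf1 normrM normrN normrM.
rewrite [`|s^-1|]ger0_norm ?invr_ge0 ?(ltW s0)// [`|normal_pdf _ _ _|]ger0_norm ?normal_pdf_ge0//.
rewrite mulrAC [leRHS](_ : _ = 100 / s / s); last by field; rewrite gt_eqF.
by rewrite ler_wpM2r// invr_ge0 ltW.
Qed.

Lemma npdf2_le m s x : 0 < s -> `|npdf2 m s x| <= 200 / s ^+ 3.
Proof.
move=> s0; have h2 := zpow_normal_pdf_le m x s0 (isT : (2 <= 4)%N).
have h0 := zpow_normal_pdf_le m x s0 (isT : (0 <= 4)%N).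
move: h0 h2; rewrite expr0 mul1r; set n := normal_pdf m s x => h0 h2.
have n0 : 0 <= n by exact: normal_pdf_ge0.
rewrite /npdf2 -/n; set z := (x - m) / s in h2 *.
have -> : (z ^+ 2 - 1) / s ^+ 2 * n = (z ^+ 2 * n - n) / s ^+ 2.
  by field; rewrite gt_eqF.
rewrite normrM [`|(s ^+ 2)^-1|]ger0_norm ?invr_ge0 ?sqr_ge0//.
rewrite [leRHS](_ : _ = (100 / s + 100 / s) / s ^+ 2); last by field; rewrite gt_eqF.
rewrite ler_wpM2r ?invr_ge0 ?sqr_ge0// (le_trans (ler_normB _ _))//.
rewrite lerD//; last by rewrite ger0_norm.
have z2n : 0 <= z ^+ 2 * n by apply: mulr_ge0 => //; exact: sqr_ge0.
by rewrite (ger0_norm z2n) -(real_normK (num_real z)).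
Qed.

(** Uniform in x and in r on a compact part of (-1, 1): this is the domination for differentiating
    under the expectation. *)
Lemma dgk_le (c k r u x : R) : 0 <= c < 1 -> - c <= r <= c -> `|u| <= k ->
  `|dgk r u x| <= 100 * k / (1 - c ^+ 2) + 200 / Num.sqrt (1 - c ^+ 2) ^+ 3.
Proof.
move=> /andP[c0 c1] rc uk.
have r1 : -1 < r < 1 by lra.
have s0 := sg_gt0 r1.
have v0 : 0 < 1 - c ^+ 2 by nra.
have vr : 1 - c ^+ 2 <= sg r ^+ 2 by rewrite sqr_sgE//; nra.
have sr : Num.sqrt (1 - c ^+ 2) <= sg r.
  by rewrite -(@ler_pXn2r _ 2)// ?nnegrE ?sqrtr_ge0 ?(ltW s0)// sqr_sqrtr// ltW.
have k0 : 0 <= k by exact: le_trans uk.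
have sc0 : 0 < Num.sqrt (1 - c ^+ 2) by rewrite sqrtr_gt0.
rewrite /dgk (le_trans (ler_normB _ _))// lerD//.
  rewrite normrM normrN [leRHS](_ : _ = k * (100 / (1 - c ^+ 2))); last by field; rewrite gt_eqF.
  apply: ler_pM => //; apply: (le_trans (npdf1_le _ _ s0)).
  by rewrite ler_wpM2l// lef_pV2 ?posrE// exprn_gt0.
rewrite normrM -[leRHS]mul1r ler_pM//; first by rewrite ler_norml; lra.
apply: (le_trans (npdf2_le _ _ s0)).
by rewrite ler_wpM2l// lef_pV2 ?posrE ?exprn_gt0// lerXn2r// nnegrE ltW.
Qed.

Lemma gk_le (c r u x : R) : 0 <= c < 1 -> - c <= r <= c ->
  `|gk r u x| <= 100 / Num.sqrt (1 - c ^+ 2).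
Proof.
move=> /andP[c0 c1] rc.
have r1 : -1 < r < 1 by lra.
have s0 := sg_gt0 r1.
have v0 : 0 < 1 - c ^+ 2 by nra.
have vr : 1 - c ^+ 2 <= sg r ^+ 2 by rewrite sqr_sgE//; nra.
have sr : Num.sqrt (1 - c ^+ 2) <= sg r.
  by rewrite -(@ler_pXn2r _ 2)// ?nnegrE ?sqrtr_ge0 ?(ltW s0)// sqr_sqrtr// ltW.
rewrite gkE// ger0_norm ?normal_pdf_ge0//.
have := zpow_normal_pdf_le (r * u) x s0 (isT : (0 <= 4)%N).
rewrite expr0 mul1r => /le_trans; apply.
by rewrite ler_wpM2l// lef_pV2 ?posrE// sqrtr_gt0.
Qed.

Lemma gk_gt0 r u x : -1 < r < 1 -> 0 < gk r u x.
Proof. by move=> r1; rewrite gkE// normal_pdf_gt0// sg_gt0. Qed.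

(* The closed form dgkE, measurable everywhere. *)
Definition dgk' r u x : R := gk r u x * (u * (x - r * u) / (1 - r ^+ 2)
   - r * ((x - r * u) ^+ 2 - (1 - r ^+ 2)) / (1 - r ^+ 2) ^+ 2).

Lemma dgk'E r u x : -1 < r < 1 -> dgk' r u x = dgk r u x.
Proof. by move=> r1; rewrite dgkE. Qed.

Lemma continuous_dgk' r u x : -1 < r < 1 -> {for r, continuous (fun r => dgk' r u x)}.
Proof.
move=> r1; have v0 := onem_sqr_gt0 r1.
have ci : (fun y : R => y) y @[y --> r] --> r by exact: cvg_id.
have cc (a : R) : (fun=> a) y @[y --> r] --> a by exact: cvg_cst.
have cv : (1 - y ^+ 2) @[y --> r] --> 1 - r ^+ 2.
  by apply: cvgB => //; apply: continuous_comp ci (@exprn_continuous _ 2 _).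
have cy : (x - y * u) @[y --> r] --> x - r * u by apply: cvgB => //; exact: cvgM.
have cX (f : R -> R) : f y @[y --> r] --> f r -> (f y ^+ 2) @[y --> r] --> f r ^+ 2.
  by move=> cf; apply: continuous_comp cf (@exprn_continuous _ 2 _).
have cg : {for r, continuous (fun r => gk r u x)}.
  by have [d1 _] := is_derive_gk u x r1; exact/differentiable_continuous/derivable1_diffP.
apply: cvgM; first exact: cg.
apply: cvgB; apply: cvgM.
- exact: cvgM.
- by apply: cvgV => //; rewrite gt_eqF.
- by apply: cvgM => //; apply: cvgB => //; exact: (cX (fun y => x - y * u)).
- by apply: cvgV; [rewrite gt_eqF// exprn_gt0|exact: (cX (fun y => 1 - y ^+ 2))].
Qed.

End Kernel.

Section Mixture.
Context d (W : measurableType d) (R : realType) (P : probability W R).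
Variables (U : W -> R) (k : R).
Hypothesis mU : measurable_fun [set: W] U.
Hypothesis Uk : forall w, `|U w| <= k.

(* Density of r U + sqrt (1 - r^2) Z and its derivative in r. *)
Definition mix r x := Ex P (fun w => gk r (U w) x).
Definition dmix r x := Ex P (fun w => dgk r (U w) x).

Lemma measurable_gk : measurable_fun [set: W * (R * R)]
  (fun q => gk q.2.1 (U q.1) q.2.2).
Proof.
have mr : measurable_fun [set: W * (R * R)] (fun q => q.2.1).
  exact: (measurableT_comp measurable_fst measurable_snd).
have mx : measurable_fun [set: W * (R * R)] (fun q => q.2.2).
  exact: (measurableT_comp measurable_snd measurable_snd).
have mu' : measurable_fun [set: W * (R * R)] (fun q => U q.1).
  exact: (measurableT_comp mU measurable_fst).
have mv : measurable_fun [set: W * (R * R)] (fun q => 1 - q.2.1 ^+ 2).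
  by apply: measurable_funB => //; exact: measurable_funX.
apply: measurable_funM.
  apply: measurable_funV; apply: measurable_fun_sqrt.
  by apply: measurable_funM => //; exact: measurable_cst.
apply: measurableT_comp => //; apply: measurable_funN; apply: measurable_funM.
  by apply: measurable_funX; apply: measurable_funB => //; exact: measurable_funM.
by apply: measurable_funV; apply: measurable_funM => //; exact: measurable_cst.
Qed.

Lemma measurable_dgk' : measurable_fun [set: W * (R * R)]
  (fun q => dgk' q.2.1 (U q.1) q.2.2).
Proof.
have mr : measurable_fun [set: W * (R * R)] (fun q => q.2.1).
  exact: (measurableT_comp measurable_fst measurable_snd).
have mx : measurable_fun [set: W * (R * R)] (fun q => q.2.2).
  exact: (measurableT_comp measurable_snd measurable_snd).
have mu' : measurable_fun [set: W * (R * R)] (fun q => U q.1).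
  exact: (measurableT_comp mU measurable_fst).
have mv : measurable_fun [set: W * (R * R)] (fun q => 1 - q.2.1 ^+ 2).
  by apply: measurable_funB => //; exact: measurable_funX.
have my : measurable_fun [set: W * (R * R)] (fun q => q.2.2 - q.2.1 * U q.1).
  by apply: measurable_funB => //; exact: measurable_funM.
apply: measurable_funM; first exact: measurable_gk.
apply: measurable_funB.
  by apply: measurable_funM; [exact: measurable_funM|exact: measurable_funV].
apply: measurable_funM; last by apply: measurable_funV; exact: measurable_funX.
by apply: measurable_funM => //; apply: measurable_funB => //; exact: measurable_funX.
Qed.

Lemma measurable_mix : measurable_fun [set: R * R] (fun p => mix p.1 p.2).
Proof. exact: (@measurable_Ex _ _ _ _ R P _ measurable_gk). Qed.

Definition dmix' r x := Ex P (fun w => dgk' r (U w) x).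

Lemma measurable_dmix' : measurable_fun [set: R * R] (fun p => dmix' p.1 p.2).
Proof. exact: (@measurable_Ex _ _ _ _ R P _ measurable_dgk'). Qed.

Lemma dmix'E r x : -1 < r < 1 -> dmix' r x = dmix r x.
Proof. by move=> r1; apply: eq_Rintegral => w _; rewrite dgkE. Qed.

Lemma bmf_gk r x : -1 < r < 1 -> bmf (fun w => gk r (U w) x).
Proof.
move=> r1; split.
  have mp : measurable_fun [set: W] (fun w => (w, (r, x))).
    by apply: measurable_fun_pair => //; exact: measurable_id.
  exact: (measurableT_comp measurable_gk mp).
exists (100 / Num.sqrt (1 - `|r| ^+ 2)) => w; apply: gk_le.
  by rewrite normr_ge0/= ltr_norml.
by rewrite -ler_norml.
Qed.

Lemma bmf_dgk r x : -1 < r < 1 -> bmf (fun w => dgk r (U w) x).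
Proof.
move=> r1; split.
  have mp : measurable_fun [set: W] (fun w => (w, (r, x))).
    by apply: measurable_fun_pair => //; exact: measurable_id.
  have := measurableT_comp measurable_dgk' mp.
  by congr measurable_fun; apply/funext => w /=; rewrite dgkE.
exists (100 * k / (1 - `|r| ^+ 2) + 200 / Num.sqrt (1 - `|r| ^+ 2) ^+ 3) => w.
apply: dgk_le => //.
  by rewrite normr_ge0/= ltr_norml.
by rewrite -ler_norml.
Qed.

Lemma mix_gt0 r x : -1 < r < 1 -> 0 < mix r x.
Proof. by move=> r1; apply: Ex_gt0; [exact: bmf_gk|move=> w; exact: gk_gt0]. Qed.

Lemma is_derive_mix (r x : R) : -1 < r < 1 -> is_derive r 1 (mix^~ x) (dmix r x).
Proof.
move=> /andP[r1 r2].
(* Halfway between |r| and 1, so that a neighbourhood of r stays in (-c, c) while c < 1. *)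
pose c := (1 + `|r|) / 2.
have rr : `|r| < 1 by rewrite ltr_norml r1.
have c0 : 0 <= c < 1 by rewrite /c; have := normr_ge0 r; lra.
have rc : - c < r < c by rewrite -ltr_norml /c; lra.
apply: (@is_derive_Ex _ W R P (fun r w => gk r (U w) x) (fun r w => dgk r (U w) x) r (- c) c
  (100 * k / (1 - c ^+ 2) + 200 / Num.sqrt (1 - c ^+ 2) ^+ 3)) => // q.
- by move=> qc; apply: bmf_gk; lra.
- by move=> w qc; apply: is_derive_gk; lra.
- by move=> w qc; apply: dgk_le => //; lra.
Qed.

Lemma continuous_dmix' r x : -1 < r < 1 -> {for r, continuous (dmix'^~ x)}.
Proof.
move=> /andP[r1 r2].
pose c := (1 + `|r|) / 2.
have rr : `|r| < 1 by rewrite ltr_norml r1.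
have c0 : 0 <= c < 1 by rewrite /c; have := normr_ge0 r; lra.
have rc : - c < r < c by rewrite -ltr_norml /c; lra.
apply: (@continuous_Ex _ W R P (fun r w => dgk' r (U w) x) r (- c) c
  (100 * k / (1 - c ^+ 2) + 200 / Num.sqrt (1 - c ^+ 2) ^+ 3)) => // q.
- move=> qc; have q1 : -1 < q < 1 by lra.
  by under eq_fun do rewrite (dgk'E _ _ q1); exact: bmf_dgk.
- by move=> w qc; apply: continuous_dgk'; lra.
- by move=> w qc; rewrite dgk'E; [apply: dgk_le => //; lra|lra].
Qed.

Lemma mix_path (w Om : R -> R) (a b : R) : -1 < a -> a < b -> b < 1 ->
    (forall r, a <= r <= b -> 0 < w r) ->
    (forall r : R, a <= r <= b -> is_derive r 1 Om (w r)) ->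
    (forall r, a <= r <= b -> {for r, continuous w}) ->
    measurable_fun [set: R] w ->
    (forall r, a <= r <= b ->
      (\int[lebesgue_measure]_x (dmix r x ^+ 2 / mix r x)%:E <= (w r ^+ 2)%:E)%E) ->
  (\int[lebesgue_measure]_x ((Num.sqrt (mix b x) - Num.sqrt (mix a x)) ^+ 2)%:E <=
   (((Om b - Om a) / 2) ^+ 2)%:E)%E.
Proof.
move=> a1 ab b1 w0 HOm cw mw bound.
have r1 r : a <= r <= b -> -1 < r < 1 by lra.
apply: (@hellinger_path R mix dmix' w Om) => //.
- by move=> r x /r1; exact: mix_gt0.
- by move=> r x /r1 rr; rewrite dmix'E//; exact: is_derive_mix.
- by move=> r x /r1; exact: continuous_dmix'.
- exact: measurable_mix.
- exact: measurable_dmix'.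
- move=> r rab; rewrite (le_trans _ (bound r rab))//; apply: le_of_eq.
  by apply: eq_integral => x _; rewrite dmix'E// r1.
Qed.

End Mixture.

(** * Exchangeable sums *)

Lemma bmf_comp d d' (T : measurableType d) (T' : measurableType d') (R : realType)
    (f : T' -> R) (g : T -> T') :
  bmf f -> measurable_fun [set: T] g -> bmf (fun x => f (g x)).
Proof.
move=> [mf [M fM]] mg; split; first exact: measurableT_comp.
by exists M => x; exact: fM.
Qed.

Section TwoPoint.
Context d (T : measurableType d) (R : realType) (mu : probability T R).

Definition integ (f : T * T -> R) (z : T) := Ex mu (fun y => f (y, z)).

Lemma bmf_integ f : bmf f -> bmf (integ f).
Proof. exact: bmf_Ex. Qed.

Lemma bmf_fst (f : T -> R) : bmf f -> bmf (fun p : T * T => f p.1).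
Proof. by move=> bf; apply: bmf_comp bf _; exact: measurable_fst. Qed.

Lemma bmf_snd (f : T -> R) : bmf f -> bmf (fun p : T * T => f p.2).
Proof. by move=> bf; apply: bmf_comp bf _; exact: measurable_snd. Qed.

Definition Ex2 (f : T * T -> R) := Ex mu (integ f).

Lemma Ex2D f g : bmf f -> bmf g -> Ex2 (fun p => f p + g p) = Ex2 f + Ex2 g.
Proof.
move=> bf bg; rewrite /Ex2 -ExD; try by apply: bmf_int; exact: bmf_integ.
apply: eq_Rintegral => z _; rewrite /integ ExD//; apply: bmf_int; exact: bmf_pair1.
Qed.

Lemma Ex2Z c f : bmf f -> Ex2 (fun p => c * f p) = c * Ex2 f.
Proof.
move=> bf; rewrite /Ex2 -ExZ; last by apply: bmf_int; exact: bmf_integ.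
apply: eq_Rintegral => z _; rewrite /integ ExZ//; apply: bmf_int; exact: bmf_pair1.
Qed.

Lemma le_Ex2 f g : bmf f -> bmf g -> (forall p, f p <= g p) -> Ex2 f <= Ex2 g.
Proof.
move=> bf bg fg; apply: le_Ex; try by apply: bmf_int; exact: bmf_integ.
by move=> z; apply: le_Ex => [||y]; [apply: bmf_int; exact: bmf_pair1..|exact: fg].
Qed.

Lemma Ex2_fst (f : T -> R) : Ex2 (fun p => f p.1) = Ex mu f.
Proof. by rewrite /Ex2 /integ/= Ex_cst. Qed.

Lemma Ex2_snd (f : T -> R) : Ex2 (fun p => f p.2) = Ex mu f.
Proof. by rewrite /Ex2 /integ/=; congr Ex; apply/funext => z; rewrite Ex_cst. Qed.

Lemma sqr_Ex_le (f : T -> R) : bmf f -> Ex mu f ^+ 2 <= Ex mu (fun x => f x ^+ 2).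
Proof.
move=> bf; have b1 := bmf_cst T (1 : R).
have := @weighted_CS _ T R mu f (fun=> 1) (proj1 bf) b1 (fun=> ler01)
  (bmf_int mu (bmfM bf b1)) (bmf_int mu (bmfM (bmfX 2 bf) b1)).
rewrite Ex_cst ltr01 divr1 => /(_ isT).
by congr (Ex mu _ ^+ 2 <= Ex mu _); apply/funext => x; rewrite mulr1.
Qed.

End TwoPoint.

Section Exchangeable.
Context d (T : measurableType d) (R : realType) (mu : probability T R).
Context (n : nat) (Q : probability (n.+1.-tuple T) R).
Implicit Types (t : n.+1.-tuple T) (i j k l : 'I_n.+1) (G : n.+1.-tuple T -> R).

Definition swp i j t : n.+1.-tuple T := [tuple tnth t (tperm i j l) | l < n.+1].

Definition free_of G k := forall t t', (forall i, i != k -> tnth t i = tnth t' i) -> G t = G t'.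

Definition swap_invariant := forall i j G, bmf G ->
  Ex Q (fun t => G (swp i j t)) = Ex Q G.

(** Independence in the form in which it is applied: coordinate k is averaged against mu although it
    appears together with another coordinate j, provided the cofactor does not depend on it. *)
Definition integrates_out := forall k j (f : T * T -> R) G, k != j -> bmf f -> bmf G ->
  free_of G k ->
  Ex Q (fun t => f (tnth t k, tnth t j) * G t) = Ex Q (fun t => integ mu f (tnth t j) * G t).

Hypothesis Qout : integrates_out.
Hypothesis n1 : (1 < n)%N.

Lemma bmf_tnth (f : T -> R) i : bmf f -> bmf (fun t => f (tnth t i)).
Proof. by move=> bf; apply: bmf_comp bf _; exact: measurable_tnth. Qed.

Lemma bmf_tnth2 (f : T * T -> R) i j : bmf f -> bmf (fun t => f (tnth t i, tnth t j)).
Proof.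
by move=> bf; apply: bmf_comp bf _; apply: measurable_fun_pair; exact: measurable_tnth.
Qed.

Lemma exists_neq k : exists j, k != j.
Proof.
have [->|k0] := eqVneq k ord0; last by exists ord0.
by exists ord_max; rewrite -val_eqE/= eq_sym -lt0n (ltn_trans _ n1).
Qed.

Lemma out1 k (f : T -> R) G : bmf f -> bmf G -> free_of G k ->
  Ex Q (fun t => f (tnth t k) * G t) = Ex mu f * Ex Q G.
Proof.
move=> bf bG Gk; have [j kj] := exists_neq k.
by rewrite (Qout kj (bmf_fst bf) bG Gk) -ExZ//; exact: bmf_int.
Qed.

Lemma Ex_tnth (f : T -> R) k : bmf f -> Ex Q (fun t => f (tnth t k)) = Ex mu f.
Proof.
move=> bf; rewrite -[RHS]mulr1 -[X in _ * X](Ex_cst Q 1) -(@out1 k)//; last exact: bmf_cst.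
by congr Ex; apply/funext => t; rewrite mulr1.
Qed.

Lemma Ex_tnth2 (f : T * T -> R) k j : k != j -> bmf f ->
  Ex Q (fun t => f (tnth t k, tnth t j)) = Ex2 mu f.
Proof.
move=> kj bf; rewrite /Ex2 -(Ex_tnth j (bmf_integ mu bf)).
have := Qout kj bf (bmf_cst _ 1) (fun _ _ _ => erefl).
by under eq_fun do rewrite mulr1; under [X in _ = Ex _ X]eq_fun do rewrite mulr1.
Qed.

Lemma free_tnth2 (f : T * T -> R) i j k : i != k -> j != k ->
  free_of (fun t => f (tnth t i, tnth t j)) k.
Proof. by move=> ik jk t t' E; rewrite !E. Qed.

Let w := lift (@ord_max n).

(** Integrate out index i, then index j: the first factor becomes its mean, 0. *)
Lemma Ex_disjoint (q : T * T -> R) (i j k l : 'I_n) : bmf q -> Ex2 mu q = 0 ->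
    i != j -> i != k -> i != l -> j != k -> j != l ->
  Ex Q (fun t => q (tnth t (w i), tnth t (w j)) * q (tnth t (w k), tnth t (w l))) = 0.
Proof.
move=> bq q0 ij ik il jk jl.
have wI (a c : 'I_n) : a != c -> w a != w c by rewrite (inj_eq lift_inj).
have bkl := bmf_tnth2 (w k) (w l) bq.
rewrite (Qout (wI _ _ ij) bq bkl); last by apply: free_tnth2; apply: wI; rewrite eq_sym.
rewrite (out1 (bmf_integ mu bq) bkl); last by apply: free_tnth2; apply: wI; rewrite eq_sym.
by rewrite -/(Ex2 mu q) q0 mul0r.
Qed.

(** xy <= (x^2 + y^2) / 2, and both squares have the same mean whichever pair of distinct indices
    they carry. *)
Lemma Ex_product_le (q : T * T -> R) (i j k l : 'I_n) : bmf q -> i != j -> k != l ->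
  Ex Q (fun t => q (tnth t (w i), tnth t (w j)) * q (tnth t (w k), tnth t (w l))) <=
  Ex2 mu (fun p => q p ^+ 2).
Proof.
move=> bq ij kl.
have wI (a c : 'I_n) : a != c -> w a != w c by rewrite (inj_eq lift_inj).
have bij := bmf_tnth2 (w i) (w j) bq; have bkl := bmf_tnth2 (w k) (w l) bq.
have bh (g : n.+1.-tuple T -> R) : bmf g -> bmf (fun t => 2^-1 * g t ^+ 2).
  by move=> bg; apply: bmfM; [exact: bmf_cst|exact: bmfX].
apply: (@le_trans _ _ (Ex Q (fun t => 2^-1 * q (tnth t (w i), tnth t (w j)) ^+ 2
   + 2^-1 * q (tnth t (w k), tnth t (w l)) ^+ 2))).
  apply: le_Ex; [by apply: bmf_int; exact: bmfM|by apply: bmf_int; apply: bmfD; exact: bh|].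
  move=> t; set x := q _; set y := q _; rewrite -subr_ge0.
  rewrite (_ : _ - _ = 2^-1 * (x - y) ^+ 2); last by field.
  by rewrite mulr_ge0 ?sqr_ge0.
rewrite ExD; try by apply: bmf_int; exact: bh.
rewrite !ExZ; try by apply: bmf_int; exact: bmfX.
have E (a c : 'I_n) : a != c -> Ex Q (fun t => q (tnth t (w a), tnth t (w c)) ^+ 2) =
    Ex2 mu (fun p => q p ^+ 2).
  by move=> /wI ac; rewrite -(Ex_tnth2 ac)//; exact: bmfX.
by rewrite !E//; lra.
Qed.

Definition offsum (q : T * T -> R) t := \sum_(i < n) \sum_(j < n | i != j) q (tnth t (w i), tnth t (w j)).

Lemma bmf_offsum q : bmf q -> bmf (offsum q).
Proof.
move=> bq; apply: bmf_sum => i; apply: bmf_sum => j; exact: bmf_tnth2.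
Qed.

Lemma sqr_offsum q t : offsum q t ^+ 2 =
  \sum_(i < n) \sum_(j < n | i != j) \sum_(k < n) \sum_(l < n | k != l)
    q (tnth t (w i), tnth t (w j)) * q (tnth t (w k), tnth t (w l)).
Proof.
rewrite expr2 {1}/offsum mulr_suml; apply: eq_bigr => i _.
rewrite mulr_suml; apply: eq_bigr => j _; rewrite mulr_sumr; apply: eq_bigr => k _.
by rewrite mulr_sumr.
Qed.

Lemma Ex_sqr_offsum q : bmf q -> Ex Q (fun t => offsum q t ^+ 2) =
  \sum_(i < n) \sum_(j < n | i != j) \sum_(k < n) \sum_(l < n | k != l)
    Ex Q (fun t => q (tnth t (w i), tnth t (w j)) * q (tnth t (w k), tnth t (w l))).
Proof.
move=> bq; under eq_fun do rewrite sqr_offsum.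
have b4 i j k l : bmf (fun t => q (tnth t i, tnth t j) * q (tnth t k, tnth t l)).
  by apply: bmfM; exact: bmf_tnth2.
have b3 i j (k : 'I_n) : bmf (fun t => \sum_(l < n | k != l) q (tnth t i, tnth t j) * q (tnth t (w k), tnth t (w l))).
  by apply: bmf_sum => l; exact: b4.
have b2 i j : bmf (fun t => \sum_(k < n) \sum_(l < n | k != l) q (tnth t i, tnth t j) * q (tnth t (w k), tnth t (w l))).
  by apply: bmf_sum => k; exact: b3.
rewrite Ex_sum; last by move=> i; apply: bmf_int; apply: bmf_sum => j; exact: b2.
apply: eq_bigr => i _; rewrite Ex_sum; last by move=> j; apply: bmf_int; exact: b2.
apply: eq_bigr => j _; rewrite Ex_sum; last by move=> k; apply: bmf_int; exact: b3.
by apply: eq_bigr => k _; rewrite Ex_sum// => l; apply: bmf_int; exact: b4.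
Qed.

Lemma offsum_cst (c : R) : \sum_(i < n) \sum_(j < n | i != j) c = n%:R * (n%:R - 1) * c.
Proof.
under eq_bigr => i _.
  rewrite sumr_const (_ : #|_| = n.-1); last first.
    by rewrite -[in RHS](card_ord n) -(cardC1 i); apply: eq_card => j; rewrite !inE eq_sym.
  over.
rewrite sumr_const card_ord -mulrnA -[LHS]mulr_natl natrM -subn1 natrB ?(ltnW n1)//.
ring.
Qed.

Lemma offsum_delta (i : 'I_n) :
  \sum_(k < n) \sum_(l < n | k != l) ((k == i)%:R : R) = n%:R - 1.
Proof.
rewrite (bigD1 i)//= [X in _ + X]big1 ?addr0; last first.
  by move=> k ki; rewrite big1// => l _; rewrite (negbTE ki).
rewrite sumr_const (_ : #|_| = n.-1); last first.
  by rewrite -[in RHS](card_ord n) -(cardC1 i); apply: eq_card => j; rewrite !inE eq_sym.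
by rewrite eqxx -subn1 natrB// ltnW.
Qed.

(** Two pairs contribute only if they share an index. There are four ways to share one, each leaving
    n - 1 choices for the other pair; [ov] counts these coincidences. *)
Lemma variance_offsum q : bmf q -> Ex2 mu q = 0 ->
  Ex Q (fun t => offsum q t ^+ 2) <= 4 * n%:R * (n%:R - 1) ^+ 2 * Ex2 mu (fun p => q p ^+ 2).
Proof.
move=> bq q0; rewrite Ex_sqr_offsum//; set V := Ex2 mu _.
have V0 : 0 <= V by apply: Ex_ge0 => z; apply: Ex_ge0 => y; exact: sqr_ge0.
pose ov (i j k l : 'I_n) : R := ((k == i)%:R + (k == j)%:R + ((l == i)%:R + (l == j)%:R)) * V.
have B (i j k l : 'I_n) : i != j -> k != l ->
    Ex Q (fun t => q (tnth t (w i), tnth t (w j)) * q (tnth t (w k), tnth t (w l))) <= ov i j k l.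
  move=> ij kl; have := Ex_product_le bq ij kl; rewrite -/V /ov.
  have := Ex_disjoint bq q0 ij.
  have [->|ki] := eqVneq k i.
    by move=> _ h; rewrite (le_trans h)// ler_peMl// -!addrA lerDl !addr_ge0.
  have [->|kj] := eqVneq k j.
    by move=> _ h; rewrite (le_trans h)// ler_peMl// add0r lerDl !addr_ge0.
  have [->|li] := eqVneq l i.
    by move=> _ h; rewrite (le_trans h)// ler_peMl// !add0r lerDl.
  have [->|lj] := eqVneq l j.
    by move=> _ h; rewrite (le_trans h)// ler_peMl// !add0r.
  by move=> ->//; rewrite ?mul0r ?add0r ?mul0r// eq_sym.
have S1 (i : 'I_n) : \sum_(k < n) \sum_(l < n | k != l) ((k == i)%:R : R) = n%:R - 1.
  exact: offsum_delta.
have S2 (i : 'I_n) : \sum_(k < n) \sum_(l < n | k != l) ((l == i)%:R : R) = n%:R - 1.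
  rewrite (exchange_big_dep predT)//= -[RHS](offsum_delta i); apply: eq_bigr => k _.
  by apply: eq_bigl => l; rewrite eq_sym.
apply: (@le_trans _ _ (\sum_(i < n) \sum_(j < n | i != j) (4 * (n%:R - 1) * V))).
  apply: ler_sum => i _; apply: ler_sum => j ij.
  apply: (@le_trans _ _ (\sum_(k < n) \sum_(l < n | k != l) ov i j k l)).
    by apply: ler_sum => k _; apply: ler_sum => l kl; exact: B.
  rewrite /ov; under eq_bigr do rewrite -mulr_suml !big_split/=.
  rewrite -mulr_suml !big_split/= !S1 !S2 ler_wpM2r//; lra.
by rewrite offsum_cst; apply: le_of_eq; ring.
Qed.

(** For a degenerate kernel a single unshared index already kills the product, so a pair meets only
    itself and its reversal. This saves a factor of order n over [variance_offsum]. *)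
Lemma degenerate_offsum q : bmf q -> (forall x y, q (x, y) = q (y, x)) ->
    (forall y, integ mu q y = 0) ->
  Ex Q (fun t => offsum q t ^+ 2) <= 2 * n%:R * (n%:R - 1) * Ex2 mu (fun p => q p ^+ 2).
Proof.
move=> bq qC q0; rewrite Ex_sqr_offsum//; set V := Ex2 mu _.
have V0 : 0 <= V by apply: Ex_ge0 => z; apply: Ex_ge0 => y; exact: sqr_ge0.
pose same (i j k l : 'I_n) : R := (((k == i) && (l == j))%:R + ((k == j) && (l == i))%:R) * V.
have wI (a c : 'I_n) : a != c -> w a != w c by rewrite (inj_eq lift_inj).
have Z (i j k l : 'I_n) : i != j -> i != k -> i != l ->
    Ex Q (fun t => q (tnth t (w i), tnth t (w j)) * q (tnth t (w k), tnth t (w l))) = 0.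
  move=> ij ik il; have bkl := bmf_tnth2 (w k) (w l) bq.
  rewrite (Qout (wI _ _ ij) bq bkl); last by apply: free_tnth2; apply: wI; rewrite eq_sym.
  by rewrite -[RHS](Ex_cst Q); congr Ex; apply/funext => t; rewrite q0 mul0r.
have B (i j k l : 'I_n) : i != j -> k != l ->
    Ex Q (fun t => q (tnth t (w i), tnth t (w j)) * q (tnth t (w k), tnth t (w l))) <= same i j k l.
  move=> ij kl; have h := Ex_product_le bq ij kl; rewrite -/V in h.
  have same0 : 0 <= same i j k l by rewrite mulr_ge0// addr_ge0.
  have [ik|ik] := boolP ((i != k) && (i != l)).
    by move/andP: ik => [ik il]; rewrite Z.
  have [jk|jk] := boolP ((j != k) && (j != l)).
    move/andP: jk => [jk jl].
    by under eq_fun do rewrite qC; rewrite Z// eq_sym.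
  have : (k == i) && (l == j) || (k == j) && (l == i).
    move: ik jk; rewrite !negb_and !negbK => /orP[] /eqP ik /orP[] /eqP jk.
    - by move: ij; rewrite ik jk eqxx.
    - by rewrite -ik -jk !eqxx.
    - by rewrite -ik -jk !eqxx orbT.
    - by move: ij; rewrite ik jk eqxx.
  rewrite /same; case: (_ && _) => /=; case: (_ && _) => //= _.
  - by rewrite (le_trans h)// ler_peMl// lerDl.
  - by rewrite addr0 mul1r.
  - by rewrite add0r mul1r.
have S (i j : 'I_n) : i != j ->
    \sum_(k < n) \sum_(l < n | k != l) (((k == i) && (l == j))%:R : R) = 1.
  move=> ij; rewrite (bigD1 i)//= [X in _ + X]big1 ?addr0; last first.
    by move=> k ki; rewrite big1// => l _; rewrite (negbTE ki).
  rewrite (bigD1 j)//= big1 ?addr0 ?eqxx//.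
  by move=> l /andP[_ lj]; rewrite (negbTE lj) andbF.
apply: (@le_trans _ _ (\sum_(i < n) \sum_(j < n | i != j) (2 * V))).
  apply: ler_sum => i _; apply: ler_sum => j ij.
  apply: (@le_trans _ _ (\sum_(k < n) \sum_(l < n | k != l) same i j k l)).
    by apply: ler_sum => k _; apply: ler_sum => l kl; exact: B.
  rewrite /same; under eq_bigr do rewrite -mulr_suml big_split/=.
  by rewrite -mulr_suml big_split/= !S// eq_sym.
by rewrite offsum_cst; apply: le_of_eq; ring.
Qed.

End Exchangeable.

(** * The Stein identity *)

Section SteinIdentity.
Context d (T : measurableType d) (R : realType) (mu : probability T R).
Context (n : nat) (Q : probability (n.+1.-tuple T) R).
Hypothesis n1 : (1 < n)%N.
Hypothesis Qswap : swap_invariant Q.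
Hypothesis Qout : integrates_out mu Q.
Variables (u : T * T -> R) (b : R).
Hypothesis meas_u : measurable_fun [set: T * T] u.
Hypothesis ub : forall p, `|u p| <= b.
Hypothesis uC : forall x y, u (x, y) = u (y, x).

Let w := lift (@ord_max n).

(* Hoeffding decomposition of u: h1 is its projection and h2 its degenerate part. The kernel qq (x, y)
   is the mean of (h1 x - h1 x') (ut (x, y) - ut (x', y)) over x' with law mu. *)
Definition theta := Ex2 mu u.
Definition ut p := u p - theta.
Definition h1 z := integ mu ut z.
Definition h2 p := ut p - h1 p.1 - h1 p.2.
Definition k1 z := integ mu (fun p => h1 p.1 * ut p) z.
Definition qq p := h1 p.1 * ut p - h1 p.1 * h1 p.2 + k1 p.2.

Lemma bmf_u : bmf u.
Proof. by split => //; exists b. Qed.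

Lemma bmf_ut : bmf ut.
Proof. by apply: bmfB; [exact: bmf_u|exact: bmf_cst]. Qed.

Lemma bmf_h1 : bmf h1.
Proof. exact: bmf_integ bmf_ut. Qed.

Lemma bmf_h2 : bmf h2.
Proof.
by apply: bmfB; [apply: bmfB; [exact: bmf_ut|exact: bmf_fst bmf_h1]|exact: bmf_snd bmf_h1].
Qed.

Lemma bmf_h1ut : bmf (fun p => h1 p.1 * ut p).
Proof. by apply: bmfM; [exact: bmf_fst bmf_h1|exact: bmf_ut]. Qed.

Lemma bmf_k1 : bmf k1.
Proof. exact: bmf_integ bmf_h1ut. Qed.

Lemma bmf_qq : bmf qq.
Proof.
apply: bmfD; last exact: bmf_snd bmf_k1.
apply: bmfB; first exact: bmf_h1ut.
by apply: bmfM; [exact: bmf_fst bmf_h1|exact: bmf_snd bmf_h1].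
Qed.

Lemma utC x y : ut (x, y) = ut (y, x).
Proof. by rewrite /ut uC. Qed.

Lemma Ex_h1 : Ex mu h1 = 0.
Proof.
have : Ex2 mu (fun p => ut p + theta) = theta.
  by rewrite /theta; congr (Ex2 mu _); apply/funext => p; rewrite /ut subrK.
rewrite (Ex2D mu bmf_ut (bmf_cst _ theta)) (Ex2_fst mu (fun=> theta)) Ex_cst -/(Ex2 mu ut).
by move/eqP; rewrite -subr_eq0 addrK => /eqP.
Qed.

Definition cU : R := (Num.sqrt n%:R * (n%:R - 1))^-1.

Definition Uf (t : n.+1.-tuple T) : R := cU * offsum ut t.
Definition Ulin (t : n.+1.-tuple T) : R := 2 / Num.sqrt n%:R * \sum_(i < n) h1 (tnth t (w i)).
Definition Udeg (t : n.+1.-tuple T) : R := cU * offsum h2 t.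
(** The Stein kernel of the linear part paired with U. Its normalisation gives it mean 1 as soon as
    h1 has variance 1/4, because [qq] then has mean 1/2. *)
Definition TT (t : n.+1.-tuple T) : R := 2 * cU / Num.sqrt n%:R * offsum qq t.

Lemma bmf_Uf : bmf Uf.
Proof. by apply: bmfM; [exact: bmf_cst|exact: bmf_offsum bmf_ut]. Qed.

Lemma bmf_Udeg : bmf Udeg.
Proof. by apply: bmfM; [exact: bmf_cst|exact: bmf_offsum bmf_h2]. Qed.

Lemma bmf_TT : bmf TT.
Proof. by apply: bmfM; [exact: bmf_cst|exact: bmf_offsum bmf_qq]. Qed.

Lemma n_gt1 : 1 < n%:R :> R. Proof. by rewrite ltr1n. Qed.
Lemma sqrtn_gt0 : 0 < Num.sqrt n%:R :> R. Proof. by rewrite sqrtr_gt0 ltr0n ltnW. Qed.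
Lemma cU_gt0 : 0 < cU.
Proof. by rewrite invr_gt0 mulr_gt0 ?sqrtn_gt0// subr_gt0 n_gt1. Qed.

Lemma natr_pred : n.-1%:R = n%:R - 1 :> R.
Proof. by rewrite -subn1 natrB// ltnW. Qed.

Lemma card_off (i : 'I_n) : #|[pred j : 'I_n | i != j]| = n.-1.
Proof.
by rewrite -[in RHS](card_ord n) -(cardC1 i); apply: eq_card => j; rewrite !inE eq_sym.
Qed.

Lemma Uf_split t : Uf t = Ulin t + Udeg t.
Proof.
rewrite /Uf /Ulin /Udeg /offsum.
have -> : \sum_(i < n) \sum_(j < n | i != j) ut (tnth t (w i), tnth t (w j)) =
   \sum_(i < n) \sum_(j < n | i != j) h2 (tnth t (w i), tnth t (w j))
   + 2 * (n%:R - 1) * \sum_(i < n) h1 (tnth t (w i)).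
  have E : \sum_(i < n) \sum_(j < n | i != j) h1 (tnth t (w i)) = (n%:R - 1) * \sum_(i < n) h1 (tnth t (w i)).
    rewrite mulr_sumr; apply: eq_bigr => i _.
    by rewrite sumr_const card_off -[LHS]mulr_natl natr_pred.
  have E' : \sum_(i < n) \sum_(j < n | i != j) h1 (tnth t (w j)) = (n%:R - 1) * \sum_(i < n) h1 (tnth t (w i)).
    rewrite (exchange_big_dep predT)//= -E; apply: eq_bigr => k _.
    by apply: eq_bigl => l; rewrite eq_sym.
  rewrite (_ : 2 * (n%:R - 1) * _ = (n%:R - 1) * (\sum_(i < n) h1 (tnth t (w i)))
    + (n%:R - 1) * (\sum_(i < n) h1 (tnth t (w i)))); last by ring.
  rewrite -{1}E -E' -!big_split/=; apply: eq_bigr => i _.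
  rewrite -!big_split/=; apply: eq_bigr => j _; rewrite /h2/=; ring.
rewrite /cU; field.
by rewrite !gt_eqF ?sqrtn_gt0// subr_gt0 n_gt1.
Qed.

(* The last coordinate is an independent copy that does not enter U: sw i resamples coordinate i. *)
Definition sw (i : 'I_n) t : n.+1.-tuple T := swp (w i) ord_max t.

Definition dl (i : 'I_n) t := Uf t - Uf (sw i t).

Lemma tnth_sw_i i t : tnth (sw i t) (w i) = tnth t ord_max.
Proof. by rewrite tnth_mktuple tpermL. Qed.

Lemma tnth_sw_max i t : tnth (sw i t) ord_max = tnth t (w i).
Proof. by rewrite tnth_mktuple tpermR. Qed.

Lemma tnth_sw_j i j t : i != j -> tnth (sw i t) (w j) = tnth t (w j).
Proof.
move=> ij; rewrite tnth_mktuple tpermD//; first by rewrite (inj_eq lift_inj).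
exact: neq_lift.
Qed.

Lemma swK i t : sw i (sw i t) = t.
Proof. by apply: eq_from_tnth => j; rewrite !tnth_mktuple tpermK. Qed.

Lemma measurable_sw i : measurable_fun [set: n.+1.-tuple T] (sw i).
Proof.
apply/measurable_fun_tnthP => j.
rewrite (_ : _ \o _ = fun t => tnth t (tperm (w i) ord_max j)); first exact: measurable_tnth.
by apply/funext => t /=; rewrite tnth_mktuple.
Qed.

Lemma bmf_sw i (F : n.+1.-tuple T -> R) : bmf F -> bmf (fun t => F (sw i t)).
Proof. by move=> bF; apply: bmf_comp bF (measurable_sw i). Qed.

Lemma bmf_dl i : bmf (dl i).
Proof. by apply: bmfB; [exact: bmf_Uf|exact: bmf_sw bmf_Uf]. Qed.

(** Resampling coordinate i changes only the pairs containing i; by symmetry of u those with i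
    second change as much as those with i first, hence the factor 2. *)
Lemma dlE i t : dl i t = 2 * cU * \sum_(j < n | i != j)
  (ut (tnth t (w i), tnth t (w j)) - ut (tnth t ord_max, tnth t (w j))).
Proof.
rewrite /dl /Uf /offsum -mulrBr mulrAC mulrC; congr (_ * _).
rewrite (bigD1 i)//= [X in _ - X](bigD1 i)//=.
set A := \sum_(j < n | i != j) ut (tnth t (w i), tnth t (w j)).
set A' := \sum_(j < n | i != j) ut (tnth (sw i t) (w i), _).
set B := \sum_(k < n | k != i) _; set B' := \sum_(k < n | k != i) _.
have eB : B - B' = A - A'.
  rewrite /B /B' /A /A' -!sumrB; under [RHS]eq_bigl do rewrite eq_sym.
  apply: eq_bigr => k ki.
  rewrite (bigD1 i)//= [X in _ - X](bigD1 i)//=.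
  rewrite [X in _ + X - _](_ : _ = \sum_(j < n | (k != j) && (j != i))
    ut (tnth (sw i t) (w k), tnth (sw i t) (w j))); last first.
    by apply: eq_bigr => j /andP[_ ji]; rewrite !tnth_sw_j// eq_sym.
  rewrite (utC _ (tnth t (w i))) (utC _ (tnth (sw i t) (w i))) tnth_sw_j; last by rewrite eq_sym.
  ring.
have -> : \sum_(j < n | i != j)
    (ut (tnth t (w i), tnth t (w j)) - ut (tnth t ord_max, tnth t (w j))) = A - A'.
  rewrite /A /A' -sumrB; apply: eq_bigr => j ij.
  by rewrite tnth_sw_i tnth_sw_j.
rewrite (_ : _ - _ = A - A' + (B - B')); last by ring.
by rewrite eB; ring.
Qed.

Lemma dl_le i t : `|dl i t| <= 4 * b / Num.sqrt n%:R.
Proof.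
have b0 : 0 <= b by apply: le_trans (ub (tnth t ord0, tnth t ord0)).
rewrite dlE normrM ger0_norm; last by rewrite mulr_ge0// ltW// cU_gt0.
apply: (@le_trans _ _ (2 * cU * \sum_(j < n | i != j) (2 * b))).
  rewrite ler_wpM2l//; first by rewrite mulr_ge0// ltW// cU_gt0.
  rewrite (le_trans (ler_norm_sum _ _ _))//; apply: ler_sum => j _.
  rewrite (_ : ut _ - ut _ = u (tnth t (w i), tnth t (w j)) - u (tnth t ord_max, tnth t (w j))).
    by rewrite (le_trans (ler_normB _ _))// mulr2n mulrDl mul1r lerD.
  by rewrite /ut; ring.
rewrite sumr_const card_off -[_ *+ n.-1]mulr_natl natr_pred /cU.
apply: le_of_eq; field.
by rewrite !gt_eqF ?sqrtn_gt0// subr_gt0 n_gt1.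
Qed.

Section Identity.
Variables (r x : R).
Hypothesis r1 : -1 < r < 1.

Definition A1 (t : n.+1.-tuple T) : R := npdf1 (r * Uf t) (sg r) x.
Definition A2 (t : n.+1.-tuple T) : R := npdf2 (r * Uf t) (sg r) x.
Definition dh (i : 'I_n) (t : n.+1.-tuple T) : R := h1 (tnth t (w i)) - h1 (tnth t ord_max).
Definition rem (i : 'I_n) (t : n.+1.-tuple T) : R := trapez (r * Uf t) (sg r) (r * dl i t) x.

Lemma bmf_gkU : bmf (fun t => gk r (Uf t) x).
Proof.
have [mU _] := bmf_Uf.
exact: (@bmf_gk _ _ R Uf mU r x r1).
Qed.

Lemma bmf_zU : bmf (fun t => (x - r * Uf t) / sg r).
Proof.
apply: bmfM; last exact: bmf_cst.
apply: bmfB; first exact: bmf_cst.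
by apply: bmfM; [exact: bmf_cst|exact: bmf_Uf].
Qed.

Lemma bmf_A1 : bmf A1.
Proof.
rewrite /A1 /npdf1; under eq_fun do rewrite -gkE//.
apply: bmfM bmf_gkU; apply: bmfN; apply: bmfM bmf_zU _; exact: bmf_cst.
Qed.

Lemma bmf_A2 : bmf A2.
Proof.
rewrite /A2 /npdf2; under eq_fun do rewrite -gkE//.
apply: bmfM bmf_gkU; apply: bmfM; last exact: bmf_cst.
by apply: bmfB; [exact: bmfX bmf_zU|exact: bmf_cst].
Qed.

Lemma bmf_dh i : bmf (dh i).
Proof. by apply: bmfB; exact: bmf_tnth bmf_h1. Qed.

Lemma remE i t : rem i t = A1 t - A1 (sw i t) + r * dl i t / 2 * (A2 t + A2 (sw i t)).
Proof.
rewrite /rem /trapez /A1 /A2 (_ : r * Uf t - r * dl i t = r * Uf (sw i t))//.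
by rewrite /dl; ring.
Qed.

Lemma bmf_rem i : bmf (rem i).
Proof.
have -> : rem i = (fun t => A1 t - A1 (sw i t) + r * dl i t / 2 * (A2 t + A2 (sw i t))).
  by apply/funext => t; exact: remE.
apply: bmfD; first by apply: bmfB bmf_A1 _; exact: bmf_sw bmf_A1.
apply: bmfM; last by apply: bmfD bmf_A2 _; exact: bmf_sw bmf_A2.
apply: bmfM; last exact: bmf_cst.
by apply: bmfM; [exact: bmf_cst|exact: bmf_dl].
Qed.

Lemma free_Uf : free_of Uf ord_max.
Proof.
move=> t t' E; rewrite /Uf /offsum; congr (_ * _).
by apply: eq_bigr => i _; apply: eq_bigr => j _; rewrite !E// eq_sym neq_lift.
Qed.

Lemma free_A1 : free_of A1 ord_max.
Proof. by move=> t t' E; rewrite /A1 (free_Uf E). Qed.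

Lemma free_A2 : free_of A2 ord_max.
Proof. by move=> t t' E; rewrite /A2 (free_Uf E). Qed.

Lemma Ex_bmfD (f g : n.+1.-tuple T -> R) : bmf f -> bmf g ->
  Ex Q (fun t => f t + g t) = Ex Q f + Ex Q g.
Proof. by move=> bf bg; apply: ExD; exact: bmf_int. Qed.

Lemma Ex_bmfB (f g : n.+1.-tuple T -> R) : bmf f -> bmf g ->
  Ex Q (fun t => f t - g t) = Ex Q f - Ex Q g.
Proof. by move=> bf bg; apply: ExB; exact: bmf_int. Qed.

Lemma Ex_bmfZ c (f : n.+1.-tuple T -> R) : bmf f -> Ex Q (fun t => c * f t) = c * Ex Q f.
Proof. by move=> bf; apply: ExZ; exact: bmf_int. Qed.

Lemma dlN i t : dl i (sw i t) = - dl i t.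
Proof. by rewrite /dl swK opprB. Qed.

Lemma dhN i t : dh i (sw i t) = - dh i t.
Proof. by rewrite /dh tnth_sw_i tnth_sw_max opprB. Qed.

(** Exchangeable pair argument. The copy is independent of [A1] and h1 is centred, so h1 may be
    replaced by its increment [dh]; the swap changes the sign of [dh], so twice the expectation is
    that of [dh] times the increment of [A1]. The trapezoidal rule rewrites this increment, and the
    swap identifies its two [A2] terms because [dh * dl] is invariant. *)
Lemma Ex_h1_A1 i : Ex Q (fun t => h1 (tnth t (w i)) * A1 t) =
  2^-1 * Ex Q (fun t => dh i t * rem i t) - r / 2 * Ex Q (fun t => dh i t * dl i t * A2 t).
Proof.
have bA1 := bmf_A1; have bA2 := bmf_A2.
have bA1s := bmf_sw i bA1; have bA2s := bmf_sw i bA2.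
have bdh := bmf_dh i; have bdl := bmf_dl i; have brem := bmf_rem i.
have bhi := bmf_tnth (w i) bmf_h1; have bhn := bmf_tnth (@ord_max n) bmf_h1.
have E1 : Ex Q (fun t => h1 (tnth t (w i)) * A1 t) = Ex Q (fun t => dh i t * A1 t).
  have -> : (fun t => dh i t * A1 t) =
      (fun t => h1 (tnth t (w i)) * A1 t - h1 (tnth t ord_max) * A1 t).
    by apply/funext => t; rewrite /dh; ring.
  rewrite (Ex_bmfB (bmfM bhi bA1) (bmfM bhn bA1)).
  by rewrite (out1 Qout n1 bmf_h1 bA1 free_A1) Ex_h1 mul0r subr0.
have E2 : Ex Q (fun t => dh i t * A1 t) = - Ex Q (fun t => dh i t * A1 (sw i t)).
  rewrite -(Qswap (w i) ord_max (bmfM bdh bA1)) -ExN; last by apply: bmf_int; exact: bmfM.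
  by congr Ex; apply/funext => t; rewrite -/(sw i t) dhN mulNr.
have E3 : Ex Q (fun t => dh i t * dl i t * A2 (sw i t)) = Ex Q (fun t => dh i t * dl i t * A2 t).
  rewrite -[RHS](Qswap (w i) ord_max (bmfM (bmfM bdh bdl) bA2)).
  by congr Ex; apply/funext => t; rewrite -/(sw i t) dhN dlN mulrNN.
have E4 : Ex Q (fun t => dh i t * rem i t) =
    Ex Q (fun t => dh i t * A1 t) - Ex Q (fun t => dh i t * A1 (sw i t))
    + r / 2 * (Ex Q (fun t => dh i t * dl i t * A2 t) + Ex Q (fun t => dh i t * dl i t * A2 (sw i t))).
  have b1 := bmfM bdh bA1; have b2 := bmfM bdh bA1s.
  have b3 := bmfM (bmfM bdh bdl) bA2; have b4 := bmfM (bmfM bdh bdl) bA2s.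
  rewrite -(Ex_bmfD b3 b4) -(Ex_bmfZ (r / 2) (bmfD b3 b4)) -(Ex_bmfB b1 b2).
  rewrite -(Ex_bmfD (bmfB b1 b2) (bmfM (bmf_cst _ (r / 2)) (bmfD b3 b4))).
  by congr Ex; apply/funext => t; rewrite remE; field.
move: E1 E2 E3 E4.
generalize (Ex Q (fun t => dh i t * A1 t)) (Ex Q (fun t => dh i t * A1 (sw i t)))
  (Ex Q (fun t => dh i t * dl i t * A2 (sw i t))) (Ex Q (fun t => dh i t * dl i t * A2 t)).
by move=> X Z K K' -> E2 -> ->; rewrite E2; field.
Qed.

(** [A2] does not see the copy, so the copy can be integrated out of each of the four products in
    [dh * dl]; what is left is [qq]. *)
Lemma Ex_dh_dl_A2 i : Ex Q (fun t => dh i t * dl i t * A2 t) =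
  2 * cU * \sum_(j < n | i != j) Ex Q (fun t => qq (tnth t (w i), tnth t (w j)) * A2 t).
Proof.
have bA2 := bmf_A2.
have bhi := bmf_tnth (w i) bmf_h1; have bhn := bmf_tnth (@ord_max n) bmf_h1.
pose c (j : 'I_n) (t : n.+1.-tuple T) : R :=
  dh i t * (ut (tnth t (w i), tnth t (w j)) - ut (tnth t ord_max, tnth t (w j))) * A2 t.
have bc j : bmf (c j).
  apply: bmfM bA2; apply: bmfM; first exact: bmf_dh.
  by apply: bmfB; exact: bmf_tnth2 bmf_ut.
transitivity (Ex Q (fun t => 2 * cU * \sum_(j < n | i != j) c j t)).
  congr Ex; apply/funext => t; rewrite dlE /c.
  rewrite mulrA [dh i t * _]mulrC -!mulrA; congr (_ * (_ * _)).
  rewrite mulr_suml mulr_sumr; apply: eq_bigr => j _.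
  by rewrite !mulrA.
rewrite Ex_bmfZ; last exact: bmf_sum.
rewrite Ex_sum; last by move=> j; apply: bmf_int; exact: bc.
congr (_ * _); apply: eq_bigr => j ij.
have wm (k : 'I_n) : ord_max != w k by exact: neq_lift.
have buij := bmf_tnth2 (w i) (w j) bmf_ut.
have bunj := bmf_tnth2 (@ord_max n) (w j) bmf_ut.
have bhj := bmf_tnth (w j) bmf_h1; have bkj := bmf_tnth (w j) bmf_k1.
have F1 : Ex Q (fun t => ut (tnth t ord_max, tnth t (w j)) * (h1 (tnth t (w i)) * A2 t)) =
    Ex Q (fun t => h1 (tnth t (w j)) * (h1 (tnth t (w i)) * A2 t)).
  apply: (Qout (wm j) bmf_ut (bmfM bhi bA2)).
  by move=> t t' E; rewrite (free_A2 E) E// eq_sym.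
have F2 : Ex Q (fun t => h1 (tnth t ord_max) * (ut (tnth t (w i), tnth t (w j)) * A2 t)) = 0.
  rewrite (out1 Qout n1 bmf_h1 (bmfM buij bA2)) ?Ex_h1 ?mul0r//.
  by move=> t t' E; rewrite (free_A2 E) !E// eq_sym.
have F3 : Ex Q (fun t => h1 (tnth t ord_max) * ut (tnth t ord_max, tnth t (w j)) * A2 t) =
    Ex Q (fun t => k1 (tnth t (w j)) * A2 t).
  exact: (Qout (wm j) bmf_h1ut bA2 free_A2).
have B1 := bmfM (bmfM bhi buij) bA2.
have B2 := bmfM bunj (bmfM bhi bA2).
have B3 := bmfM bhn (bmfM buij bA2).
have B4 := bmfM (bmfM bhn bunj) bA2.
have B5 := bmfM bhj (bmfM bhi bA2).
have B6 := bmfM bkj bA2.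
have -> : c j = (fun t => h1 (tnth t (w i)) * ut (tnth t (w i), tnth t (w j)) * A2 t
    - ut (tnth t ord_max, tnth t (w j)) * (h1 (tnth t (w i)) * A2 t)
    - h1 (tnth t ord_max) * (ut (tnth t (w i), tnth t (w j)) * A2 t)
    + h1 (tnth t ord_max) * ut (tnth t ord_max, tnth t (w j)) * A2 t).
  by apply/funext => t; rewrite /c /dh; ring.
rewrite (Ex_bmfD (bmfB (bmfB B1 B2) B3) B4) (Ex_bmfB (bmfB B1 B2) B3) (Ex_bmfB B1 B2).
rewrite F1 F2 F3 subr0 -(Ex_bmfB B1 B5) -(Ex_bmfD (bmfB B1 B5) B6).
by congr Ex; apply/funext => t; rewrite /qq/=; ring.
Qed.

(** In - E[U A1] - r E[A2], the linear part of U produces r E[TT A2] and the remainder; the term - r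
    E[A2] is what centres the Stein kernel at 1. *)
Lemma stein_identity : Ex Q (fun t => dgk r (Uf t) x) =
  - Ex Q (fun t => Udeg t * A1 t)
  - (Num.sqrt n%:R)^-1 * \sum_(i < n) Ex Q (fun t => dh i t * rem i t)
  + r * Ex Q (fun t => (TT t - 1) * A2 t).
Proof.
have bA1 := bmf_A1; have bA2 := bmf_A2.
have bq (i j : 'I_n) : bmf (fun t => qq (tnth t (w i), tnth t (w j)) * A2 t).
  by apply: bmfM bA2; exact: bmf_tnth2 bmf_qq.
have bh (i : 'I_n) : bmf (fun t => h1 (tnth t (w i)) * A1 t).
  by apply: bmfM bA1; exact: bmf_tnth bmf_h1.
have bUd : bmf (fun t => Udeg t * A1 t) by apply: bmfM bA1; exact: bmf_Udeg.
have bTT : bmf (fun t => TT t * A2 t) by apply: bmfM bA2; exact: bmf_TT.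
have E0 : Ex Q (fun t => Uf t * A1 t) = Ex Q (fun t => Udeg t * A1 t)
    + 2 / Num.sqrt n%:R * \sum_(i < n) Ex Q (fun t => h1 (tnth t (w i)) * A1 t).
  rewrite -Ex_sum; last by move=> i; exact: bmf_int.
  rewrite -Ex_bmfZ; last exact: bmf_sum.
  rewrite -Ex_bmfD//; last by apply: bmfM; [exact: bmf_cst|exact: bmf_sum].
  congr Ex; apply/funext => t; rewrite Uf_split mulrDl addrC; congr (_ + _).
  by rewrite /Ulin -[LHS]mulrA mulr_suml.
have ETT : Ex Q (fun t => TT t * A2 t) = 2 * cU / Num.sqrt n%:R *
    \sum_(i < n) \sum_(j < n | i != j) Ex Q (fun t => qq (tnth t (w i), tnth t (w j)) * A2 t).
  transitivity (Ex Q (fun t => 2 * cU / Num.sqrt n%:R *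
      \sum_(i < n) \sum_(j < n | i != j) (qq (tnth t (w i), tnth t (w j)) * A2 t))).
    congr Ex; apply/funext => t; rewrite /TT /offsum -mulrA; congr (_ * _).
    by rewrite mulr_suml; apply: eq_bigr => i _; rewrite mulr_suml.
  rewrite Ex_bmfZ; last by apply: bmf_sum => i; exact: bmf_sum.
  rewrite Ex_sum; last by move=> i; apply: bmf_int; exact: bmf_sum.
  congr (_ * _); apply: eq_bigr => i _.
  by rewrite Ex_sum// => j; exact: bmf_int.
have -> : Ex Q (fun t => dgk r (Uf t) x) =
    - Ex Q (fun t => Uf t * A1 t) - r * Ex Q A2.
  have bU : bmf (fun t => Uf t * A1 t) by apply: bmfM bA1; exact: bmf_Uf.
  rewrite -Ex_bmfZ// -ExN; last exact: bmf_int.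
  rewrite -Ex_bmfB; [|exact: bmfN|by apply: bmfM bA2; exact: bmf_cst].
  by congr Ex; apply/funext => t; rewrite /dgk mulNr.
have -> : Ex Q (fun t => (TT t - 1) * A2 t) = Ex Q (fun t => TT t * A2 t) - Ex Q A2.
  by rewrite -Ex_bmfB//; congr Ex; apply/funext => t; rewrite mulrBl mul1r.
rewrite E0; under eq_bigr do rewrite Ex_h1_A1 Ex_dh_dl_A2.
rewrite sumrB -mulr_sumr -mulr_sumr ETT -mulr_sumr.
set S1 := \sum_(i < n) Ex Q _; set S2 := \sum_(i < n) _; set s := Num.sqrt _.
by field; rewrite gt_eqF// sqrtn_gt0.
Qed.

End Identity.
End SteinIdentity.

(** * Norms weighted by a density *)

Section WeightedNorm.
Context (R : realType).
Notation leb := (@lebesgue_measure R).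
Variable f : R -> R.
Hypothesis mf : measurable_fun [set: R] f.
Hypothesis f0 : forall x, 0 < f x.

(* a bounds the norm of t / f in L2 of the density f. *)
Definition wnorm_le (t : R -> R) (a : R) := measurable_fun [set: R] t /\
  (\int[leb]_x (t x ^+ 2 / f x)%:E <= (a ^+ 2)%:E)%E.

Lemma measurable_sqr_div (t : R -> R) : measurable_fun [set: R] t ->
  measurable_fun [set: R] (fun x => (t x ^+ 2 / f x)%:E).
Proof.
move=> mt; apply/measurable_EFinP/measurable_funM; first exact: measurable_funX.
exact: measurable_funV.
Qed.

Lemma sqr_div_ge0 (t : R -> R) x : (0 <= (t x ^+ 2 / f x)%:E)%E.
Proof. by rewrite lee_fin divr_ge0 ?sqr_ge0// ltW. Qed.

(** Minkowski from the pointwise inequality (s + t)^2 <= (a + b) / a s^2 + (a + b) / b t^2, whose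
    weights are tuned to the two bounds and therefore need both positive. *)
Lemma wnorm_leD s t a b : 0 < a -> 0 < b -> wnorm_le s a -> wnorm_le t b ->
  wnorm_le (fun x => s x + t x) (a + b).
Proof.
move=> a0 b0 [ms sa] [mt tb]; split; first exact: measurable_funD.
have A0 : 0 <= (a + b) / a by rewrite divr_ge0 ?addr_ge0// ltW.
have B0 : 0 <= (a + b) / b by rewrite divr_ge0 ?addr_ge0// ltW.
have mS := measurable_sqr_div ms; have mT := measurable_sqr_div mt.
apply: (@le_trans _ _ (\int[leb]_x (((a + b) / a)%:E * (s x ^+ 2 / f x)%:E
   + ((a + b) / b)%:E * (t x ^+ 2 / f x)%:E))%E).
  apply: ge0_le_integral => //.
  - by move=> x _; exact: (@sqr_div_ge0 (fun x => s x + t x)).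
  - by apply: measurable_sqr_div; exact: measurable_funD.
  - by apply: emeasurable_funD; exact: measurable_funeM.
  - move=> x _; rewrite -!EFinM -EFinD lee_fin -!mulrA -!mulrDr.
    rewrite -subr_ge0.
    rewrite (_ : _ - _ = (b * s x - a * t x) ^+ 2 / (a * b) / f x); last first.
      by field; rewrite !gt_eqF.
    by rewrite !divr_ge0 ?sqr_ge0 ?mulr_ge0// ltW.
rewrite ge0_integralD//; last 4 first.
- by move=> x _; apply: mule_ge0; [rewrite lee_fin|exact: sqr_div_ge0].
- exact: measurable_funeM.
- by move=> x _; apply: mule_ge0; [rewrite lee_fin|exact: sqr_div_ge0].
- exact: measurable_funeM.
rewrite !ge0_integralZl//; try by move=> x _; exact: sqr_div_ge0.
apply: (@le_trans _ _ (((a + b) / a)%:E * (a ^+ 2)%:E + ((a + b) / b)%:E * (b ^+ 2)%:E)%E).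
  by apply: leeD; rewrite lee_wpmul2l// lee_fin.
rewrite -!EFinM -EFinD lee_fin; apply: le_of_eq; field.
by rewrite !gt_eqF.
Qed.

Lemma wnorm_leW t a b : 0 <= a -> a <= b -> wnorm_le t a -> wnorm_le t b.
Proof.
move=> a0 ab [mt ta]; split => //; apply: (le_trans ta).
by rewrite lee_fin lerXn2r// nnegrE (le_trans a0).
Qed.

Lemma wnorm_leZ c t a : wnorm_le t a -> wnorm_le (fun x => c * t x) (c * a).
Proof.
move=> [mt ta]; split; first by apply: measurable_funM => //; exact: measurable_cst.
have mT := measurable_sqr_div mt.
under eq_integral do rewrite exprMn -mulrA EFinM.
rewrite ge0_integralZl//; last 2 first.
- by move=> x _; exact: sqr_div_ge0.
- by rewrite lee_fin sqr_ge0.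
by rewrite exprMn [leRHS]EFinM lee_wpmul2l// lee_fin sqr_ge0.
Qed.

Lemma wnorm_le_sum n (t : 'I_n.+1 -> R -> R) a : 0 < a -> (forall i, wnorm_le (t i) a) ->
  wnorm_le (fun x => \sum_(i < n.+1) t i x) (n.+1%:R * a).
Proof.
elim: n t => [|n IH] t a0 ta.
  under eq_fun do rewrite big_ord_recl big_ord0 addr0.
  by rewrite mul1r; exact: ta.
under eq_fun do rewrite big_ord_recl.
rewrite -natr1 addrC mulrDl mul1r; apply: wnorm_leD => //.
  by rewrite mulr_gt0.
by apply: IH.
Qed.

End WeightedNorm.

Section MixtureNorm.
Context d (W : measurableType d) (R : realType) (P : probability W R).
Notation leb := (@lebesgue_measure R).
Variables (U : W -> R).
Hypothesis bU : bmf U.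
Variable r : R.
Hypothesis r1 : -1 < r < 1.

Lemma bmf_expR (g : W -> R) : bmf g -> bmf (fun w => expR (g w)).
Proof.
move=> [mg [M gM]]; split; first exact: measurableT_comp.
exists (expR M) => w; rewrite ger0_norm ?expR_ge0// ler_expR.
by rewrite (le_trans _ (gM w))// ler_norm.
Qed.

Lemma bmf_gkV x : bmf (fun w => (gk r (U w) x)^-1).
Proof.
under eq_fun do rewrite /gk invfM invrK -expRN opprK.
apply: bmfM; first exact: bmf_cst.
apply: bmf_expR; apply: bmfM; last exact: bmf_cst.
apply: bmfX; apply: bmfB; first exact: bmf_cst.
by apply: bmfM => //; exact: bmf_cst.
Qed.

Lemma measurable_gk2 : measurable_fun [set: W * R] (fun p => gk r (U p.1) p.2).
Proof.
have mp : measurable_fun [set: W * R] (fun p => (p.1, (r, p.2))).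
  apply: measurable_fun_pair; first exact: measurable_fst.
  by apply: measurable_fun_pair; [exact: measurable_cst|exact: measurable_snd].
exact: (measurableT_comp (measurable_gk (proj1 bU)) mp).
Qed.

Lemma measurable_mixr : measurable_fun [set: R] (mix P U r).
Proof.
exact: (@measurable_fun_pair2 _ _ _ _ _ _ (fun p : R * R => mix P U p.1 p.2) r
  (measurable_mix P (proj1 bU))).
Qed.

(** By [weighted_CS], E[B l g]^2 / E[g] <= E[B^2 l^2 g] for each x. Tonelli then isolates the
    integral of l^2 g in x, which is Gaussian for each sample point and bounded by C. *)
Lemma mixture_norm_le (B : W -> R) (l : W * R -> R) (C : R) : bmf B ->
    measurable_fun [set: W * R] l -> (forall x, bmf (fun w => l (w, x))) ->
    (forall w, (\int[leb]_x (l (w, x) ^+ 2 * gk r (U w) x)%:E <= C%:E)%E) ->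
  (\int[leb]_x (Ex P (fun w => B w * (l (w, x) * gk r (U w) x)) ^+ 2 / mix P U r x)%:E
    <= (C * Ex P (fun w => B w ^+ 2))%:E)%E.
Proof.
move=> bB ml bl lC; have mU := proj1 bU.
have bg x : bmf (fun w => gk r (U w) x) by exact: (@bmf_gk _ _ R U mU r x r1).
have mB1 : measurable_fun [set: W * R] (fun p => B p.1).
  exact: (measurableT_comp (proj1 bB) measurable_fst).
pose H (p : W * R) : R := B p.1 ^+ 2 * (l p ^+ 2 * gk r (U p.1) p.2).
have mlg : measurable_fun [set: W * R] (fun p => l p ^+ 2 * gk r (U p.1) p.2).
  by apply: measurable_funM measurable_gk2; exact: measurable_funX.
have mH : measurable_fun [set: W * R] H.
  by apply: measurable_funM mlg; exact: measurable_funX.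
have H0 p : 0 <= H p.
  by rewrite mulr_ge0 ?sqr_ge0// mulr_ge0 ?sqr_ge0// ltW// gk_gt0.
have bH x : bmf (fun w => H (w, x)).
  exact: (bmfM (bmfX 2 bB) (bmfM (bmfX 2 (bl x)) (bg x))).
apply: (@le_trans _ _ (\int[leb]_x (Ex P (fun w => H (w, x)))%:E)%E).
  apply: ge0_le_integral => //.
  - by move=> x _; rewrite lee_fin divr_ge0 ?sqr_ge0// ltW// (mix_gt0 P mU x r1).
  - apply: measurable_sqr_div; first exact: measurable_mixr.
    apply: (@measurable_Ex _ _ _ _ R P (fun p : W * R => B p.1 * (l p * gk r (U p.1) p.2))).
    by apply: measurable_funM mB1 _; apply: measurable_funM ml measurable_gk2.
  - by apply/measurable_EFinP; exact: (@measurable_Ex _ _ _ _ R P H mH).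
  - move=> x _; rewrite lee_fin.
    have bBl : bmf (fun w => B w * l (w, x)) by exact: bmfM.
    have := @weighted_CS _ W R P (fun w => B w * l (w, x)) (fun w => gk r (U w) x)
      (proj1 bBl) (bg x) (fun w => ltW (gk_gt0 (U w) x r1))
      (bmf_int P (bmfM bBl (bg x))) (bmf_int P (bmfM (bmfX 2 bBl) (bg x)))
      (mix_gt0 P mU x r1).
    rewrite /mix; congr (Ex P _ ^+ 2 / _ <= Ex P _); apply/funext => w.
      by rewrite mulrA.
    by rewrite /H/= exprMn mulrA.
under eq_integral do rewrite (EFin_Ex (bmf_int P (bH _))).
rewrite -(@fubini_tonelli _ _ _ _ R P leb (EFin \o H)); last 2 first.
- exact/measurable_EFinP.
- by move=> p; rewrite lee_fin.
have bB2 := bmfX 2 bB.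
apply: (@le_trans _ _ (\int[P]_w (C * B w ^+ 2)%:E)%E); last first.
  rewrite -EFin_Ex ?ExZ//; first exact: bmf_int.
  by apply: bmf_int; apply: bmfM => //; exact: bmf_cst.
apply: ge0_le_integral => //.
- by move=> w _; apply: integral_ge0 => x _; rewrite lee_fin.
- apply: (@measurable_fun_fubini_tonelli_F _ _ _ _ R leb (EFin \o H)) => //.
    exact/measurable_EFinP.
- by apply/measurable_EFinP/measurable_funM; [exact: measurable_cst|exact: (proj1 bB2)].
- move=> w _; rewrite /H/=; under eq_integral do rewrite EFinM.
  rewrite ge0_integralZl//.
  + by rewrite [C * _]mulrC [leRHS]EFinM; apply: lee_wpmul2l => //; rewrite lee_fin sqr_ge0.
  + by apply/measurable_EFinP; exact: (@measurable_fun_pair2 _ _ _ _ _ _ _ w mlg).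
  + by move=> x _; rewrite lee_fin mulr_ge0 ?sqr_ge0// ltW// gk_gt0.
  + by rewrite lee_fin sqr_ge0.
Qed.

End MixtureNorm.

(** * Moments of the degenerate part and of the Stein kernel *)

Section SteinMoments.
Context d (T : measurableType d) (R : realType) (mu : probability T R).
Context (n : nat) (Q : probability (n.+1.-tuple T) R).
Hypothesis n1 : (1 < n)%N.
Hypothesis Qout : integrates_out mu Q.
Variables (u : T * T -> R) (b m : R).
Hypothesis meas_u : measurable_fun [set: T * T] u.
Hypothesis ub : forall p, `|u p| <= b.
Hypothesis uC : forall x y, u (x, y) = u (y, x).
Hypothesis h1_var : Ex mu (fun z => h1 mu u z ^+ 2) = 4^-1.
Hypothesis m0 : 0 <= m.
Hypothesis u4 : Ex2 mu (fun p => u p ^+ 4) <= m ^+ 2.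

Let but : bmf (ut mu u) := bmf_ut mu meas_u ub.
Let bh1 : bmf (h1 mu u) := bmf_h1 mu meas_u ub.
Let bh2 : bmf (h2 mu u) := bmf_h2 mu meas_u ub.
Let bqq : bmf (qq mu u) := bmf_qq mu meas_u ub.
Let bk1 : bmf (k1 mu u) := bmf_k1 mu meas_u ub.
Let bu : bmf u := bmf_u meas_u ub.
Let bh1_fst : bmf (fun p : T * T => h1 mu u p.1) := bmf_fst bh1.
Let bh1_snd : bmf (fun p : T * T => h1 mu u p.2) := bmf_snd bh1.

Lemma Ex2B f g : bmf f -> bmf g -> Ex2 mu (fun p => f p - g p) = Ex2 mu f - Ex2 mu g.
Proof.
move=> bf bg; have -> : (fun p => f p - g p) = (fun p => f p + -1 * g p).
  by apply/funext => p; rewrite mulN1r.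
by rewrite (Ex2D mu bf (bmfM (bmf_cst _ _) bg)) (Ex2Z mu _ bg) mulN1r.
Qed.

Lemma Ex2_ge0 f : (forall p, 0 <= f p) -> 0 <= Ex2 mu f.
Proof. by move=> f0; apply: Ex_ge0 => z; apply: Ex_ge0 => y; exact: f0. Qed.

Lemma Ex2_cst c : Ex2 mu (fun=> c) = c.
Proof. by rewrite (Ex2_fst mu (fun=> c)) Ex_cst. Qed.

(** Fubini for mu x mu, read off the sample law: two coordinates can be integrated out in either
    order. *)
Lemma Ex2C f : bmf f -> Ex2 mu (fun p => f (p.2, p.1)) = Ex2 mu f.
Proof.
move=> bf; have [j kj] := exists_neq n1 ord0.
have bfs : bmf (fun p : T * T => f (p.2, p.1)).
  by apply: bmf_comp bf _; apply: measurable_fun_pair.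
have jk : j != ord0 by rewrite eq_sym.
by rewrite -(Ex_tnth2 Qout n1 kj bf) -(Ex_tnth2 Qout n1 jk bfs).
Qed.

Lemma sqr_Ex2_le f : bmf f -> Ex2 mu f ^+ 2 <= Ex2 mu (fun p => f p ^+ 2).
Proof.
move=> bf; rewrite (le_trans (sqr_Ex_le mu (bmf_integ mu bf)))//.
apply: le_Ex => [||z].
- by apply: bmf_int; apply: bmfX; exact: bmf_integ.
- by apply: bmf_int; apply: bmf_integ; exact: bmfX.
- by apply: sqr_Ex_le; exact: bmf_pair1.
Qed.

Lemma sqr_integ_le f : bmf f ->
  Ex mu (fun z => integ mu f z ^+ 2) <= Ex2 mu (fun p => f p ^+ 2).
Proof.
move=> bf; apply: le_Ex => [||z].
- by apply: bmf_int; apply: bmfX; exact: bmf_integ.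
- by apply: bmf_int; apply: bmf_integ; exact: bmfX.
- by apply: sqr_Ex_le; exact: bmf_pair1.
Qed.

Lemma Ex2_h1_ut : Ex2 mu (fun p => h1 mu u p.1 * ut mu u p) = 4^-1.
Proof.
rewrite -(Ex2C (bmf_h1ut mu meas_u ub))/= -h1_var.
congr Ex; apply/funext => z; rewrite /integ/=.
under eq_fun do rewrite (utC mu uC).
by rewrite ExZ ?expr2//; apply: bmf_int; exact: bmf_pair1.
Qed.

Lemma Ex2_h1_h1 : Ex2 mu (fun p => h1 mu u p.1 * h1 mu u p.2) = 0.
Proof.
rewrite /Ex2 (_ : integ _ _ = fun=> 0) ?Ex_cst//; apply/funext => z; rewrite /integ/=.
under eq_fun do rewrite mulrC.
by rewrite ExZ ?(Ex_h1 mu meas_u ub) ?mulr0//; exact: bmf_int.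
Qed.

(** Pythagoras for the Hoeffding decomposition: the two projections each carry 1/4 and are
    orthogonal to the rest. *)
Lemma Ex2_sqr_h2 : Ex2 mu (fun p => h2 mu u p ^+ 2) = Ex2 mu (fun p => ut mu u p ^+ 2) - 2^-1.
Proof.
have -> : (fun p => h2 mu u p ^+ 2) = (fun p => ut mu u p ^+ 2 +
    (-2 * (h1 mu u p.1 * ut mu u p) + (-2 * (h1 mu u p.2 * ut mu u p) +
    (2 * (h1 mu u p.1 * h1 mu u p.2) + (h1 mu u p.1 ^+ 2 + h1 mu u p.2 ^+ 2))))).
  by apply/funext => p; rewrite /h2; ring.
have b1 : bmf (fun p => h1 mu u p.1 * ut mu u p) by exact: bmfM.
have b2 : bmf (fun p => h1 mu u p.2 * ut mu u p) by exact: bmfM.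
have b3 : bmf (fun p : T * T => h1 mu u p.1 * h1 mu u p.2) by exact: bmfM.
have bf2 := bmf_fst (bmfX 2 bh1); have bs2 := bmf_snd (bmfX 2 bh1).
have c2 (c : R) (f : T * T -> R) : bmf f -> bmf (fun p => c * f p).
  by apply: bmfM; exact: bmf_cst.
rewrite (Ex2D mu (bmfX 2 but) (bmfD (c2 _ _ b1) (bmfD (c2 _ _ b2) (bmfD (c2 _ _ b3) (bmfD bf2 bs2))))).
rewrite (Ex2D mu (c2 _ _ b1) (bmfD (c2 _ _ b2) (bmfD (c2 _ _ b3) (bmfD bf2 bs2)))).
rewrite (Ex2D mu (c2 _ _ b2) (bmfD (c2 _ _ b3) (bmfD bf2 bs2))).
rewrite (Ex2D mu (c2 _ _ b3) (bmfD bf2 bs2)) (Ex2D mu bf2 bs2).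
rewrite (Ex2Z mu _ b1) (Ex2Z mu _ b2) (Ex2Z mu _ b3) Ex2_h1_h1 Ex2_h1_ut.
rewrite (Ex2_fst mu (fun z => h1 mu u z ^+ 2)) (Ex2_snd mu (fun z => h1 mu u z ^+ 2)) h1_var.
have -> : Ex2 mu (fun p => h1 mu u p.2 * ut mu u p) = 4^-1.
  rewrite -Ex2_h1_ut -(Ex2C b2)/=; congr Ex2; apply/funext => -[y z] /=.
  by rewrite (utC mu uC).
by field.
Qed.

Lemma Ex2_sqr_ut_le : Ex2 mu (fun p => ut mu u p ^+ 2) <= Ex2 mu (fun p => u p ^+ 2).
Proof.
have -> : (fun p => ut mu u p ^+ 2) = (fun p => u p ^+ 2 +
    (-2 * theta mu u * u p + theta mu u ^+ 2)).
  by apply/funext => p; rewrite /ut; ring.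
have bb : bmf (fun p => -2 * theta mu u * u p) by apply: bmfM => //; exact: bmf_cst.
have bc := bmf_cst (T * T)%type (theta mu u ^+ 2).
rewrite (Ex2D mu (bmfX 2 bu) (bmfD bb bc)) (Ex2D mu bb bc) (Ex2Z mu _ bu) Ex2_cst.
rewrite -/(theta mu u); have := sqr_ge0 (theta mu u); lra.
Qed.

Lemma Ex2_sqr_u_le : Ex2 mu (fun p => u p ^+ 2) <= m.
Proof.
rewrite -(@ler_pXn2r _ 2)//; last by rewrite nnegrE; apply: Ex2_ge0 => p; exact: sqr_ge0.
apply: le_trans (sqr_Ex2_le (bmfX 2 bu)) _; apply: le_trans u4.
by apply: le_of_eq; congr Ex2; apply/funext => p; rewrite -exprM.
Qed.

(** The second moment of h2 is nonnegative, so the centred kernel has second moment at least 1/2,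
    the share of its two projections. *)
Lemma m_ge : 2^-1 <= m.
Proof.
apply: le_trans Ex2_sqr_u_le; apply: le_trans Ex2_sqr_ut_le.
by rewrite -subr_ge0 -Ex2_sqr_h2; apply: Ex2_ge0 => p; exact: sqr_ge0.
Qed.

Lemma Ex_sqr_Udeg : Ex Q (fun t => Udeg mu u t ^+ 2) <= (2 * m / Num.sqrt (n%:R - 1)) ^+ 2.
Proof.
have n0 : 0 < n%:R :> R by rewrite ltr0n ltnW.
have n10 : 0 < n%:R - 1 :> R by rewrite subr_gt0 (n_gt1 R n1).
rewrite /Udeg; under eq_fun do rewrite exprMn.
rewrite ExZ; last by apply: bmf_int; apply: bmfX; exact: bmf_offsum.
have h2C x y : h2 mu u (x, y) = h2 mu u (y, x).
  by rewrite /h2 (utC mu uC)/=; ring.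
have h20 y : integ mu (h2 mu u) y = 0.
  rewrite /integ /h2/= ExB; last 2 first.
  - apply: bmf_int; apply: bmfB => //; exact: (bmf_pair1 y but).
  - exact/bmf_int/bmf_cst.
  rewrite ExB; [|exact/bmf_int/(bmf_pair1 y but)|exact: bmf_int].
  by rewrite (Ex_h1 mu meas_u ub) Ex_cst subr0 -/(integ mu _ y) -/(h1 mu u y) subrr.
have := degenerate_offsum Qout n1 bh2 h2C h20.
rewrite Ex2_sqr_h2; set E := Ex Q _; set V := Ex2 mu _ => EV.
(* The natural bound V <= m is of degree one in m; it is traded for degree two so that all norms
   scale like m. *)
have V2 : V - 2^-1 <= 2 * m ^+ 2.
  have := Ex2_sqr_ut_le; have := Ex2_sqr_u_le; rewrite -/V; have := m_ge; nra.
apply: (@le_trans _ _ (cU R n ^+ 2 * (2 * n%:R * (n%:R - 1) * (2 * m ^+ 2)))).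
  rewrite ler_wpM2l ?sqr_ge0// (le_trans EV)// ler_wpM2l//.
  by rewrite !mulr_ge0// ltW.
apply: le_of_eq.
rewrite /cU !exprMn !exprVn exprMn !sqr_sqrtr ?(ltW n0) ?(ltW n10)//.
by field; rewrite !gt_eqF.
Qed.

Lemma Ex2_qq : Ex2 mu (qq mu u) = 2^-1.
Proof.
have b1 : bmf (fun p => h1 mu u p.1 * ut mu u p) by exact: bmfM.
have b3 : bmf (fun p : T * T => h1 mu u p.1 * h1 mu u p.2) by exact: bmfM.
rewrite /qq (Ex2D mu (bmfB b1 b3) (bmf_snd bk1)) (Ex2B b1 b3) Ex2_h1_h1 Ex2_h1_ut.
rewrite (Ex2_snd mu (k1 mu u)) (_ : Ex mu (k1 mu u) = 4^-1); last exact: Ex2_h1_ut.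
by field.
Qed.

Lemma Ex2_ut4 : Ex2 mu (fun p => ut mu u p ^+ 4) <= 16 * m ^+ 2.
Proof.
have th : theta mu u ^+ 4 <= m ^+ 2.
  apply: le_trans u4; rewrite (_ : theta mu u ^+ 4 = (theta mu u ^+ 2) ^+ 2); last by rewrite -exprM.
  apply: (@le_trans _ _ (Ex2 mu (fun p => u p ^+ 2) ^+ 2)).
    rewrite lerXn2r// ?nnegrE ?sqr_ge0//; first by apply: Ex2_ge0 => p; exact: sqr_ge0.
    exact: sqr_Ex2_le.
  apply: le_trans (sqr_Ex2_le (bmfX 2 bu)) _.
  by apply: le_of_eq; congr Ex2; apply/funext => p; rewrite -exprM.
have b8 : bmf (fun p => 8 * u p ^+ 4) by apply: bmfM; [exact: bmf_cst|exact: bmfX].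
have bc := bmf_cst (T * T)%type (8 * theta mu u ^+ 4).
apply: (@le_trans _ _ (Ex2 mu (fun p => 8 * u p ^+ 4 + 8 * theta mu u ^+ 4))).
  apply: le_Ex2; [exact: bmfX|exact: bmfD|move=> p].
  rewrite /ut; set x := u p; set y := theta mu u.
  have E2 : (x - y) ^+ 2 <= 2 * x ^+ 2 + 2 * y ^+ 2.
    by have := sqr_ge0 (x + y); nra.
  have E4 : (x - y) ^+ 4 <= (2 * x ^+ 2 + 2 * y ^+ 2) ^+ 2.
    rewrite (_ : (x - y) ^+ 4 = ((x - y) ^+ 2) ^+ 2); last by rewrite -exprM.
    by rewrite lerXn2r// nnegrE ?sqr_ge0// addr_ge0// mulr_ge0// sqr_ge0.
  have := sqr_ge0 (x ^+ 2 - y ^+ 2); nra.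
rewrite (Ex2D mu b8 bc) (Ex2Z mu _ (bmfX 4 bu)) Ex2_cst.
rewrite (_ : 16 * m ^+ 2 = 8 * m ^+ 2 + 8 * m ^+ 2); last by ring.
by apply: lerD; rewrite ler_wpM2l.
Qed.

Lemma Ex_h14 : Ex mu (fun z => h1 mu u z ^+ 4) <= 16 * m ^+ 2.
Proof.
apply: le_trans Ex2_ut4.
have b2 := bmfX 2 but.
apply: (@le_trans _ _ (Ex mu (fun z => integ mu (fun p => ut mu u p ^+ 2) z ^+ 2))).
  apply: le_Ex => [||z].
  - by apply: bmf_int; exact: bmfX.
  - by apply: bmf_int; apply: bmfX; exact: bmf_integ.
  - rewrite (_ : h1 mu u z ^+ 4 = (h1 mu u z ^+ 2) ^+ 2); last by rewrite -exprM.
    rewrite lerXn2r// ?nnegrE ?sqr_ge0//; first by apply: Ex_ge0 => y; exact: sqr_ge0.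
    by apply: sqr_Ex_le; exact: bmf_pair1.
apply: le_trans (sqr_integ_le b2) _.
by apply: le_of_eq; congr Ex2; apply/funext => p; rewrite -exprM.
Qed.

(** [qq] has three terms, each of second moment at most 16 m^2 by the arithmetic-geometric mean and
    Jensen inequalities; the square of a sum of three costs 3 times the sum of squares, and 3 * 3 *
    16 = 144. *)
Lemma Ex2_sqr_qq : Ex2 mu (fun p => qq mu u p ^+ 2) <= 144 * m ^+ 2.
Proof.
have b1 : bmf (fun p => h1 mu u p.1 * ut mu u p) by exact: bmfM.
have b3 : bmf (fun p : T * T => h1 mu u p.1 * h1 mu u p.2) by exact: bmfM.
have bf4 := bmf_fst (bmfX 4 bh1); have bs4 := bmf_snd (bmfX 4 bh1).
have c2 (c : R) (f : T * T -> R) : bmf f -> bmf (fun p => c * f p).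
  by apply: bmfM; exact: bmf_cst.
have amgm (x y : R) : (x * y) ^+ 2 <= 2^-1 * (x ^+ 4 + y ^+ 4).
  by have := sqr_ge0 (x ^+ 2 - y ^+ 2); nra.
have I1 : Ex2 mu (fun p => (h1 mu u p.1 * ut mu u p) ^+ 2) <= 16 * m ^+ 2.
  apply: (@le_trans _ _ (Ex2 mu (fun p => 2^-1 * (h1 mu u p.1 ^+ 4 + ut mu u p ^+ 4)))).
    apply: le_Ex2; [exact: bmfX|apply: c2; apply: bmfD => //; exact: bmfX|by []].
  rewrite (Ex2Z mu _ (bmfD bf4 (bmfX 4 but))) (Ex2D mu bf4 (bmfX 4 but)).
  rewrite (Ex2_fst mu (fun z => h1 mu u z ^+ 4)); have := Ex2_ut4; have := Ex_h14; lra.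
have I2 : Ex2 mu (fun p => (h1 mu u p.1 * h1 mu u p.2) ^+ 2) <= 16 * m ^+ 2.
  apply: (@le_trans _ _ (Ex2 mu (fun p => 2^-1 * (h1 mu u p.1 ^+ 4 + h1 mu u p.2 ^+ 4)))).
    by apply: le_Ex2; [exact: bmfX|apply: c2; exact: bmfD|].
  rewrite (Ex2Z mu _ (bmfD bf4 bs4)) (Ex2D mu bf4 bs4).
  rewrite (Ex2_fst mu (fun z => h1 mu u z ^+ 4)) (Ex2_snd mu (fun z => h1 mu u z ^+ 4)).
  have := Ex_h14; lra.
have I3 : Ex2 mu (fun p => k1 mu u p.2 ^+ 2) <= 16 * m ^+ 2.
  rewrite (Ex2_snd mu (fun z => k1 mu u z ^+ 2)).
  exact: le_trans (sqr_integ_le b1) I1.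
have b12 := bmfX 2 b1; have b32 := bmfX 2 b3; have bk2 := bmf_snd (bmfX 2 bk1).
apply: (@le_trans _ _ (Ex2 mu (fun p => 3 * ((h1 mu u p.1 * ut mu u p) ^+ 2 +
    ((h1 mu u p.1 * h1 mu u p.2) ^+ 2 + k1 mu u p.2 ^+ 2))))).
  apply: le_Ex2; [exact: bmfX|apply: c2; apply: bmfD => //; exact: bmfD|move=> p].
  rewrite /qq; set x := _ * ut _ _ _; set y := _ * _; set z := k1 _ _ _.
  rewrite -subr_ge0 (_ : _ - _ = (x + y) ^+ 2 + ((x - z) ^+ 2 + (y + z) ^+ 2)); last by ring.
  by rewrite addr_ge0 ?addr_ge0 ?sqr_ge0.
rewrite (Ex2Z mu _ (bmfD b12 (bmfD b32 bk2))) (Ex2D mu b12 (bmfD b32 bk2)) (Ex2D mu b32 bk2).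
move: I1 I2 I3; set x := Ex2 _ _; set y := Ex2 _ _; set z := Ex2 _ _.
generalize x y z => {}x {}y {}z I1 I2 I3.
rewrite (_ : 144 * m ^+ 2 = 3 * (16 * m ^+ 2 + (16 * m ^+ 2 + 16 * m ^+ 2))); last by ring.
by rewrite ler_wpM2l// lerD// lerD.
Qed.

(** [TT - 1] is the normalised sum of qq - 1/2, centred but not degenerate, so [variance_offsum]
    applies: 48^2 = 2^2 * 4 * 144. *)
Lemma Ex_sqr_TT : Ex Q (fun t => (TT mu u t - 1) ^+ 2) <= (48 * m / Num.sqrt n%:R) ^+ 2.
Proof.
have n0 : 0 < n%:R :> R by rewrite ltr0n ltnW.
have n10 : 0 < n%:R - 1 :> R by rewrite subr_gt0 (n_gt1 R n1).
have bq0 : bmf (fun p => qq mu u p - 2^-1) by apply: bmfB => //; exact: bmf_cst.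
have q0 : Ex2 mu (fun p => qq mu u p - 2^-1) = 0.
  by rewrite (Ex2B bqq (bmf_cst _ _)) Ex2_qq Ex2_cst subrr.
have c0 : 2 * cU R n / Num.sqrt n%:R = 2 / (n%:R * (n%:R - 1)).
  have s0 : Num.sqrt n%:R != 0 :> R by rewrite gt_eqF ?sqrtr_gt0.
  have aux (s k : R) : s ^+ 2 = k -> s != 0 -> 0 < k - 1 ->
      2 * (s * (k - 1))^-1 / s = 2 / (k * (k - 1)).
    by move=> <- s1 k1; field; rewrite s1 gt_eqF.
  by apply: aux => //; exact/sqr_sqrtr/ltW.
have -> : (fun t : n.+1.-tuple T => (TT mu u t - 1) ^+ 2) =
    (fun t => (2 / (n%:R * (n%:R - 1))) ^+ 2 * offsum (fun p => qq mu u p - 2^-1) t ^+ 2).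
  apply/funext => t; rewrite -exprMn; congr (_ ^+ 2); rewrite /TT c0 /offsum.
  under [in RHS]eq_bigr do rewrite sumrB.
  rewrite sumrB (offsum_cst n1); field; by rewrite !gt_eqF.
rewrite ExZ; last by apply: bmf_int; apply: bmfX; exact: bmf_offsum.
have := variance_offsum Qout n1 bq0 q0.
set E := Ex Q _; set V := Ex2 mu _ => EV.
have V2 : V <= 144 * m ^+ 2.
  apply: le_trans Ex2_sqr_qq; rewrite /V.
  have -> : (fun p => (qq mu u p - 2^-1) ^+ 2) = (fun p => qq mu u p ^+ 2 - (qq mu u p - 4^-1)).
    by apply/funext => p; field.
  rewrite (Ex2B (bmfX 2 bqq) (bmfB bqq (bmf_cst _ _))) (Ex2B bqq (bmf_cst _ _)) Ex2_qq Ex2_cst.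
  lra.
apply: (@le_trans _ _ ((2 / (n%:R * (n%:R - 1))) ^+ 2 * (4 * n%:R * (n%:R - 1) ^+ 2 * (144 * m ^+ 2)))).
  rewrite ler_wpM2l ?sqr_ge0// (le_trans EV)// ler_wpM2l//.
  by rewrite !mulr_ge0 ?sqr_ge0// ltW.
apply: le_of_eq.
rewrite !exprMn !exprVn sqr_sqrtr ?(ltW n0)// exprMn.
by field; rewrite !gt_eqF.
Qed.

End SteinMoments.

Section JointMeasurability.
Context d (W : measurableType d) (R : realType).
Variables (U : W -> R) (r : R).
Hypothesis bU : bmf U.
Hypothesis r1 : -1 < r < 1.

Lemma measurable_z : measurable_fun [set: W * R] (fun p => (p.2 - r * U p.1) / sg r).
Proof.
apply: measurable_funM; last exact: measurable_cst.
apply: measurable_funB; first exact: measurable_snd.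
apply: measurable_funM; first exact: measurable_cst.
exact: (measurableT_comp (proj1 bU) measurable_fst).
Qed.

Lemma measurable_npdf1 : measurable_fun [set: W * R] (fun p => npdf1 (r * U p.1) (sg r) p.2).
Proof.
rewrite /npdf1; under eq_fun do rewrite -gkE//.
apply: measurable_funM (measurable_gk2 bU r); apply: measurable_funN.
by apply: measurable_funM measurable_z _; exact: measurable_cst.
Qed.

Lemma measurable_npdf2 : measurable_fun [set: W * R] (fun p => npdf2 (r * U p.1) (sg r) p.2).
Proof.
rewrite /npdf2; under eq_fun do rewrite -gkE//.
apply: measurable_funM (measurable_gk2 bU r).
apply: measurable_funM; last exact: measurable_cst.
by apply: measurable_funB; [apply: measurable_funX; exact: measurable_z|exact: measurable_cst].
Qed.

End JointMeasurability.

Section OneMinusSquare.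
Context (R : realType).
Implicit Types r : R.

Lemma onem_sqrE r : 1 - r ^+ 2 = (1 + r) * (1 - r). Proof. by ring. Qed.

Lemma sqr_onem_le r : 0 <= r -> r < 1 -> (1 - r) ^+ 2 <= 1 - r ^+ 2.
Proof.
move=> r0 r1; have or0 : 0 <= 1 - r by lra.
by rewrite onem_sqrE expr2 ler_wpM2r//; lra.
Qed.

Lemma div_onem_sqr_le r : 0 <= r -> r < 1 -> r / (1 - r ^+ 2) <= 2^-1 / (1 - r).
Proof.
move=> r0 r1; have or0 : 0 <= 1 - r by lra.
rewrite onem_sqrE invfM mulrA ler_wpM2r ?invr_ge0//.
by rewrite ler_pdivrMr; lra.
Qed.

Lemma sqr_div_onem_sqr_le r : 0 <= r -> r < 1 -> r ^+ 2 / (1 - r ^+ 2) <= 2^-1 / (1 - r).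
Proof.
move=> r0 r1; have or0 : 0 <= 1 - r by lra.
apply: le_trans (div_onem_sqr_le r0 r1); rewrite ler_wpM2r//.
  by rewrite invr_ge0 onem_sqrE mulr_ge0//; lra.
by rewrite expr2 ler_piMr// ltW.
Qed.

Lemma cube_div_onem_sqr_le r : 0 <= r -> r < 1 ->
  r ^+ 3 / (1 - r ^+ 2) ^+ 2 <= 4^-1 / (1 - r) ^+ 2.
Proof.
move=> r0 r1; have or0 : 0 <= 1 - r by lra.
rewrite onem_sqrE exprMn invfM mulrA ler_wpM2r ?invr_ge0 ?sqr_ge0//.
rewrite ler_pdivrMr; last by rewrite exprn_gt0//; lra.
have -> : r ^+ 3 = r * (r * r) by ring.
have h1 : r * (r * r) <= r * 1 by rewrite ler_wpM2l// mulr_ile1// ltW.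
have := sqr_ge0 (1 - r); nra.
Qed.

Lemma sqr_mulE (l g : R) : 0 < g -> l ^+ 2 * g = (l * g) ^+ 2 / g.
Proof. by move=> g0; field; rewrite gt_eqF. Qed.

(** 44/5 is a round number whose square 77.44 exceeds 6144/5 / 16 = 76.8. *)
Lemma remainder_constant_le (c a e : R) : 0 <= a -> a <= 4^-1 / e ->
  6144 / 5 * c ^+ 2 * a ^+ 2 <= (44 / 5 * c / e) ^+ 2.
Proof.
move=> a0 ae; have h : a ^+ 2 <= (4^-1 / e) ^+ 2.
  by rewrite lerXn2r// nnegrE (le_trans a0).
have := ler_wpM2l (sqr_ge0 c) h.
have := mulr_ge0 (sqr_ge0 c) (sqr_ge0 (4^-1 / e)).
by rewrite !exprMn; set p := e^-1 ^+ 2; set q := c ^+ 2; lra.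
Qed.

End OneMinusSquare.

(** * Bounds on the three terms of the Stein identity *)

Section SteinBound.
Context d (T : measurableType d) (R : realType) (mu : probability T R).
Context (n : nat) (Q : probability (n.+1.-tuple T) R).
Hypothesis n1 : (1 < n)%N.
Hypothesis Qswap : swap_invariant Q.
Hypothesis Qout : integrates_out mu Q.
Variables (u : T * T -> R) (b m : R).
Hypothesis meas_u : measurable_fun [set: T * T] u.
Hypothesis ub : forall p, `|u p| <= b.
Hypothesis uC : forall x y, u (x, y) = u (y, x).
Hypothesis h1_var : Ex mu (fun z => h1 mu u z ^+ 2) = 4^-1.
Hypothesis m0 : 0 <= m.
Hypothesis u4 : Ex2 mu (fun p => u p ^+ 4) <= m ^+ 2.
Hypothesis b0 : 0 < b.
Variable r : R.
Hypothesis r01 : 0 <= r < 1.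
Hypothesis small : 8 * b ^+ 2 / (n%:R * (1 - r)) <= 1.

Let U : n.+1.-tuple T -> R := Uf mu u.
Let bU : bmf U := bmf_Uf mu n meas_u ub.
Let r1 : -1 < r < 1.
Proof. by case/andP: r01 => r0 ->; rewrite (lt_le_trans _ r0) ?ltrN10. Qed.
Let s := sg r.
Let s0 : 0 < s := sg_gt0 r1.
Let s2 : s ^+ 2 = 1 - r ^+ 2 := sqr_sgE r1.
Let n0 : 0 < n%:R :> R. Proof. by rewrite ltr0n ltnW. Qed.
Let mp : 0 < m. Proof. by have := m_ge n1 Qout meas_u ub uC h1_var m0 u4; lra. Qed.
Let f := mix Q U r.
Let mf : measurable_fun [set: R] f := measurable_mixr Q bU r.
Let f0 x : 0 < f x := mix_gt0 Q (proj1 bU) x r1.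
Let n10 : 0 < n%:R - 1 :> R. Proof. by rewrite subr_gt0 (n_gt1 R n1). Qed.

Lemma le_sqr_wnorm (t : R -> R) (a : R) (C : \bar R) : measurable_fun [set: R] t ->
  (C <= (a ^+ 2)%:E)%E -> (\int[lebesgue_measure]_x (t x ^+ 2 / f x)%:E <= C)%E -> wnorm_le f t a.
Proof. by move=> mt Ca tC; split => //; exact: le_trans tC Ca. Qed.

Let r0 : 0 <= r. Proof. by case/andP: r01. Qed.
Let rlt1 : r < 1. Proof. by case/andP: r01. Qed.
Let or0 : 0 < 1 - r. Proof. by rewrite subr_gt0. Qed.

Lemma wnorm_Udeg : wnorm_le f (fun x => Ex Q (fun t => Udeg mu u t * A1 mu u r x t))
  (2 * m / Num.sqrt (n%:R - 1) / (1 - r)).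
Proof.
have bUd := bmf_Udeg mu n meas_u ub.
have E x : Ex Q (fun t => Udeg mu u t * A1 mu u r x t) =
    Ex Q (fun t => Udeg mu u t * (- ((x - r * U t) / s / s) * gk r (U t) x)).
  by congr Ex; apply/funext => t; rewrite gkE.
apply: (@le_sqr_wnorm _ _ (s ^- 2 * Ex Q (fun t => Udeg mu u t ^+ 2))%:E).
- apply: (@measurable_Ex _ _ _ _ R Q (fun p : _ * R => Udeg mu u p.1 * A1 mu u r p.2 p.1)).
  apply: measurable_funM; first exact: (measurableT_comp (proj1 bUd) measurable_fst).
  exact: measurable_npdf1 bU r1.
- rewrite lee_fin [leRHS]exprMn mulrC; apply: ler_pM.
  + by apply: Ex_ge0 => t; exact: sqr_ge0.
  + by rewrite invr_ge0 sqr_ge0.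
  + exact: (Ex_sqr_Udeg n1 Qout meas_u ub uC h1_var m0 u4).
  + by rewrite exprVn lef_pV2 ?posrE ?exprn_gt0// s2 sqr_onem_le.
under eq_integral do rewrite E.
apply: (@mixture_norm_le _ _ R Q U bU r r1 _ (fun p => - ((p.2 - r * U p.1) / s / s))) => //.
- apply: measurable_funN; apply: measurable_funM; last exact: measurable_cst.
  exact: measurable_z.
- by move=> x; apply: bmfN; apply: bmfM; [exact: bmf_zU|exact: bmf_cst].
- move=> t; rewrite -(integral_npdf1_sqr (r * U t) s0); apply: le_of_eq.
  apply: eq_integral => x _; congr EFin; rewrite gkE// /npdf1.
  by apply: sqr_mulE; exact: normal_pdf_gt0.
Qed.

Lemma wnorm_TT : wnorm_le f (fun x => r * Ex Q (fun t => (TT mu u t - 1) * A2 mu u r x t))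
  (48 * m / Num.sqrt n%:R / Num.sqrt 2 / (1 - r)).
Proof.
have sn := sqrtn_gt0 R n1; have st : 0 < Num.sqrt 2 :> R by rewrite sqrtr_gt0.
have bT : bmf (fun t : n.+1.-tuple T => TT mu u t - 1).
  by apply: bmfB; [exact: bmf_TT ub|exact: bmf_cst].
have E x : Ex Q (fun t => (TT mu u t - 1) * A2 mu u r x t) =
    Ex Q (fun t => (TT mu u t - 1) * ((((x - r * U t) / s) ^+ 2 - 1) / s ^+ 2 * gk r (U t) x)).
  by congr Ex; apply/funext => t; rewrite gkE.
apply: (@wnorm_leW _ _ _ (r * (Num.sqrt 2 * (48 * m / Num.sqrt n%:R) / s ^+ 2))).
- by rewrite !mulr_ge0 ?invr_ge0 ?sqr_ge0 ?sqrtr_ge0.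
- rewrite [leLHS](_ : _ = 48 * m / Num.sqrt n%:R / Num.sqrt 2 * (Num.sqrt 2 ^+ 2 * (r / s ^+ 2))); last first.
    by field; rewrite (gt_eqF s0) (gt_eqF sn) ?(gt_eqF st).
  rewrite sqr_sqrtr// ler_wpM2l//; first by rewrite !mulr_ge0 ?invr_ge0// ltW.
  have := div_onem_sqr_le r0 rlt1; rewrite -s2 => h.
  by rewrite -(ler_pM2l (ltr0n R 2)) in h; rewrite (le_trans h)// mulrA divff// mul1r.
apply: wnorm_leZ => //.
apply: (@le_sqr_wnorm _ _ (2 * s ^- 4 * Ex Q (fun t => (TT mu u t - 1) ^+ 2))%:E).
- apply: (@measurable_Ex _ _ _ _ R Q (fun p : _ * R => (TT mu u p.1 - 1) * A2 mu u r p.2 p.1)).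
  apply: measurable_funM; first exact: (measurableT_comp (proj1 bT) measurable_fst).
  exact: measurable_npdf2 bU r1.
- rewrite lee_fin [leRHS](_ : _ = 2 * s ^- 4 * (48 * m / Num.sqrt n%:R) ^+ 2); last first.
    rewrite -[X in X * s ^- 4](@sqr_sqrtr R 2)//.
    by field; rewrite (gt_eqF s0) (gt_eqF sn) ?(gt_eqF st).
  rewrite ler_wpM2l//; first by rewrite mulr_ge0// invr_ge0 exprn_ge0// ltW.
  exact: (Ex_sqr_TT n1 Qout meas_u ub uC h1_var u4).
under eq_integral do rewrite E.
apply: (@mixture_norm_le _ _ R Q U bU r r1 _ (fun p => (((p.2 - r * U p.1) / s) ^+ 2 - 1) / s ^+ 2)) => //.
- apply: measurable_funM; last exact: measurable_cst.
  by apply: measurable_funB; [apply: measurable_funX; exact: measurable_z|exact: measurable_cst].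
- move=> x; apply: bmfM; last exact: bmf_cst.
  by apply: bmfB; [apply: bmfX; exact: bmf_zU|exact: bmf_cst].
- move=> t; rewrite -(integral_npdf2_sqr (r * U t) s0); apply: le_of_eq.
  apply: eq_integral => x _; congr EFin; rewrite gkE// /npdf2.
  by apply: sqr_mulE; exact: normal_pdf_gt0.
Qed.

Lemma Ex_sqr_dh i : Ex Q (fun t => dh mu u i t ^+ 2) = 2^-1.
Proof.
set w : 'I_n.+1 := lift ord_max i; have bh := bmf_h1 mu meas_u ub.
have bw := bmf_tnth w (bmfX 2 bh); have bn := bmf_tnth (@ord_max n) (bmfX 2 bh).
have bwn := bmfM (bmf_tnth (@ord_max n) bh) (bmf_tnth w bh).
have -> : (fun t => dh mu u i t ^+ 2) = (fun t : n.+1.-tuple T => h1 mu u (tnth t w) ^+ 2 +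
    h1 mu u (tnth t ord_max) ^+ 2 - 2 * (h1 mu u (tnth t ord_max) * h1 mu u (tnth t w))).
  by apply/funext => t; rewrite /dh -/w; ring.
rewrite ExB; [|by apply: bmf_int; exact: bmfD|by apply: bmf_int; apply: bmfM => //; exact: bmf_cst].
rewrite ExD; try exact: bmf_int.
rewrite ExZ; last exact: bmf_int.
rewrite (Ex_tnth Qout n1 w (bmfX 2 bh)) (Ex_tnth Qout n1 ord_max (bmfX 2 bh)) h1_var.
rewrite (out1 Qout n1 bh (bmf_tnth w bh)); last by move=> t t' E; rewrite E// eq_sym neq_lift.
by rewrite (Ex_h1 mu meas_u ub) mul0r; field.
Qed.

(** The trapezoidal error is of third order in an increment of size b / sqrt n, hence the power
    n^(-3/2). Summing n such terms and dividing by sqrt n leaves 1 / n in [dmix_norm_le]. *)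
Lemma wnorm_rem i : wnorm_le f (fun x => Ex Q (fun t => dh mu u i t * rem mu u r x i t))
  (44 / 5 * b ^+ 3 / (n%:R * Num.sqrt n%:R) / (1 - r) ^+ 2).
Proof.
have bdh := bmf_dh mu meas_u ub i.
(* The squared increment over the variance is at most this quantity since |dl| <= 4 b / sqrt n; the
   hypothesis [small] places it in [0, 1], the range of [trapez_norm_le]. *)
have q1 : r ^+ 2 * (16 * b ^+ 2 / n%:R) / s ^+ 2 <= 1.
  apply: le_trans small.
  rewrite [leLHS](_ : _ = 16 * b ^+ 2 / n%:R * (r ^+ 2 / s ^+ 2)); last by ring.
  rewrite [leRHS](_ : _ = 16 * b ^+ 2 / n%:R * (2^-1 / (1 - r))); last first.
    by field; rewrite !gt_eqF//; lra.
  by rewrite ler_wpM2l ?s2 ?sqr_div_onem_sqr_le// !mulr_ge0 ?invr_ge0 ?sqr_ge0// ltW.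
pose g (p : n.+1.-tuple T * R) := gk r (U p.1) p.2.
have g0 p : 0 < g p by exact: gk_gt0.
have mg : measurable_fun [set: n.+1.-tuple T * R] g := measurable_gk2 bU r.
have mrem : measurable_fun [set: n.+1.-tuple T * R] (fun p => rem mu u r p.2 i p.1).
  have bUs : bmf (fun t => U (sw i t)) := bmf_sw i bU.
  under eq_fun do rewrite remE.
  apply: measurable_funD.
    by apply: measurable_funB; [exact: measurable_npdf1 bU r1|exact: measurable_npdf1 bUs r1].
  apply: measurable_funM; last first.
    by apply: measurable_funD; [exact: measurable_npdf2 bU r1|exact: measurable_npdf2 bUs r1].
  apply: measurable_funM; last exact: measurable_cst.
  apply: measurable_funM; first exact: measurable_cst.
  exact: (measurableT_comp (proj1 (bmf_dl mu meas_u ub i)) measurable_fst).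
have E x : Ex Q (fun t => dh mu u i t * rem mu u r x i t) =
    Ex Q (fun t => dh mu u i t * (rem mu u r x i t / g (t, x) * gk r (U t) x)).
  by congr Ex; apply/funext => t; rewrite divfK// gt_eqF// g0.
pose q : R := r ^+ 2 * (16 * b ^+ 2 / n%:R) / s ^+ 2.
have q0 : 0 <= q by rewrite /q !mulr_ge0 ?invr_ge0 ?sqr_ge0// ltW.
apply: (@le_sqr_wnorm _ _ (s ^- 2 * (3 / 5 * q ^+ 3) * Ex Q (fun t => dh mu u i t ^+ 2))%:E).
- apply: (@measurable_Ex _ _ _ _ R Q (fun p : _ * R => dh mu u i p.1 * rem mu u r p.2 i p.1)).
  by apply: measurable_funM mrem; exact: (measurableT_comp (proj1 bdh) measurable_fst).
- rewrite Ex_sqr_dh lee_fin.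
  (* 6144/5 = 3/5 * 16^3 / 2, the last factor being E[dh^2] = 1/2. *)
  rewrite [leLHS](_ : _ = 6144 / 5 * (b ^+ 3 / (n%:R * Num.sqrt n%:R)) ^+ 2 * (r ^+ 3 / s ^+ 4) ^+ 2); last first.
    rewrite [(b ^+ 3 / _) ^+ 2]exprMn exprVn [(_ * Num.sqrt _) ^+ 2]exprMn (sqr_sqrtr (ltW n0)) /q.
    have aux (v k : R) : 0 < v -> 0 < k ->
        v ^- 2 * (3 / 5 * (r ^+ 2 * (16 * b ^+ 2 / k) / v ^+ 2) ^+ 3) / 2 =
        6144 / 5 * (b ^+ 3 ^+ 2 / (k ^+ 2 * k)) * (r ^+ 3 / v ^+ 4) ^+ 2.
      by move=> v0 k0; field; rewrite !gt_eqF.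
    exact: aux.
  have a0 : r ^+ 3 / s ^+ 4 <= 4^-1 / (1 - r) ^+ 2.
    rewrite (_ : s ^+ 4 = (1 - r ^+ 2) ^+ 2); last by rewrite -s2 -exprM.
    exact: cube_div_onem_sqr_le.
  rewrite [44 / 5 * b ^+ 3 / _](_ : _ = 44 / 5 * (b ^+ 3 / (n%:R * Num.sqrt n%:R))); last first.
    by rewrite -[LHS]mulrA.
  by apply: remainder_constant_le => //; rewrite divr_ge0 ?exprn_ge0 ?(ltW s0).
under eq_integral do rewrite E.
apply: (@mixture_norm_le _ _ R Q U bU r r1 _ (fun p => rem mu u r p.2 i p.1 / g p)) => //.
- by apply: measurable_funM mrem _; exact: measurable_funV.
- by move=> x; apply: bmfM; [exact: bmf_rem meas_u ub _ x r1 i|exact: bmf_gkV].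
- move=> t; pose e := r * dl mu u i t.
  have qe : (e / s) ^+ 2 <= q.
    rewrite /q /e !exprMn exprVn ler_wpM2r ?invr_ge0 ?sqr_ge0// ler_wpM2l ?sqr_ge0//.
    rewrite (_ : 16 * b ^+ 2 / n%:R = (4 * b / Num.sqrt n%:R) ^+ 2); last first.
      by rewrite !exprMn exprVn sqr_sqrtr ?(ltW n0)//; ring.
    have dle := dl_le mu n1 ub uC i t.
    rewrite -(real_normK (num_real (dl mu u i t))) lerXn2r// nnegrE.
    exact: le_trans (normr_ge0 _) dle.
  apply: (@le_trans _ _ (s ^- 2 * (3 / 5 * ((e / s) ^+ 2) ^+ 3))%:E).
    apply: (@le_trans _ _ (s ^- 2 * (expR ((e / s) ^+ 2) * (1 - (e / s) ^+ 2 / 2 + ((e / s) ^+ 2) ^+ 3 / 4)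
      - 1 - (e / s) ^+ 2 / 2))%:E).
      rewrite -(integral_trapez_sqr (r * U t) e s0); apply: le_of_eq.
      apply: eq_integral => x _; congr EFin; rewrite /g/= gkE// /rem -/U -/s -/e.
      by rewrite sqr_mulE ?divfK ?normal_pdf_gt0// gt_eqF// normal_pdf_gt0.
    rewrite lee_fin ler_wpM2l ?invr_ge0 ?sqr_ge0// trapez_norm_le// sqr_ge0/=.
    exact: le_trans qe q1.
  rewrite lee_fin ler_wpM2l ?invr_ge0 ?sqr_ge0// ler_wpM2l// lerXn2r// nnegrE ?sqr_ge0//.
Qed.

Lemma dmix_norm_le : (\int[lebesgue_measure]_x (dmix Q U r x ^+ 2 / mix Q U r x)%:E <=
  (((2 * m / Num.sqrt (n%:R - 1) + 48 * m / Num.sqrt n%:R / Num.sqrt 2) / (1 - r)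
   + 44 / 5 * b ^+ 3 / n%:R / (1 - r) ^+ 2) ^+ 2)%:E)%E.
Proof.
have sn := sqrtn_gt0 R n1.
have sn1 : 0 < Num.sqrt (n%:R - 1) :> R by rewrite sqrtr_gt0.
pose c : R := 44 / 5 * b ^+ 3 / (n%:R * Num.sqrt n%:R) / (1 - r) ^+ 2.
have c0 : 0 < c by rewrite /c !divr_gt0 ?mulr_gt0 ?exprn_gt0.
have W2 : wnorm_le f (fun x => - (Num.sqrt n%:R)^-1 *
    \sum_(i < n) Ex Q (fun t => dh mu u i t * rem mu u r x i t)) (44 / 5 * b ^+ 3 / n%:R / (1 - r) ^+ 2).
  have W (k : nat) (t : 'I_k -> R -> R) : (1 < k)%N -> (forall i, wnorm_le f (t i) c) ->
      wnorm_le f (fun x => \sum_(i < k) t i x) (k%:R * c).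
    by case: k t => // k t _ H; exact: wnorm_le_sum.
  have [m1 W1] := W n _ n1 (fun i => wnorm_rem i).
  have := wnorm_leZ mf f0 (Num.sqrt n%:R)^-1 (conj m1 W1).
  rewrite (_ : _ * (n%:R * c) = 44 / 5 * b ^+ 3 / n%:R / (1 - r) ^+ 2); last first.
    have aux (v k p : R) : 0 < v -> 0 < p -> v ^+ 2 = k ->
        v^-1 * (k * (44 / 5 * b ^+ 3 / (k * v) / p ^+ 2)) = 44 / 5 * b ^+ 3 / k / p ^+ 2.
      by move=> v0 p0 <-; field; rewrite !gt_eqF.
    by apply: aux => //; exact/sqr_sqrtr/ltW.
  move=> [m2 W2]; split; first by under eq_fun do rewrite mulNr; exact: measurable_funN.
  by under eq_integral do rewrite mulNr sqrrN.
have W1 : wnorm_le f (fun x => - Ex Q (fun t => Udeg mu u t * A1 mu u r x t))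
    (2 * m / Num.sqrt (n%:R - 1) / (1 - r)).
  have [m1 W1] := wnorm_Udeg; split; first exact: measurable_funN.
  by under eq_integral do rewrite sqrrN.
have a1 : 0 < 2 * m / Num.sqrt (n%:R - 1) / (1 - r) by rewrite !divr_gt0 ?mulr_gt0.
have a2 : 0 < 48 * m / Num.sqrt n%:R / Num.sqrt 2 / (1 - r) by rewrite !divr_gt0 ?mulr_gt0 ?sqrtr_gt0.
have a3 : 0 < 44 / 5 * b ^+ 3 / n%:R / (1 - r) ^+ 2 by rewrite !divr_gt0 ?mulr_gt0 ?exprn_gt0.
have a12 := addr_gt0 a1 a2.
have [_] := wnorm_leD mf f0 a12 a3 (wnorm_leD mf f0 a1 a2 W1 wnorm_TT) W2.
rewrite -mulrDl; apply: le_trans; apply: le_of_eq.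
apply: eq_integral => x _; congr EFin; congr (_ ^+ 2 / _); rewrite /dmix.
by rewrite (stein_identity n1 Qswap Qout meas_u ub uC x r1); ring.
Qed.

End SteinBound.

(** * Bound for the U-statistic along the path *)

Section Norms.
Context d (W : measurableType d) (R : realType) (P : probability W R).

Lemma pnorm_ge0 p (Y : W -> R) : 0 <= pnorm P p Y.
Proof. by apply: fine_ge0; exact: Lnorm_ge0. Qed.

Lemma pnormX k (Y : W -> R) : (0 < k)%N ->
    P.-integrable [set: W] (EFin \o (fun w => `|Y w| ^+ k)) ->
  pnorm P k%:R Y ^+ k = Ex P (fun w => `|Y w| ^+ k).
Proof.
move=> k0 iY; have kn0 : k%:R != 0 :> R by rewrite pnatr_eq0 -lt0n.
have := @poweR_Lnorm _ _ _ P (EFin \o Y) k%:R kn0.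
under eq_integral do rewrite /= powR_mulrn//.
rewrite -(EFin_Ex iY) /pnorm.
have := Lnorm_ge0 P k%:R%:E (EFin \o Y).
case: ('N[P]_ _ [_])%E => [x x0| |//].
  by rewrite poweR_EFin powR_mulrn// => -[].
by rewrite poweRyr.
Qed.

Lemma ae_Ex (f g : W -> R) : measurable_fun [set: W] f -> measurable_fun [set: W] g ->
  {ae P, forall w, f w = g w} -> Ex P f = Ex P g.
Proof.
move=> mf mg fg; rewrite /Ex /Rintegral; congr fine; apply: ae_eq_integral => //.
- exact/measurable_EFinP.
- exact/measurable_EFinP.
- by apply: filterS fg => w /= -> _.
Qed.

End Norms.

(** * The law of a sample of size n + 1 *)

Section SampleTuple.
Context d d' (W : measurableType d) (T : measurableType d') (R : realType).
Context (P : probability W R) (X : nat -> {RV P >-> T}).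
Hypothesis iidX : iid X.
Notation mu := (distribution P (X 0%N)).
Variable n : nat.

Definition smp : W -> n.+1.-tuple T := sample X (fun i : 'I_n.+1 => val i).
Notation Q := (distribution P (sample X (fun i : 'I_n.+1 => val i))).

Lemma Ex_smp (F : n.+1.-tuple T -> R) : bmf F -> Ex Q F = Ex P (fun w => F (smp w)).
Proof. by move=> bF; rewrite (@Ex_pushforward _ _ _ _ _ P (sample X _)). Qed.

Lemma tnth_smp w i : tnth (smp w) i = X i w.
Proof. by rewrite tnth_mktuple. Qed.

Lemma measurable_swp i j : measurable_fun [set: n.+1.-tuple T] (swp i j).
Proof.
apply/measurable_fun_tnthP => k.
rewrite (_ : _ \o _ = fun t => tnth t (tperm i j k)); first exact: measurable_tnth.
by apply/funext => t /=; rewrite tnth_mktuple.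
Qed.

Lemma sample_swap_invariant : swap_invariant Q.
Proof.
move=> i j G bG; have bGs : bmf (fun t => G (swp i j t)) := bmf_comp bG (measurable_swp i j).
rewrite !Ex_smp//.
rewrite -(@Ex_sample _ _ _ _ _ _ _ iidX _ (fun k => val (tperm i j k)) (fun k => val k) G)//.
- congr Ex; apply/funext => w; congr G; apply: eq_from_tnth => k.
  by rewrite !tnth_mktuple.
- by move=> k l /val_inj /perm_inj.
Qed.

(** Rebuilds the full tuple from coordinate k and the remaining ones, so that the independence of
    X_k from the other variables applies to functions of the tuple. *)
Definition ins k (p : T * n.-tuple T) : n.+1.-tuple T :=
  [tuple if unlift k l is Some i then tnth p.2 i else p.1 | l < n.+1].

Lemma measurable_ins k : measurable_fun [set: T * n.-tuple T] (ins k).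
Proof.
apply/measurable_fun_tnthP => l.
rewrite (_ : _ \o _ = fun p : T * n.-tuple T => if unlift k l is Some i then tnth p.2 i else p.1).
  case: unlift => [i|]; last exact: measurable_fst.
  exact: (measurableT_comp (measurable_tnth i) measurable_snd).
by apply/funext => p /=; rewrite tnth_mktuple.
Qed.

Lemma sample_integrates_out : integrates_out mu Q.
Proof.
move=> k j f G kj bf bG Gk.
have bfG : bmf (fun t => f (tnth t k, tnth t j) * G t) by apply: bmfM bG; exact: bmf_tnth2.
have biG : bmf (fun t => integ mu f (tnth t j) * G t).
  by apply: bmfM bG; apply: bmf_tnth; exact: bmf_integ.
rewrite !Ex_smp//.
pose s (i : 'I_n) : nat := val (lift k i).
pose F p := f (tnth (ins k p) k, tnth (ins k p) j) * G (ins k p).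
have bF : bmf F by exact: (bmf_comp bfG (measurable_ins k)).
have insE w : ins k (X (val k) w, sample X s w) = smp w.
  apply: eq_from_tnth => l; rewrite !tnth_mktuple/=.
  case: unliftP => [i ->|->//].
  by rewrite tnth_mktuple.
have injs : injective s by move=> a c /val_inj /lift_inj.
have sk i : s i != val k by rewrite eq_sym; exact: neq_bump.
have := Ex_indep iidX injs sk bF; rewrite /F => E.
transitivity (Ex P (fun w => F (X (val k) w, sample X s w))).
  by congr Ex; apply/funext => w; rewrite /F insE.
rewrite E; congr Ex; apply/funext => w.
have insj y : tnth (ins k (y, sample X s w)) j = X (val j) w.
  rewrite tnth_mktuple; case: unliftP kj => [i -> _|-> /eqP//].
  by rewrite tnth_mktuple.
have insk y : tnth (ins k (y, sample X s w)) k = y by rewrite tnth_mktuple unlift_none.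
have GE y : G (ins k (y, sample X s w)) = G (smp w).
  rewrite -insE; apply: Gk => i ik; rewrite !tnth_mktuple.
  by case: unliftP ik => [//|->]; rewrite eqxx.
under eq_fun do rewrite insj insk GE mulrC.
rewrite ExZ; first by rewrite mulrC tnth_smp.
by apply: bmf_int; exact: bmf_pair1.
Qed.

End SampleTuple.

(** * Reduction to a kernel bounded everywhere *)

Section Clipping.
Context d d' (W : measurableType d) (T : measurableType d') (R : realType).
Context (P : probability W R) (X : nat -> {RV P >-> T}) (u : T * T -> R) (b : R).
Hypothesis iidX : iid X.
Hypothesis meas_u : measurable_fun [set: T * T] u.
Hypothesis sym_u : forall x y : T, u (x, y) = u (y, x).
Hypothesis bnd_u : bounded_fun u.
Hypothesis bound_b : {ae P, forall w, `|u (X 0%N w, X 1%N w)| <= b}.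
Hypothesis cov_u : (4%:E * covariance P (fun w => u (X 0%N w, X 1%N w))
                                  (fun w => u (X 0%N w, X 2%N w)) = 1)%E.
Notation mu := (distribution P (X 0%N)).

(** The Stein argument bounds the kernel pointwise by b, whereas this bound is given only almost
    surely at one pair of variables. Clipping preserves symmetry and changes the statistic only on a
    null event. *)
Definition clip (p : T * T) : R := Num.max (- b) (Num.min b (u p)).

Lemma measurable_clip : measurable_fun [set: T * T] clip.
Proof.
apply: measurable_maxr; first exact: measurable_cst.
by apply: measurable_minr => //; exact: measurable_cst.
Qed.

Lemma clipC x y : clip (x, y) = clip (y, x).
Proof. by rewrite /clip sym_u. Qed.

Lemma b_ge0 : 0 <= b.
Proof.
have PF : ProperFilter (almost_everywhere P).
  have h : (0 < P [set: W])%E by rewrite probability_setT lte01.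
  exact: (ae_properfilter_algebraOfSetsType h).
have [w] := @filter_ex _ _ PF _ bound_b.
exact: le_trans.
Qed.

Lemma clip_le p : `|clip p| <= b.
Proof.
have b0 := b_ge0; rewrite /clip ler_norml le_max lexx/= ge_max ge_min lexx/=.
by rewrite andbT; lra.
Qed.

Lemma clip_id p : `|u p| <= b -> clip p = u p.
Proof.
by rewrite ler_norml => /andP[h1 h2]; rewrite /clip (min_idPr h2) (max_idPr h1).
Qed.

Lemma bmf_u0 : bmf u.
Proof.
split => //; have [M [_ HM]] := bnd_u; exists (M + 1) => p.
by apply: HM => //; rewrite ltrDl.
Qed.

Lemma measurable_uX i j (f : T * T -> R) : measurable_fun [set: T * T] f ->
  measurable_fun [set: W] (fun w => f (X i w, X j w)).
Proof. by move=> mf; apply: (measurableT_comp mf); exact: measurable_fun_pair. Qed.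

Lemma bmf_uX i j (f : T * T -> R) : bmf f -> bmf (fun w => f (X i w, X j w)).
Proof.
by move=> [mf [M fM]]; split; [exact: measurable_uX|exists M => w; exact: fM].
Qed.

Lemma Ex_uX i j (f : T * T -> R) : i != j -> bmf f ->
  Ex P (fun w => f (X i w, X j w)) = Ex P (fun w => f (X 0%N w, X 1%N w)).
Proof.
move=> ij bf.
pose F (t : 2.-tuple T) := f (tnth t ord0, tnth t (lift ord0 ord0)).
have bF : bmf F by exact: bmf_tnth2.
pose s (k : 'I_2) := if k == ord0 then i else j.
have injs : injective s.
  move=> k l; rewrite /s; case: (unliftP ord0 k) => [k'|] ->; case: (unliftP ord0 l) => [l'|] ->//=.
  - by rewrite (ord1 k') (ord1 l').
  - by move/eqP; rewrite eq_sym (negbTE ij).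
  - by move/eqP; rewrite (negbTE ij).
have := Ex_sample iidX injs (@val_inj _ _ 'I_2) bF.
by rewrite /F; under eq_fun do rewrite !tnth_mktuple; under [in RHS]eq_fun do rewrite !tnth_mktuple.
Qed.

(** The expectation of |u - clip| depends only on the law of the pair, so its vanishing passes from
    the first two variables to any two. *)
Lemma clip_uX i j : i != j -> {ae P, forall w, u (X i w, X j w) = clip (X i w, X j w)}.
Proof.
move=> ij; pose F p := `|u p - clip p|.
have bcl : bmf clip by split; [exact: measurable_clip|exists b; exact: clip_le].
have bF : bmf F.
  have [mD [M DM]] := bmfB bmf_u0 bcl; split; first exact: measurableT_comp.
  by exists M => p; rewrite /F normr_id.
have E0 : Ex P (fun w => F (X i w, X j w)) = 0.
  rewrite Ex_uX// -[RHS](Ex_cst P); apply: ae_Ex.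
  - exact: measurable_uX (proj1 bF).
  - exact: measurable_cst.
  - by apply: filterS bound_b => w h; rewrite /F clip_id// subrr normr0.
have mFX := measurable_uX i j (proj1 bF).
have : (\int[P]_w `|(F (X i w, X j w))%:E| = 0)%E.
  rewrite -[RHS]/(0%:E) -E0 (EFin_Ex (bmf_int P (bmf_uX i j bF))).
  by apply: eq_integral => w _; rewrite /= normr_id.
move/(@ae_eq_integral_abs _ _ _ P setT measurableT _ _).1 => H.
have := H (proj2 (measurable_EFinP _ _) mFX).
apply: filterS => w /= /(_ I) [] /eqP; rewrite normr_eq0 subr_eq0 => /eqP ->.
by [].
Qed.

Lemma bmf_clip : bmf clip.
Proof. by split; [exact: measurable_clip|exists b; exact: clip_le]. Qed.

Lemma Ex_clipX i j (g : R -> R) : i != j -> bmf (g \o clip) -> bmf (g \o u) ->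
  Ex P (fun w => g (u (X i w, X j w))) = Ex2 mu (g \o clip).
Proof.
move=> ij bgc bgu.
transitivity (Ex P (fun w => (g \o clip) (X i w, X j w))).
  apply: ae_Ex; [exact: measurable_uX (proj1 bgu)|exact: measurable_uX (proj1 bgc)|].
  by apply: filterS (clip_uX ij) => w ->.
have n1 : (1 < 2)%N by [].
have o01 : (ord0 : 'I_3) != lift ord0 ord0 by [].
rewrite Ex_uX// -(Ex_tnth2 (@sample_integrates_out _ _ _ _ _ _ _ iidX 2) n1 o01 bgc).
rewrite (Ex_smp X (bmf_tnth2 _ _ bgc)); congr Ex; apply/funext => w.
by rewrite !tnth_smp.
Qed.

Lemma EFin_expectation (f : W -> R) : bmf f -> ('E_P[f] = (Ex P f)%:E)%E.
Proof. by move=> bf; rewrite unlock (EFin_Ex (bmf_int P bf)). Qed.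

Lemma mean_uX i j : i != j -> fine 'E_P[fun w => u (X i w, X j w)] = theta mu clip.
Proof.
move=> ij; rewrite (EFin_expectation (bmf_uX i j bmf_u0))/=.
by apply: (@Ex_clipX i j id) => //; [exact: bmf_clip|exact: bmf_u0].
Qed.

(** Given the shared variable, the two factors of the covariance are independent with conditional
    mean h1, so the covariance is the variance of h1. *)
Lemma h1_clip_var : Ex mu (fun z => h1 mu clip z ^+ 2) = 4^-1.
Proof.
have but := bmf_ut mu measurable_clip clip_le.
have bh1 := bmf_h1 mu measurable_clip clip_le.
have b1 := bmf_uX 0 1 bmf_u0; have b2 := bmf_uX 0 2 bmf_u0.
have E : (Ex P (fun w => ut mu clip (X 1%N w, X 0%N w) * ut mu clip (X 2%N w, X 0%N w))) =
    Ex mu (fun z => h1 mu clip z ^+ 2).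
  have Qo := @sample_integrates_out _ _ _ _ _ _ _ iidX 2.
  pose o0 : 'I_3 := ord0; pose o1 : 'I_3 := lift ord0 ord0; pose o2 : 'I_3 := ord_max.
  have bG := bmf_tnth2 o2 o0 but.
  have bh0 := bmf_tnth o0 bh1.
  transitivity (Ex (distribution P (sample X (fun i : 'I_3 => val i)))
      (fun t => ut mu clip (tnth t o1, tnth t o0) * ut mu clip (tnth t o2, tnth t o0))).
    rewrite (Ex_smp X (bmfM (bmf_tnth2 o1 o0 but) bG)); congr Ex; apply/funext => w.
    by rewrite !tnth_smp.
  rewrite (Qo o1 o0 _ _ _ but bG)//; last by move=> t t' tt'; rewrite !tt'.
  rewrite -/(h1 mu clip) (_ : (fun t => _) = (fun t : 3.-tuple T =>
    ut mu clip (tnth t o2, tnth t o0) * h1 mu clip (tnth t o0))); last first.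
    by apply/funext => t; rewrite mulrC.
  rewrite (Qo o2 o0 _ _ _ but bh0)//; last by move=> t t' tt'; rewrite !tt'.
  rewrite -(Ex_tnth Qo _ o0 (bmfX 2 bh1))//; congr Ex; apply/funext => t.
pose f w := (u (X 0%N w, X 1%N w) - theta mu clip) * (u (X 0%N w, X 2%N w) - theta mu clip).
have bf : bmf f by apply: bmfM; apply: bmfB => //; exact: bmf_cst.
have cE : (4%:E * 'E_P[f] = 1)%E.
  by have := cov_u; rewrite unlock !mean_uX.
move: cE; rewrite EFin_expectation// -EFinM => -[] cE.
have <- : Ex P f = 4^-1 by rewrite -[LHS](@mulKf _ 4)// cE mulr1.
rewrite -E; apply: ae_Ex.
- apply: measurable_funM; exact: (measurable_uX _ _ (proj1 but)).
- exact: (proj1 bf).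
- apply: filterS2 (clip_uX (isT : 0%N != 1%N)) (clip_uX (isT : 0%N != 2%N)) => w e1 e2.
  by rewrite /f/= e1 e2 /ut (clipC (X 1 w)) (clipC (X 2 w)).
Qed.

Lemma b_gt0 : 0 < b.
Proof.
rewrite lt_neqAle b_ge0 andbT; apply/eqP => b0.
have clip0 p : clip p = 0.
  by apply/eqP; rewrite -normr_eq0 eq_le normr_ge0 b0 clip_le.
have h0 z : h1 mu clip z = 0.
  rewrite /h1 /integ /ut/= (_ : (fun _ => _) = fun=> 0) ?Ex_cst//.
  apply/funext => y; rewrite clip0 sub0r /theta.
  have -> : clip = fun=> 0 by apply/funext => p; exact: clip0.
  by rewrite (Ex2_fst mu (fun=> 0)) Ex_cst oppr0.
have := h1_clip_var; under eq_fun do rewrite h0 expr0n; rewrite Ex_cst => /eqP.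
by rewrite eq_sym invr_eq0 pnatr_eq0.
Qed.

Lemma norm_u4 : Ex2 mu (fun p => clip p ^+ 4) =
  (pnorm P 4 (fun w => u (X 0%N w, X 1%N w)) ^+ 2) ^+ 2.
Proof.
have n4 (x : R) : `|x| ^+ 4 = x ^+ 4.
  by rewrite -[4%N]/(2 * 2)%N !exprM real_normK// num_real.
have := @pnormX _ W R P 4 (fun w => u (X 0%N w, X 1%N w)) isT.
under eq_fun do rewrite n4.
move=> h; rewrite -exprM h; last exact: (bmf_int P (bmf_uX 0 1 (bmfX 4 bmf_u0))).
by rewrite (@Ex_clipX 0 1 (fun x => x ^+ 4))//; apply: bmfX; [exact: bmf_clip|exact: bmf_u0].
Qed.

Section Ustatistic.
Variable n : nat.
Hypothesis n1 : (1 < n)%N.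
Let U := Ustat X u n.
Let V w := Uf mu clip (smp X n w).
Notation Q := (distribution P (sample X (fun i : 'I_n.+1 => val i))).

Lemma Ustat_clip : {ae P, forall w, U w = V w}.
Proof.
have A : {ae P, forall w, forall p : 'I_n * 'I_n, p.1 != p.2 ->
    u (X p.1 w, X p.2 w) = clip (X p.1 w, X p.2 w)}.
  apply: filter_forall => -[i j] /=; have [->|ij] := eqVneq i j.
    by apply: nearW.
  by apply: filterS (@clip_uX i j ij) => w ->.
apply: filterS A => w A; rewrite /U /V /Ustat /Uf /cU /offsum; congr (_ * _).
apply: eq_bigr => i _; apply: eq_bigr => j ij.
rewrite (A (i, j) ij) mean_uX// /ut.
have E (k : 'I_n) : tnth (smp X n w) (lift ord_max k) = X k w.
  by rewrite tnth_smp; congr (X _ w); exact: lift_max.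
by rewrite !E.
Qed.

Lemma bmf_Ustat : bmf U.
Proof.
apply: bmfM; first exact: bmf_cst.
apply: bmf_sum => i; apply: bmf_sum => j; apply: bmfB; last exact: bmf_cst.
exact: bmf_uX bmf_u0.
Qed.

Lemma Ex_Ustat (g : R -> R) : bmf (fun w => g (U w)) -> bmf (fun t => g (@Uf _ _ _ mu n clip t)) ->
  Ex P (fun w => g (U w)) = Ex Q (fun t => g (Uf mu clip t)).
Proof.
move=> bU bV; rewrite Ex_smp//; apply: ae_Ex.
- exact: (proj1 bU).
- exact: (measurableT_comp (proj1 bV) (measurable_sample X _)).
- by apply: filterS Ustat_clip => w ->.
Qed.

Let m := pnorm P 4 (fun w => u (X 0%N w, X 1%N w)) ^+ 2.

Lemma stein_bound r : 0 <= r < 1 -> 8 * b ^+ 2 / (n%:R * (1 - r)) <= 1 ->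
  (\int[lebesgue_measure]_x (dmix P U r x ^+ 2 / mix P U r x)%:E <=
  (((2 * m / Num.sqrt (n%:R - 1) + 48 * m / Num.sqrt n%:R / Num.sqrt 2) / (1 - r)
   + 44 / 5 * b ^+ 3 / n%:R / (1 - r) ^+ 2) ^+ 2)%:E)%E.
Proof.
move=> r01 small; have r1 : -1 < r < 1 by case/andP: r01 => r0 ->; rewrite (lt_le_trans _ r0) ?ltrN10.
have u4 : Ex2 mu (fun p => clip p ^+ 4) <= m ^+ 2 by rewrite norm_u4.
have := dmix_norm_le n1 (@sample_swap_invariant _ _ _ _ _ _ _ iidX n)
  (@sample_integrates_out _ _ _ _ _ _ _ iidX n) measurable_clip clip_le clipC h1_clip_var
  (sqr_ge0 _) u4 b_gt0 r01 small.
apply: le_trans; apply: le_of_eq; apply: eq_integral => x _.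
have [mU [k Uk]] := bmf_Ustat.
have bV := bmf_Uf mu n measurable_clip clip_le; have [mV [l Vl]] := bV.
have -> : dmix P U r x = dmix Q (Uf mu clip) r x.
  exact: (@Ex_Ustat (fun y => dgk r y x) (@bmf_dgk _ _ R U k mU Uk r x r1)
    (@bmf_dgk _ _ R _ l mV Vl r x r1)).
have -> // : mix P U r x = mix Q (Uf mu clip) r x.
exact: (@Ex_Ustat (fun y => gk r y x) (@bmf_gk _ _ R U mU r x r1) (@bmf_gk _ _ R _ mV r x r1)).
Qed.

Lemma norm_u_ge : 2^-1 <= m.
Proof.
have u4 : Ex2 mu (fun p => clip p ^+ 4) <= m ^+ 2 by rewrite norm_u4.
exact: (m_ge n1 (@sample_integrates_out _ _ _ _ _ _ _ iidX n) measurable_clip clip_le clipC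
  h1_clip_var (sqr_ge0 _) u4).
Qed.

End Ustatistic.
End Clipping.

(** * Smooth cutoffs and the score identity *)

Section FlatFunctions.
Context (R : realType).
Implicit Types (x y : R) (p : {poly R}).

(* p(1/x) e^{-1/x} continued by 0: these functions are closed under differentiation. *)
Definition flat p x : R := if 0 < x then p.[x^-1] * expR (- x^-1) else 0.

(** With y = 1 / x, the bound y^(i+2) <= (i+2)! exp y turns every monomial of p into O(x^2).
    Quadratic decay makes the difference quotient at 0 tend to 0. *)
Lemma flat_le p : exists2 C : R, 0 <= C & forall x, `|flat p x| <= C * x ^+ 2.
Proof.
exists (\sum_(i < size p) `|p`_i| * (i.+2)`!%:R); first by apply: sumr_ge0 => i _; rewrite mulr_ge0.
move=> x; rewrite /flat; case: ifPn => x0; last first.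
  by rewrite normr0 mulr_ge0 ?sqr_ge0//; apply: sumr_ge0 => i _; rewrite mulr_ge0.
have y0 : 0 < x^-1 by rewrite invr_gt0.
rewrite horner_coef normrM [`|expR _|]ger0_norm ?expR_ge0// mulr_suml.
apply: (@le_trans _ _ (\sum_(i < size p) `|p`_i * x^-1 ^+ i| * expR (- x^-1))).
  by rewrite -mulr_suml ler_wpM2r ?expR_ge0// ler_norm_sum.
apply: ler_sum => i _; rewrite normrM -!mulrA ler_wpM2l//.
rewrite ger0_norm ?(exprn_ge0 _ (ltW y0))// expRN ler_pdivrMr ?expR_gt0//.
have := expR_ge1Dxn i.+1 (ltW y0).
have f0 : 0 < (i.+2)`!%:R :> R by rewrite ltr0n fact_gt0.
set F := (i.+2)`!%:R in f0 *.
move=> h; have {}h : x^-1 ^+ i.+2 <= F * expR x^-1.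
  rewrite mulrC -ler_pdivrMr//; lra.
rewrite (_ : x^-1 ^+ i = x^-1 ^+ i.+2 * x ^+ 2); last first.
  by rewrite -addn2 exprD -mulrA -exprMn mulVf ?expr1n ?mulr1// gt_eqF.
by rewrite [leRHS]mulrAC ler_wpM2r ?sqr_ge0.
Qed.

Lemma is_derive_flat p x : is_derive x 1 (flat p) (flat ('X^2 * (p - p^`())) x).
Proof.
have [x0|x0|->] := ltgtP x 0.
- rewrite [X in is_derive _ _ _ X]/flat ltNge (ltW x0)/=.
  have d0 : is_derive x 1 (cst 0 : R -> R) 0 by exact: is_derive_cst.
  apply: (near_eq_is_derive _ d0).
  by near=> y; rewrite /flat ltNge (_ : y <= 0)//; near: y; exact: lt_le_nbhsl.
- apply: (@near_eq_is_derive _ _ _ (fun y => p.[y^-1] * expR (- y^-1))).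
    near=> y; rewrite /flat (_ : 0 < y)//; near: y; exact: lt_nbhsr.
  have xn : x != 0 by rewrite gt_eqF.
  have dV : is_derive x 1 (fun y : R => y^-1) (- x ^- 2).
    have := @is_deriveV _ (fun y : R => y) x 1 1 xn (is_derive_id x 1).
    by move=> h; apply: is_derive_eq; rewrite /GRing.scale/= mulr1.
  have dp : is_derive x 1 (fun y => p.[y^-1]) (p^`().[x^-1] * - x ^- 2).
    exact: (@is_derive1_comp _ (horner p) (fun y => y^-1) x _ _ (is_derive_poly p x^-1) dV).
  have de : is_derive x 1 (fun y => expR (- y^-1)) (expR (- x^-1) * - - x ^- 2).
    have dN : is_derive x 1 (fun y : R => - y^-1) (- - x ^- 2) by apply: is_derive_eq.
    exact: (@is_derive1_comp _ expR (fun y => - y^-1) x _ _ (is_derive_expR _) dN).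
  apply: is_derive_eq; rewrite /flat x0 !hornerE /GRing.scale/=.
  by field.
- have F0 q : flat q 0 = 0 by rewrite /flat ltxx.
  rewrite F0; have [C C0 HC] := flat_le p.
  have C1 : 0 < C + 1 by lra.
  have H : h^-1 *: ((flat p \o shift 0) (h *: 1) - flat p 0) @[h --> 0^'] --> (0 : R).
    apply/cvgr0Pnorm_le => e e0; have eC0 := divr_gt0 e0 C1; near=> h.
    have hn : h != 0 by near: h; exact: nbhs_dnbhs_neq.
    rewrite /= F0 subr0 addr0 /GRing.scale/= mulr1 normrM normfV.
    rewrite ler_pdivrMl ?normr_gt0// (le_trans (HC h))//.
    rewrite -(real_normK (num_real h)) expr2 mulrA mulrC ler_wpM2l//.
    have : `|h| <= e / (C + 1).
      by near: h; exact: (@dnbhs0_le _ R _ eC0).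
    by rewrite ler_pdivlMr//; have := normr_ge0 h; nra.
  by apply: DeriveDef; [apply/cvg_ex; exists 0|exact/cvg_lim].
Unshelve. all: by end_near. Qed.

Lemma flat1_gt0 x : 0 < x -> 0 < flat 1 x.
Proof. by move=> x0; rewrite /flat x0 hornerC mul1r expR_gt0. Qed.

Lemma flat_le0 p x : x <= 0 -> flat p x = 0.
Proof. by move=> x0; rewrite /flat ltNge x0. Qed.

(** A class closed under differentiation: smoothness of all orders follows by structural induction,
    without formulas for higher derivatives. *)
Inductive elementary : (R -> R) -> Prop :=
| El_cst c : elementary (fun=> c)
| El_id : elementary (fun x => x)
| El_exp : elementary expR
| El_flat p : elementary (flat p)
| El_add f g : elementary f -> elementary g -> elementary (fun x => f x + g x)
| El_mul f g : elementary f -> elementary g -> elementary (fun x => f x * g x)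
| El_inv f : elementary f -> (forall x, f x != 0) -> elementary (fun x => (f x)^-1)
| El_comp f g : elementary f -> elementary g -> elementary (fun x => f (g x)).

Lemma elementary_derive f : elementary f ->
  exists2 g, elementary g & forall x, is_derive x 1 f (g x).
Proof.
elim=> {f} [c|||p|f g ef [f' ef' df] eg [g' eg' dg]|f g ef [f' ef' df] eg [g' eg' dg]
  |f ef [f' ef' df] f0|f g ef [f' ef' df] eg [g' eg' dg]].
- by exists (fun=> 0); [exact: El_cst|move=> x; exact: is_derive_cst].
- by exists (fun=> 1); [exact: El_cst|move=> x; exact: is_derive_id].
- by exists expR; [exact: El_exp|move=> x; exact: is_derive_expR].
- by exists (flat ('X^2 * (p - p^`()))); [exact: El_flat|exact: is_derive_flat].
- exists (fun x => f' x + g' x); first exact: El_add.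
  by move=> x; apply: is_deriveD.
- exists (fun x => f x * g' x + g x * f' x); first by apply: El_add; exact: El_mul.
  by move=> x; apply: is_deriveM.
- exists (fun x => (-1 * ((f x)^-1 * (f x)^-1)) * f' x).
    apply: El_mul => //; apply: El_mul; first exact: El_cst.
    by apply: El_mul; exact: El_inv.
  move=> x; have := @is_deriveV _ f x (f' x) 1 (f0 x) (df x) => h.
  by apply: is_derive_eq; rewrite /GRing.scale/= mulN1r expr2 invfM.
- exists (fun x => f' (g x) * g' x); first by apply: El_mul => //; exact: El_comp.
  by move=> x; exact: is_derive1_comp.
Qed.

Lemma elementary_smooth k f : elementary f -> forall x, derivable (derive1n k f) x 1.
Proof.
elim: k f => [|k IH] f ef x; have [g eg dg] := elementary_derive ef.
  by rewrite derive1n0; exact: ex_derive.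
rewrite derive1Sn (_ : f^`() = g)%classic; first exact: IH.
by apply/funext => y; rewrite derive1E; exact: derive_val.
Qed.

Lemma elementary_Cc f (M : R) : elementary f -> (forall x, M < `|x| -> f x = 0) ->
  Cc_infty f.
Proof.
move=> ef fM; split; first by move=> k x; exact: elementary_smooth.
apply: (@subclosed_compact _ _ `[- M, M]%classic).
- exact: closed_closure.
- exact: segment_compact.
- have cl : closed (`[- M, M]%classic : set R) by exact: itv_closed.
  rewrite [X in _ `<=` X]((closure_id _).1 cl).
  apply: closureS => x /= /eqP fx; rewrite in_itv/= -ler_norml leNgt.
  by apply/negP => /fM.
Qed.

Definition step x : R := flat 1 x * (flat 1 x + flat 1 (1 - x))^-1.

Lemma step_denom x : flat 1 x + flat 1 (1 - x) != 0.
Proof.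
have f0 y : 0 <= flat 1 y.
  by have [/(flat_le0 1) ->//|/flat1_gt0 /ltW] := leP y 0.
rewrite gt_eqF//; have [x0|x0] := leP x 0.
  by rewrite ltr_wpDl// flat1_gt0; lra.
by rewrite ltr_pwDl// flat1_gt0.
Qed.

Lemma step1 x : 1 <= x -> step x = 1.
Proof.
by move=> x1; rewrite /step (flat_le0 1 (x := 1 - x)) ?addr0 ?divff// ?gt_eqF ?flat1_gt0//; lra.
Qed.

Lemma step0 x : x <= 0 -> step x = 0.
Proof. by move=> x0; rewrite /step (flat_le0 1 x0) mul0r. Qed.

Lemma El_step : elementary step.
Proof.
apply: El_mul; first exact: El_flat.
apply: El_inv; last exact: step_denom.
apply: El_add; first exact: El_flat.
apply: (@El_comp (flat 1) (fun x => 1 - x)); first exact: El_flat.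
have -> : (fun x : R => 1 - x) = (fun x => 1 + -1 * x) by apply/funext => x; rewrite mulN1r.
by apply: El_add; [exact: El_cst|apply: El_mul; [exact: El_cst|exact: El_id]].
Qed.

(** For a variable bounded by k the plateau exceeds the range by a margin 1, so that multiplying by
    the cutoff alters neither the values nor the derivatives of a test function on the range. *)
Definition cutoff k x : R := step (k + 2 + -1 * x) * step (k + 2 + x).

Lemma El_cutoff k : elementary (cutoff k).
Proof.
apply: El_mul; apply: El_comp El_step _; apply: El_add; try exact: El_cst; last exact: El_id.
by apply: El_mul; [exact: El_cst|exact: El_id].
Qed.

Lemma cutoff1 k x : `|x| <= k + 1 -> cutoff k x = 1.
Proof. by rewrite ler_norml => /andP[h1 h2]; rewrite /cutoff !step1 ?mulr1//; lra. Qed.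

Lemma cutoff0 k x : k + 2 < `|x| -> cutoff k x = 0.
Proof.
rewrite ltr_normr => /orP[h|h]; rewrite /cutoff.
  by rewrite step0 ?mul0r//; lra.
by rewrite [X in _ * X]step0 ?mulr0//; lra.
Qed.

End FlatFunctions.

Section KernelDerivatives.
Context (R : realType).
Implicit Types r u x k : R.

Lemma gk_expE r u x : -1 < r < 1 ->
  gk r u x = normal_peak (sg r) * expR (- (((x - r * u) / sg r) ^+ 2 / 2)).
Proof. by move=> r1; rewrite gkE// normal_pdf_zE// sg_gt0. Qed.

Lemma is_derive_gk_u r u x : -1 < r < 1 ->
  is_derive u 1 (fun u => gk r u x) (- r * npdf1 (r * u) (sg r) x).
Proof.
move=> r1; have s0 := sg_gt0 r1; rewrite /npdf1 -gkE// gk_expE//.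
have -> : (fun u => gk r u x) =
    (fun u => normal_peak (sg r) * expR (- (((x - r * u) / sg r) ^+ 2 / 2))).
  by apply/funext => v; exact: gk_expE.
apply: is_derive_eq; rewrite /GRing.scale/=.
by field; rewrite gt_eqF.
Qed.

Lemma is_derive_npdf1_u r u x : -1 < r < 1 ->
  is_derive u 1 (fun u => npdf1 (r * u) (sg r) x) (- r * npdf2 (r * u) (sg r) x).
Proof.
move=> r1; have s0 := sg_gt0 r1; have dg := is_derive_gk_u u x r1.
rewrite /npdf1; under eq_fun do rewrite -gkE//.
apply: is_derive_eq; rewrite /GRing.scale/= /npdf2 /npdf1 gkE//.
by field; rewrite gt_eqF.
Qed.

Lemma El_gk r x : -1 < r < 1 -> elementary (fun u => gk r u x).
Proof.
move=> r1; have -> : (fun u => gk r u x) =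
    (fun u => normal_peak (sg r) * expR (-2^-1 * (((x + - r * u) * (sg r)^-1) * ((x + - r * u) * (sg r)^-1)))).
  apply/funext => u; rewrite gk_expE//; congr (_ * expR _); rewrite !mulNr.
  by rewrite expr2 mulrC.
have El_z : elementary (fun u => (x + - r * u) * (sg r)^-1).
  apply: El_mul; last exact: El_cst.
  apply: El_add; first exact: El_cst.
  by apply: El_mul; [exact: El_cst|exact: El_id].
apply: El_mul; first exact: El_cst.
apply: (El_comp (El_exp R)); apply: El_mul; first exact: El_cst.
exact: El_mul.
Qed.

Lemma integral_gk r u : -1 < r < 1 -> (\int[lebesgue_measure]_x (gk r u x)%:E = 1)%E.
Proof.
move=> r1; under eq_integral do rewrite gkE//.
by apply: integral_normal_pdf; rewrite gt_eqF// sg_gt0.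
Qed.

Lemma near_lt_norm (c x : R) : `|x| < c -> \forall y \near x, `|y| < c.
Proof.
rewrite ltr_norml => /andP[h1 h2]; near=> y; rewrite ltr_norml; apply/andP; split; near: y.
- exact: lt_nbhsr.
- exact: lt_nbhsl.
Unshelve. all: by end_near. Qed.

Lemma derive1_cutoff k (f df : R -> R) (x : R) : `|x| < k + 1 -> is_derive x 1 f (df x) ->
  derive1 (fun y => cutoff k y * f y) x = df x.
Proof.
move=> xk dfx; rewrite derive1E -[RHS](derive_val (is_derive := dfx)).
apply: near_eq_derive; apply: filterS (near_lt_norm xk) => y yk.
by rewrite cutoff1 ?mul1r// ltW.
Qed.

Lemma derive1n2_cutoff k (f df ddf : R -> R) (x : R) : `|x| < k + 1 ->
    (forall y : R, is_derive y 1 f (df y)) -> is_derive x 1 df (ddf x) ->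
  derive1n 2 (fun y => cutoff k y * f y) x = ddf x.
Proof.
move=> xk dfy ddfx; rewrite derive1nS derive1n1 derive1E -[RHS](derive_val (is_derive := ddfx)).
apply: near_eq_derive; apply: filterS (near_lt_norm xk) => y yk.
exact: derive1_cutoff.
Qed.

End KernelDerivatives.

Section ScoreIdentity.
Context d (W : measurableType d) (R : realType) (P : probability W R).
Variables (U : W -> R) (s I : R -> R).
Hypothesis bU : bmf U.
Hypothesis scU : is_score P U s.
Hypothesis sL2 : in_Lp_of P U 2 s.
Hypothesis sc2U : is_score2 P U I.
Hypothesis IL2 : in_Lp_of P U 2 I.

Lemma expectationE (f : W -> R) : P.-integrable [set: W] (EFin \o f) -> ('E_P[f] = (Ex P f)%:E)%E.
Proof. by move=> fi; rewrite unlock (EFin_Ex fi). Qed.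

Lemma in_L1_integrable f : in_Lp_of P U 1 f -> P.-integrable [set: W] (EFin \o (fun w => f (U w))).
Proof.
move=> [mf]; rewrite unlock; under eq_integral do rewrite powRr1//.
move=> fi; apply/integrableP; split => //.
by apply/measurable_EFinP; exact: (measurableT_comp mf (proj1 bU)).
Qed.

Lemma in_L2_integrable f : in_Lp_of P U 2 f ->
  P.-integrable [set: W] (EFin \o (fun w => `|f (U w)| ^+ 2)).
Proof.
move=> [mf]; rewrite unlock; under eq_integral do rewrite powR_mulrn//.
move=> fi; apply/integrableP; split.
  apply/measurable_EFinP/measurable_funX; apply: measurableT_comp => //.
  exact: (measurableT_comp mf (proj1 bU)).
apply: le_lt_trans fi; apply: le_of_eq.
by apply: eq_integral => w _; rewrite /= ger0_norm ?sqr_ge0.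
Qed.

Let iS := in_L1_integrable (proj1 scU).
Let iI := in_L1_integrable (proj1 sc2U).

Definition tot w := I (U w) + (1 + s (U w) * U w).

Lemma integrable_tot : P.-integrable [set: W] (EFin \o tot).
Proof.
have i1 : P.-integrable [set: W] (EFin \o (fun w => 1 : R)) by exact/bmf_int/bmf_cst.
have i2 := integrableM_bmf iS bU.
have i3 := integrableD measurableT i1 i2.
exact: (integrableD measurableT iI i3).
Qed.

(** The score identities for u g and g, made compactly supported by the cutoff, express E[U npdf1]
    and r E[npdf2] through E[g], E[s(U) U g] and E[I(U) g]. These are the two halves of [dmix], and
    each expression carries a factor 1 / r. *)
Lemma dmix_score r x : 0 < r < 1 ->
  dmix P U r x = - r^-1 * Ex P (fun w => tot w * gk r (U w) x).
Proof.
move=> /andP[r0 rl]; have r1 : -1 < r < 1 by lra.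
have [mU [k Uk]] := bU.
have bg : bmf (fun w => gk r (U w) x) := @bmf_gk _ _ R U mU r x r1.
have bz : bmf (fun w => (x - r * U w) / sg r).
  apply: bmfM; last exact: bmf_cst.
  by apply: bmfB; [exact: bmf_cst|apply: bmfM => //; exact: bmf_cst].
have b1 : bmf (fun w => npdf1 (r * U w) (sg r) x).
  rewrite /npdf1; under eq_fun do rewrite -gkE//.
  by apply: bmfM bg; apply: bmfN; apply: bmfM bz _; exact: bmf_cst.
have b2 : bmf (fun w => npdf2 (r * U w) (sg r) x).
  rewrite /npdf2; under eq_fun do rewrite -gkE//.
  apply: bmfM bg; apply: bmfM; last exact: bmf_cst.
  by apply: bmfB; [exact: bmfX bz|exact: bmf_cst].
have E1 : Ex P (fun w => s (U w) * (U w * gk r (U w) x)) =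
    - (Ex P (fun w => gk r (U w) x) - r * Ex P (fun w => U w * npdf1 (r * U w) (sg r) x)).
  pose Phi u := cutoff k u * (u * gk r u x).
  have CPhi : Cc_infty Phi.
    apply: (@elementary_Cc _ _ (k + 2)).
      apply: El_mul; first exact: El_cutoff.
      by apply: El_mul; [exact: El_id|exact: El_gk].
    by move=> y ky; rewrite /Phi cutoff0// mul0r.
  have := proj2 scU Phi CPhi.
  have -> : (fun w => s (U w) * Phi (U w)) = (fun w => s (U w) * (U w * gk r (U w) x)).
    by apply/funext => w; rewrite /Phi cutoff1 ?mul1r// (le_trans (Uk w))// lerDl.
  have -> : (fun w => derive1 Phi (U w)) =
      (fun w => gk r (U w) x - r * (U w * npdf1 (r * U w) (sg r) x)).
    apply/funext => w; have Uk1 : `|U w| < k + 1 by rewrite (le_lt_trans (Uk w))// ltrDl.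
    have dg := is_derive_gk_u (U w) x r1.
    have dug : is_derive (U w) 1 (fun u => u * gk r u x)
        (gk r (U w) x - r * (U w * npdf1 (r * U w) (sg r) x)).
      by apply: is_derive_eq; rewrite /GRing.scale/= mulr1; ring.
    exact: (@derive1_cutoff R k (fun u => u * gk r u x)
      (fun u => gk r u x - r * (u * npdf1 (r * u) (sg r) x)) (U w) Uk1 dug).
  have bUn : bmf (fun w => U w * npdf1 (r * U w) (sg r) x) by exact: bmfM.
  have brUn : bmf (fun w => r * (U w * npdf1 (r * U w) (sg r) x)) := bmfM (bmf_cst _ r) bUn.
  rewrite (expectationE (integrableM_bmf iS (bmfM bU bg))).
  rewrite (expectationE (bmf_int P (bmfB bg brUn))) -EFinN => -[->].
  by rewrite (ExB (bmf_int P bg) (bmf_int P brUn)) (ExZ r (bmf_int P bUn)).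
have E2 : Ex P (fun w => I (U w) * gk r (U w) x) = r ^+ 2 * Ex P (fun w => npdf2 (r * U w) (sg r) x).
  pose Psi u := cutoff k u * gk r u x.
  have CPsi : Cc_infty Psi.
    apply: (@elementary_Cc _ _ (k + 2)).
      by apply: El_mul; [exact: El_cutoff|exact: El_gk].
    by move=> y ky; rewrite /Psi cutoff0// mul0r.
  have := proj2 sc2U Psi CPsi.
  have -> : (fun w => I (U w) * Psi (U w)) = (fun w => I (U w) * gk r (U w) x).
    by apply/funext => w; rewrite /Psi cutoff1 ?mul1r// (le_trans (Uk w))// lerDl.
  have -> : (fun w => derive1n 2 Psi (U w)) =
      (fun w => r ^+ 2 * npdf2 (r * U w) (sg r) x).
    apply/funext => w; have Uk1 : `|U w| < k + 1 by rewrite (le_lt_trans (Uk w))// ltrDl.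
    have dg (u : R) := is_derive_gk_u u x r1.
    have dn : is_derive (U w) 1 (fun u => - r * npdf1 (r * u) (sg r) x)
        (r ^+ 2 * npdf2 (r * U w) (sg r) x).
      have dn := is_derive_npdf1_u (U w) x r1; apply: is_derive_eq.
      by rewrite /GRing.scale/=; ring.
    exact: (@derive1n2_cutoff R k (fun u => gk r u x) (fun u => - r * npdf1 (r * u) (sg r) x)
      (fun u => r ^+ 2 * npdf2 (r * u) (sg r) x) (U w) Uk1 dg dn).
  rewrite (expectationE (integrableM_bmf iI bg)).
  rewrite (expectationE (bmf_int P (bmfM (bmf_cst _ _) b2))) => -[->].
  by rewrite ExZ//; exact: bmf_int.
have -> : Ex P (fun w => tot w * gk r (U w) x) = Ex P (fun w => I (U w) * gk r (U w) x) +
    (Ex P (fun w => gk r (U w) x) + Ex P (fun w => s (U w) * (U w * gk r (U w) x))).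
  have i1 := integrableM_bmf iI bg; have i2 := bmf_int P bg.
  have i3 := integrableM_bmf iS (bmfM bU bg).
  rewrite -(ExD i2 i3) -(ExD i1 (integrableD measurableT i2 i3)).
  by congr Ex; apply/funext => w; rewrite /tot/=; ring.
rewrite E1 E2 /dmix /dgk.
have bUn : bmf (fun w => U w * npdf1 (r * U w) (sg r) x) by exact: bmfM.
rewrite (_ : Ex P (fun w => _) = - Ex P (fun w => U w * npdf1 (r * U w) (sg r) x)
    - r * Ex P (fun w => npdf2 (r * U w) (sg r) x)); last first.
  rewrite -(ExZ r (bmf_int P b2)) -(ExN (bmf_int P bUn)).
  rewrite -(ExB (bmf_int P (bmfN bUn)) (bmf_int P (bmfM (bmf_cst _ r) b2))).
  by congr Ex; apply/funext => w; rewrite mulNr.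
by field; rewrite gt_eqF.
Qed.

Lemma Lnorm2_fin (Y : W -> R) : P.-integrable [set: W] (EFin \o (fun w => `|Y w| ^+ 2)) ->
  'N[P]_2%:E[EFin \o Y]%E = (pnorm P 2 Y)%:E.
Proof.
move=> iY; have := @poweR_Lnorm _ _ _ P (EFin \o Y) 2 (lt0r_neq0 (ltr0n _ 2)).
under eq_integral do rewrite /= powR_mulrn//.
rewrite -(EFin_Ex iY) /pnorm; have := Lnorm_ge0 P 2%:E (EFin \o Y).
by case: ('N[P]_ _ [_])%E => [x x0| |//]//; rewrite poweRyr.
Qed.

Definition score_norm := pnorm P 2 (fun w => I (U w)) + (1 + pnorm P 2 (fun w => s (U w) * U w)).

Let mU : measurable_fun [set: W] U := proj1 bU.
Let ms : measurable_fun [set: W] (fun w => s (U w)) := measurableT_comp (proj1 sL2) mU.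
Let mI : measurable_fun [set: W] (fun w => I (U w)) := measurableT_comp (proj1 IL2) mU.

Lemma integrable_sqr_score : P.-integrable [set: W] (EFin \o (fun w => `|s (U w) * U w| ^+ 2)).
Proof.
have := integrableM_bmf (in_L2_integrable sL2) (bmfX 2 bU).
by under eq_fun do rewrite -[U _ ^+ 2](real_normK (num_real _)) -exprMn -normrM.
Qed.

Lemma measurable_tot : measurable_fun [set: W] tot.
Proof.
apply: measurable_funD => //; apply: measurable_funD; first exact: measurable_cst.
exact: measurable_funM.
Qed.

Lemma Lnorm_tot : ('N[P]_2%:E[EFin \o tot] <= (score_norm)%:E)%E.
Proof.
have m1 : measurable_fun [set: W] (fun=> 1 : R) by exact: measurable_cst.
have msU : measurable_fun [set: W] (fun w => s (U w) * U w) by exact: measurable_funM.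
have le12 : (1 : R) <= 2 by rewrite ler1n.
apply: (le_trans (@minkowski_EFin _ _ _ P (fun w => I (U w)) (fun w => 1 + s (U w) * U w) 2
  mI (measurable_funD m1 msU) le12)).
rewrite [leRHS](_ : _ = (pnorm P 2 (fun w => I (U w)))%:E +
  (1%:E + (pnorm P 2 (fun w => s (U w) * U w))%:E))%E; last by rewrite /score_norm !EFinD.
apply: leeD.
  by rewrite -(Lnorm2_fin (in_L2_integrable IL2)).
apply: (le_trans (@minkowski_EFin _ _ _ P (fun=> 1) (fun w => s (U w) * U w) 2 m1 msU le12)).
apply: leeD; last by rewrite -(Lnorm2_fin integrable_sqr_score).
have -> // : 'N[P]_2%:E[EFin \o (fun=> 1%R)]%E = 1%E.
transitivity (P [set: W] `^ 2^-1)%E; first exact: Lnorm_cst1.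
by rewrite probability_setT poweR1r.
Qed.

Lemma integral_sqr_tot : (\int[P]_w (tot w ^+ 2)%:E <= (score_norm ^+ 2)%:E)%E.
Proof.
have := @poweR_Lnorm _ _ _ P (EFin \o tot) 2 (lt0r_neq0 (ltr0n _ 2)).
under eq_integral do rewrite /= powR_mulrn// real_normK ?num_real//.
move=> <-; have := Lnorm_tot; have := Lnorm_ge0 P 2%:E (EFin \o tot).
case: ('N[P]_ _ [_])%E => [x x0 xL| |]//.
rewrite poweR_EFin powR_mulrn// lee_fin lerXn2r// nnegrE; rewrite !lee_fin in x0 xL => //.
exact: le_trans x0 xL.
Qed.

(** The argument of [mixture_norm_le] with l = 1, repeated because [tot] is only square integrable,
    not bounded. *)
Lemma score_bound r : 0 < r < 1 ->
  (\int[lebesgue_measure]_x (dmix P U r x ^+ 2 / mix P U r x)%:E <= ((score_norm / r) ^+ 2)%:E)%E.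
Proof.
move=> r01; have [r0 rl] := andP r01; have r1 : -1 < r < 1 by lra.
have mg := measurable_gk2 bU r.
have bg x : bmf (fun w => gk r (U w) x) := @bmf_gk _ _ R U mU r x r1.
have iA2 : P.-integrable [set: W] (EFin \o (fun w => tot w ^+ 2)).
  apply/integrableP; split; first by apply/measurable_EFinP/measurable_funX; exact: measurable_tot.
  apply: (le_lt_trans _ (ltry (score_norm ^+ 2))); apply: le_trans integral_sqr_tot.
  apply: le_of_eq.
  by apply: eq_integral => w _; rewrite /= ger0_norm ?sqr_ge0.
pose H (p : W * R) := tot p.1 ^+ 2 * gk r (U p.1) p.2.
have mt1 : measurable_fun [set: W * R] (fun p => tot p.1).
  exact: (measurableT_comp measurable_tot measurable_fst).
have mH : measurable_fun [set: W * R] H by apply: measurable_funM mg; exact: measurable_funX.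
have H0 p : (0 <= (H p)%:E)%E by rewrite lee_fin mulr_ge0 ?sqr_ge0// ltW// gk_gt0.
have mEA : measurable_fun [set: R] (fun x => Ex P (fun w => tot w * gk r (U w) x)).
  apply: (@measurable_Ex _ _ _ _ R P (fun p : W * R => tot p.1 * gk r (U p.1) p.2)).
  exact: measurable_funM.
have m0 x : 0 < mix P U r x := mix_gt0 P mU x r1.
have mm : measurable_fun [set: R] (mix P U r) := measurable_mixr P bU r.
under eq_integral do rewrite dmix_score// exprMn sqrrN exprVn -mulrA EFinM.
have mq := measurable_sqr_div mm mEA.
rewrite ge0_integralZl//; last 2 first.
- by move=> x _; rewrite lee_fin divr_ge0 ?sqr_ge0// ltW.
- by rewrite lee_fin invr_ge0 sqr_ge0.
rewrite exprMn exprVn mulrC [leRHS]EFinM; apply: lee_wpmul2l.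
  by rewrite lee_fin invr_ge0 sqr_ge0.
apply: le_trans integral_sqr_tot.
apply: (@le_trans _ _ (\int[lebesgue_measure]_x (\int[P]_w (H (w, x))%:E))%E).
  apply: ge0_le_integral => //.
  - by move=> x _; rewrite lee_fin divr_ge0 ?sqr_ge0// ltW.
  - apply: (@measurable_fun_fubini_tonelli_G _ _ _ _ R P (EFin \o H)) => //.
    exact/measurable_EFinP.
  - move=> x _; rewrite -(EFin_Ex (integrableM_bmf iA2 (bg x))) lee_fin.
    exact: (@weighted_CS _ W R P tot (fun w => gk r (U w) x) measurable_tot (bg x)
      (fun w => ltW (gk_gt0 (U w) x r1)) (integrableM_bmf integrable_tot (bg x))
      (integrableM_bmf iA2 (bg x)) (m0 x)).
rewrite -(@fubini_tonelli _ _ _ _ R P lebesgue_measure (EFin \o H)) => //; last exact/measurable_EFinP.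
apply: le_of_eq; apply: eq_integral => w _.
rewrite /H/=; under eq_integral do rewrite EFinM.
rewrite ge0_integralZl//.
- by rewrite integral_gk// mule1.
- by apply/measurable_EFinP; exact: (@measurable_fun_pair2 _ _ _ _ _ _ _ w mg).
- by move=> x _; rewrite lee_fin ltW// gk_gt0.
- by rewrite lee_fin sqr_ge0.
Qed.

End ScoreIdentity.

(** * The density of a variable with scores *)

Section DensityLimit.
Context d (W : measurableType d) (R : realType) (P : probability W R).
Notation leb := (@lebesgue_measure R).
Variables (U : W -> R) (K : R).
Hypothesis bU : bmf U.
Hypothesis K0 : 0 <= K.
Hypothesis dmixK : forall r x, 2^-1 <= r -> r < 1 -> `|dmix P U r x| <= K / Num.sqrt (1 - r).

Let mU : measurable_fun [set: W] U := proj1 bU.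

Lemma is_derive_sqrt_onem (r : R) : r < 1 ->
  is_derive r 1 (fun r => Num.sqrt (1 - r)) (- (2 * Num.sqrt (1 - r))^-1).
Proof.
move=> r1; have r0 : 0 < 1 - r by rewrite subr_gt0.
have d1 : is_derive r 1 (fun r : R => 1 - r) (-1).
  rewrite -[X in is_derive _ _ _ X]add0r.
    by apply: is_deriveB.
have := @is_derive1_comp R Num.sqrt (fun r => 1 - r) r _ _ (is_derive1_sqrt r0) d1.
by rewrite mulrN1.
Qed.

(** K / sqrt (1 - q) is the derivative of - 2 K sqrt (1 - q), so adding this function to the mixture
    or to its opposite gives nondecreasing functions of q. *)
Lemma mix_increment (r r' x : R) : 2^-1 <= r -> r <= r' -> r' < 1 ->
  `|mix P U r' x - mix P U r x| <= 2 * K * (Num.sqrt (1 - r) - Num.sqrt (1 - r')).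
Proof.
move=> r2 rr' r'1; have [_ [k Uk]] := bU.
have dm (q : R) : r <= q <= r' -> is_derive q 1 ((mix P U)^~ x) (dmix P U q x).
  by move=> rq; apply: (is_derive_mix P mU Uk); lra.
have dq (q : R) : r <= q <= r' -> is_derive q 1 (fun r => Num.sqrt (1 - r)) (- (2 * Num.sqrt (1 - q))^-1).
  by move=> rq; apply: is_derive_sqrt_onem; lra.
have E (q : R) : q < 1 -> 2 * K * (2 * Num.sqrt (1 - q))^-1 = K / Num.sqrt (1 - q).
  by move=> q1; field; rewrite gt_eqF// sqrtr_gt0 subr_gt0.
have h (q : R) : r <= q <= r' -> `|dmix P U q x| <= K / Num.sqrt (1 - q).
  by move=> rq; apply: dmixK; lra.
have u1 : 2 * K * Num.sqrt (1 - r') + mix P U r' x <= 2 * K * Num.sqrt (1 - r) + mix P U r x.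
  rewrite -lerN2.
  apply: (@ge0_is_derive_le R (fun q => - (2 * K * Num.sqrt (1 - q) + mix P U q x))
    (fun q => K / Num.sqrt (1 - q) - dmix P U q x) r r' rr').
    move=> q rq; have d1 := dm q rq; have d2 := dq q rq; apply: is_derive_eq.
    by rewrite /GRing.scale/= -E ?scaler0; [ring|lra].
  by move=> q rq; have := h q rq; rewrite ler_norml subr_ge0 => /andP[].
have u2 : mix P U r x - 2 * K * Num.sqrt (1 - r) <= mix P U r' x - 2 * K * Num.sqrt (1 - r').
  apply: (@ge0_is_derive_le R (fun q => mix P U q x - 2 * K * Num.sqrt (1 - q))
    (fun q => K / Num.sqrt (1 - q) + dmix P U q x) r r' rr').
    move=> q rq; have d1 := dm q rq; have d2 := dq q rq; apply: is_derive_eq.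
    by rewrite /GRing.scale/= -E ?scaler0; [ring|lra].
  by move=> q rq; have := h q rq; rewrite ler_norml => /andP[+ _]; rewrite -subr_ge0 opprK addrC.
by rewrite ler_norml; apply/andP; split; lra.
Qed.

(** Starts at 1/2, where the bound [dmixK] begins to hold, and increases to 1. *)
Definition rn (n : nat) : R := 1 - n.+2%:R^-1.

Lemma rn_ge n : 2^-1 <= rn n.
Proof.
rewrite /rn -subr_ge0 (_ : _ - _ = 2^-1 - n.+2%:R^-1); last by field.
by rewrite subr_ge0 lef_pV2 ?posrE// ler_nat.
Qed.

Lemma rn_lt1 n : rn n < 1.
Proof. by rewrite /rn ltrBlDr ltrDl invr_gt0 ltr0n. Qed.

Lemma rn_le m n : (m <= n)%N -> rn m <= rn n.
Proof. by move=> mn; rewrite /rn lerD2l lerN2 lef_pV2 ?posrE// ler_nat. Qed.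

Lemma rn_near (r : R) : r < 1 -> \forall n \near \oo, r <= rn n.
Proof.
move=> r1; have r0 : 0 < 1 - r by rewrite subr_gt0.
near=> n; rewrite /rn lerBrDr addrC -lerBrDr invf_ple ?posrE//.
have : (1 - r)^-1 <= n%:R by near: n; exact: nbhs_infty_ger.
by move/le_trans; apply; rewrite ler_nat (leq_trans (leqnSn _) (leqnSn _)).
Unshelve. all: by end_near. Qed.

(** By [mix_increment] the sequence minus [a] is nondecreasing and bounded, and [a] itself is
    nonincreasing; two monotone limits replace a Cauchy argument. *)
Lemma cvg_mix x : cvgn (fun n => mix P U (rn n) x).
Proof.
pose a n := 2 * K * Num.sqrt (1 - rn n).
have a0 n : 0 <= a n by rewrite !mulr_ge0.
have inc m n : (m <= n)%N -> mix P U (rn m) x - a m <= mix P U (rn n) x - a n.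
  move=> mn; have := mix_increment x (rn_ge m) (rn_le mn) (rn_lt1 n).
  by rewrite ler_norml /a => /andP[+ _]; lra.
have dec m n : (m <= n)%N -> a n <= a m.
  move=> mn; rewrite /a ler_wpM2l ?mulr_ge0// ler_wsqrtr// lerD2l lerN2.
  exact: rn_le.
have c1 : cvgn (fun n => mix P U (rn n) x - a n).
  apply: nondecreasing_is_cvgn; first by move=> m n; exact: inc.
  exists (mix P U (rn 0) x + a 0%N) => _ [n _ <-].
  have := mix_increment x (rn_ge 0) (rn_le (leq0n n)) (rn_lt1 n).
  by have := a0 n; rewrite ler_norml /a => + /andP[_]; lra.
have c2 : cvgn a.
  apply: nonincreasing_is_cvgn; first by move=> m n; exact: dec.
  by exists 0 => _ [n _ <-].
have -> : (fun n => mix P U (rn n) x) = (fun n => mix P U (rn n) x - a n) + a.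
  by apply/funext => n; rewrite fctE subrK.
exact: is_cvgD.
Qed.

Definition dens x := limn (fun n => mix P U (rn n) x).

Lemma dens_mix_le (r x : R) : 2^-1 <= r -> r < 1 ->
  `|dens x - mix P U r x| <= 2 * K * Num.sqrt (1 - r).
Proof.
move=> r2 r1.
have H : \forall n \near \oo, mix P U r x - 2 * K * Num.sqrt (1 - r) <= mix P U (rn n) x
    <= mix P U r x + 2 * K * Num.sqrt (1 - r).
  apply: filterS (rn_near r1) => n rrn.
  have := mix_increment x r2 rrn (rn_lt1 n).
  have : 0 <= 2 * K * Num.sqrt (1 - rn n) by rewrite !mulr_ge0.
  by rewrite ler_norml => ? /andP[? ?]; apply/andP; split; lra.
have l1 : dens x <= mix P U r x + 2 * K * Num.sqrt (1 - r).
  by apply: limr_le; [exact: cvg_mix|apply: filterS H => n /andP[]].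
have l2 : mix P U r x - 2 * K * Num.sqrt (1 - r) <= dens x.
  by apply: limr_ge; [exact: cvg_mix|apply: filterS H => n /andP[]].
by rewrite ler_norml; apply/andP; split; lra.
Qed.

Lemma mix_rn_gt0 n x : 0 < mix P U (rn n) x.
Proof. by apply: (mix_gt0 P mU); have := rn_ge n; have := rn_lt1 n; lra. Qed.

Lemma dens_ge0 x : 0 <= dens x.
Proof. by apply: limr_ge; [exact: cvg_mix|apply: nearW => n; exact/ltW/mix_rn_gt0]. Qed.

Lemma measurable_dens : measurable_fun [set: R] dens.
Proof.
apply: (@measurable_fun_cvg _ _ _ _ (fun n => mix P U (rn n))).
  by move=> n; exact: (measurable_mixr P bU).
by move=> x _; exact: cvg_mix.
Qed.

Lemma dens_le : exists M : R, forall x, dens x <= M.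
Proof.
have r2 : 2^-1 <= 2^-1 :> R by [].
have r1 : 2^-1 < 1 :> R by lra.
have r1' : -1 < (2^-1 : R) < 1 by lra.
exists (100 / Num.sqrt (1 - 2^-1 ^+ 2) + 2 * K * Num.sqrt (1 - 2^-1)) => x.
have := dens_mix_le x r2 r1; rewrite ler_norml lerBlDr => /andP[_] /le_trans; apply.
rewrite addrC lerD2r.
have bg := @bmf_gk _ _ R U mU 2^-1 x r1'.
rewrite -[leRHS](Ex_cst P); apply: le_Ex; [exact: bmf_int|exact/bmf_int/bmf_cst|move=> w].
apply: le_trans (ler_norm _) _; apply: gk_le; lra.
Qed.

Section LipschitzTest.
Variables (h : R -> R) (a c L : R).
Hypothesis mh : measurable_fun [set: R] h.
Hypothesis h0 : forall x, 0 <= h x.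
Hypothesis h1 : forall x, h x <= 1.
Hypothesis ac : a <= c.
Hypothesis hac : forall x, ~~ (a <= x <= c) -> h x = 0.
Hypothesis L0 : 0 <= L.
Hypothesis hL : forall x y, h x <= h y + L * `|x - y|.
Variable k : R.
Hypothesis Uk : forall w, `|U w| <= k.

(** Bounds L times the mean distance from u to r u + sg r Z when |u| <= k, since E|Z| <= 1. *)
Definition lip_err (r : R) := L * ((1 - r) * k + sg r).

Section Fixed.
Variable r : R.
Hypothesis r2 : 2^-1 <= r.
Hypothesis rl : r < 1.

Let r1 : -1 < r < 1. Proof. by have := r2; have := rl; lra. Qed.

Lemma measurable_gkr u : measurable_fun [set: R] (gk r u).
Proof.
rewrite (_ : gk r u = normal_pdf (r * u) (sg r)); first exact: measurable_normal_pdf.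
by apply/funext => x; rewrite gkE.
Qed.

(** |z| <= (1 + z^2) / 2 makes the bound quadratic, so that its Gaussian mean is given by
    [integral_quart]. *)
Lemma dist_le u x : `|u| <= k ->
  `|x - u| <= (1 - r) * k + sg r / 2 + sg r / 2 * ((x - r * u) / sg r) ^+ 2.
Proof.
move=> uk; have s0 := sg_gt0 r1.
have -> : x - u = (x - r * u) - (1 - r) * u by ring.
have n1 : `|(1 - r) * u| <= (1 - r) * k.
  by rewrite normrM ger0_norm ?ler_wpM2l// subr_ge0 ltW.
apply: le_trans (ler_normB _ _) _; rewrite addrC -addrA; apply: lerD => //.
set z := (x - r * u) / sg r; have -> : x - r * u = sg r * z.
  by rewrite [RHS]mulrC divfK// gt_eqF.
rewrite normrM (ger0_norm (ltW s0)) -(real_normK (num_real z)).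
rewrite -subr_ge0 (_ : _ - _ = sg r / 2 * (1 - `|z|) ^+ 2); last by field.
by rewrite mulr_ge0 ?sqr_ge0// divr_ge0// ltW.
Qed.

Lemma inner_le u : `|u| <= k ->
  (\int[leb]_x (h x * gk r u x)%:E <= (h u + lip_err r)%:E)%E.
Proof.
move=> uk; have s0 := sg_gt0 r1.
have := integral_quart (r * u) s0 (h u + L * ((1 - r) * k + sg r / 2)) 0 (L * (sg r / 2)) 0 0.
rewrite mulr0 addr0 (_ : _ + _ + L * (sg r / 2) = h u + lip_err r); last first.
  by rewrite /lip_err; field.
move=> <-; apply: ge0_le_integral => //.
- by move=> x _; rewrite lee_fin mulr_ge0// ltW// gk_gt0.
- by apply/measurable_EFinP/measurable_funM => //; exact: measurable_gkr.
- have := integrable_quart (r * u) s0 (h u + L * ((1 - r) * k + sg r / 2)) 0 (L * (sg r / 2)) 0 0.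
  by move/(measurable_int _).
- move=> x _; rewrite lee_fin -gkE// ler_wpM2r//; first by rewrite ltW// gk_gt0.
  apply: le_trans (hL x u) _; rewrite /quart !mul0r !addr0 -addrA lerD2l -mulrA -mulrDr.
  by rewrite ler_wpM2l// dist_le.
Qed.

Lemma inner_ge u : `|u| <= k ->
  ((h u)%:E <= \int[leb]_x (h x * gk r u x)%:E + (lip_err r)%:E)%E.
Proof.
move=> uk; have s0 := sg_gt0 r1.
have mg := measurable_gkr u.
have g0 x : 0 <= gk r u x by rewrite ltW// gk_gt0.
pose q x := quart (L * ((1 - r) * k + sg r / 2)) 0 (L * (sg r / 2)) 0 0 ((x - r * u) / sg r)
  * normal_pdf (r * u) (sg r) x.
have q0 x : 0 <= q x.
  rewrite /q -gkE// mulr_ge0// /quart !mul0r !addr0 -mulrA -mulrDr mulr_ge0//.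
  exact: le_trans (normr_ge0 _) (dist_le x uk).
have mq : measurable_fun [set: R] (EFin \o q).
  by have /(measurable_int _) := integrable_quart (r * u) s0 (L * ((1 - r) * k + sg r / 2)) 0 (L * (sg r / 2)) 0 0.
have Eq : (\int[leb]_x (q x)%:E = (lip_err r)%:E)%E.
  by rewrite /q integral_quart// mulr0 addr0; congr EFin; rewrite /lip_err; field.
rewrite -Eq -ge0_integralD//; last 3 first.
- by move=> x _; rewrite lee_fin mulr_ge0.
- by apply/measurable_EFinP; exact: measurable_funM.
- by move=> x _; rewrite lee_fin.
rewrite -[leLHS]mule1 -(integral_gk u r1) -ge0_integralZl//; last 3 first.
- exact/measurable_EFinP.
- by move=> x _; rewrite lee_fin.
- by rewrite lee_fin.
apply: ge0_le_integral => //.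
- by move=> x _; rewrite mule_ge0// lee_fin.
- by apply: measurable_funeM; exact/measurable_EFinP.
- by apply: emeasurable_funD => //; apply/measurable_EFinP; exact: measurable_funM.
- move=> x _; rewrite -EFinM -EFinD lee_fin /q -gkE// -mulrDl ler_wpM2r//.
  apply: le_trans (hL u x) _; rewrite distrC lerD2l /quart !mul0r !addr0 -mulrA -mulrDr.
  by rewrite ler_wpM2l// dist_le.
Qed.

End Fixed.

Let k0 : 0 <= k.
Proof.
have PF : ProperFilter (almost_everywhere P).
  have PW : (0 < P [set: W])%E by rewrite probability_setT lte01.
  exact: (ae_properfilter_algebraOfSetsType PW).
have [w _] := @filter_ex _ _ PF _ (@filterT _ _ _).
exact: le_trans (normr_ge0 _) (Uk w).
Qed.

Let bhU : bmf (fun w => h (U w)).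
Proof.
split; first exact: measurableT_comp mh mU.
by exists 1 => w; rewrite ger0_norm.
Qed.

Lemma integral_test_mix r : 2^-1 <= r -> r < 1 ->
  (\int[leb]_x (h x * mix P U r x)%:E = \int[P]_w \int[leb]_x (h x * gk r (U w) x)%:E)%E.
Proof.
move=> r2 rl; have r1 : -1 < r < 1 by lra.
have bg x : bmf (fun w => gk r (U w) x) := @bmf_gk _ _ R U mU r x r1.
pose H (p : W * R) := h p.2 * gk r (U p.1) p.2.
have mH : measurable_fun [set: W * R] H.
  by apply: measurable_funM (measurable_gk2 bU r); exact: measurableT_comp mh measurable_snd.
rewrite (@fubini_tonelli _ _ _ _ R P leb (EFin \o H)); last 2 first.
- exact/measurable_EFinP.
- by move=> p; rewrite lee_fin mulr_ge0// ltW// gk_gt0.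
apply: eq_integral => x _; rewrite /H/= /mix -(ExZ _ (bmf_int P (bg x))).
by rewrite EFin_Ex//; apply: bmf_int; apply: bmfM; [exact: bmf_cst|exact: bg].
Qed.

Lemma measurable_inner r : 2^-1 <= r -> r < 1 ->
  measurable_fun [set: W] (fun w => \int[leb]_x (h x * gk r (U w) x)%:E)%E.
Proof.
move=> r2 rl; have r1 : -1 < r < 1 by lra.
apply: (@measurable_fun_fubini_tonelli_F _ _ _ _ R leb (fun p : W * R => (h p.2 * gk r (U p.1) p.2)%:E)).
  apply/measurable_EFinP.
  by apply: measurable_funM (measurable_gk2 bU r); exact: measurableT_comp mh measurable_snd.
by move=> p; rewrite lee_fin mulr_ge0// ltW// gk_gt0.
Qed.

Let inner_ge0 r w : 2^-1 <= r -> r < 1 -> (0 <= \int[leb]_x (h x * gk r (U w) x)%:E)%E.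
Proof.
move=> r2 rl; apply: integral_ge0 => x _; rewrite lee_fin mulr_ge0// ltW// gk_gt0//; lra.
Qed.

Let lip_err_ge0 r : 2^-1 <= r -> r < 1 -> 0 <= lip_err r.
Proof.
move=> r2 rl; rewrite /lip_err mulr_ge0// addr_ge0 ?sqrtr_ge0//.
by rewrite mulr_ge0// subr_ge0 ltW.
Qed.

Lemma test_mix_le r : 2^-1 <= r -> r < 1 ->
  (\int[leb]_x (h x * mix P U r x)%:E <= (Ex P (fun w => h (U w)) + lip_err r)%:E)%E.
Proof.
move=> r2 rl; rewrite integral_test_mix//.
have i1 := bmf_int P bhU; have bE := bmf_cst W (lip_err r).
rewrite -[X in _ + X](Ex_cst P) -(ExD i1 (bmf_int P bE)) (EFin_Ex (bmf_int P (bmfD bhU bE))).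
apply: ge0_le_integral => //.
- by move=> w _; exact: inner_ge0.
- exact: measurable_inner.
- by apply/measurable_EFinP; exact: (proj1 (bmfD bhU bE)).
- by move=> w _; exact: inner_le.
Qed.

Lemma test_mix_ge r : 2^-1 <= r -> r < 1 ->
  ((Ex P (fun w => h (U w)))%:E <= \int[leb]_x (h x * mix P U r x)%:E + (lip_err r)%:E)%E.
Proof.
move=> r2 rl; rewrite integral_test_mix//.
rewrite -(integral_cst_probability P (lip_err r)) (EFin_Ex (bmf_int P bhU)).
rewrite -ge0_integralD//; last 3 first.
- by move=> w _; exact: inner_ge0.
- exact: measurable_inner.
- by move=> w _; rewrite lee_fin lip_err_ge0.
apply: ge0_le_integral => //.
- by move=> w _; rewrite lee_fin.
- by apply/measurable_EFinP; exact: (proj1 bhU).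
- by apply: emeasurable_funD => //; exact: measurable_inner.
- by move=> w _; exact: inner_ge.
Qed.

Lemma integral_strip (dlt : R) : 0 <= dlt ->
  (\int[leb]_x (dlt * \1_(`[a, c]%classic) x)%:E = (dlt * (c - a))%:E)%E.
Proof.
move=> d0; under eq_integral do rewrite EFinM.
rewrite ge0_integralZl//; last first.
  by apply/measurable_EFinP; apply: measurable_indic; exact: measurable_itv.
rewrite integral_indic//.
rewrite setIT; have := @lebesgue_measure_itv R `[a, c]; rewrite /= lte_fin => ->.
rewrite EFinM; congr (_ * _)%E.
case: ltP => // ca; suff -> : c = a by rewrite subrr.
by apply/eqP; rewrite eq_le ac ca.
Qed.

Let close_test (f g : R -> R) (dlt : R) : measurable_fun [set: R] f -> measurable_fun [set: R] g ->
    (forall x, 0 <= f x) -> (forall x, 0 <= g x) -> (forall x, `|f x - g x| <= dlt) -> 0 <= dlt ->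
  (\int[leb]_x (h x * f x)%:E <= \int[leb]_x (h x * g x)%:E + (dlt * (c - a))%:E)%E.
Proof.
move=> mf mg f0 g0 fg d0; rewrite -integral_strip//.
have ms : measurable_fun [set: R] (fun x => (dlt * \1_(`[a, c]%classic) x)%:E).
  apply/measurable_EFinP/measurable_funM; first exact: measurable_cst.
  by apply: measurable_indic; exact: measurable_itv.
have mhg : measurable_fun [set: R] (fun x => (h x * g x)%:E).
  by apply/measurable_EFinP; exact: measurable_funM.
rewrite -ge0_integralD//; last 2 first.
- by move=> x _; rewrite lee_fin mulr_ge0.
- by move=> x _; rewrite lee_fin mulr_ge0// indicE.
apply: ge0_le_integral => //.
- by move=> x _; rewrite lee_fin mulr_ge0.
- by apply/measurable_EFinP; exact: measurable_funM.
- exact: emeasurable_funD.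
- move=> x _; rewrite -EFinD lee_fin indicE.
  have -> : (x \in `[a, c]%classic) = (a <= x <= c).
    by apply/idP/idP; rewrite inE/= in_itv.
  case: (boolP (a <= x <= c)) => [_|/hac ->]; last by rewrite !mul0r mulr0 addr0.
  rewrite mulr1 -lerBlDl -mulrBr (le_trans (ler_norm _))// normrM ger0_norm//.
  by rewrite (le_trans (ler_wpM2l (h0 x) (fg x)))// ler_piMl.
Qed.

(** Both sides are within [err r] of the integral of h against the mixture at r: one by the
    Lipschitz property of h, the other by uniform convergence of the mixtures on the bounded support
    of h. Then r tends to 1. *)
Lemma test_dens : (\int[leb]_x (h x * dens x)%:E = (Ex P (fun w => h (U w)))%:E)%E.
Proof.
pose C : R := L * (k + 2) + 2 * K * (c - a).
have ca0 : 0 <= c - a by rewrite subr_ge0.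
have C0 : 0 <= C.
  by apply: addr_ge0; apply: mulr_ge0 => //; [exact: addr_ge0|exact: mulr_ge0].
pose err r := lip_err r + 2 * K * Num.sqrt (1 - r) * (c - a).
have main r : 2^-1 <= r -> r < 1 ->
    (\int[leb]_x (h x * dens x)%:E <= (Ex P (fun w => h (U w)))%:E + (err r)%:E)%E /\
    ((Ex P (fun w => h (U w)))%:E <= \int[leb]_x (h x * dens x)%:E + (err r)%:E)%E.
  move=> r2 rl; have r1 : -1 < r < 1 by lra.
  have d0 : 0 <= 2 * K * Num.sqrt (1 - r) by rewrite !mulr_ge0.
  have mm : measurable_fun [set: R] (mix P U r) := measurable_mixr P bU r.
  have m0 x : 0 <= mix P U r x by rewrite ltW// (mix_gt0 P mU).
  have fg x := dens_mix_le x r2 rl.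
  split.
    apply: le_trans (close_test measurable_dens mm dens_ge0 m0 fg d0) _.
    apply: le_trans (leeD2r _ (test_mix_le r2 rl)) _.
    by rewrite /err -!EFinD lee_fin addrA.
  apply: le_trans (test_mix_ge r2 rl) _.
  have gf x : `|mix P U r x - dens x| <= 2 * K * Num.sqrt (1 - r) by rewrite distrC.
  apply: le_trans (leeD2r _ (close_test mm measurable_dens m0 dens_ge0 gf d0)) _.
  by rewrite -addeA -EFinD [X in X%:E]addrC.
have small e : 0 < e -> exists r, [/\ 2^-1 <= r, r < 1 & err r <= e].
  move=> e0; have C1 : 0 < C + 1 by rewrite ltr_wpDl.
  (* With r = 1 - t^2 one has sqrt (1 - r) = t and sg r <= 2 t, so the error is at most t C. *)
  pose t : R := Num.min 2^-1 (e / (C + 1)).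
  have t0 : 0 < t by rewrite lt_min invr_gt0 ltr0n divr_gt0.
  have t2 : t <= 2^-1 by rewrite ge_min lexx.
  have te : t * (C + 1) <= e by rewrite -ler_pdivlMr// ge_min lexx orbT.
  exists (1 - t ^+ 2); split; [nra|by rewrite ltrBlDr ltrDl exprn_gt0|].
  rewrite /err /lip_err /sg subKr sqrtr_sqr (ger0_norm (ltW t0)).
  have s2 : Num.sqrt (1 - (1 - t ^+ 2) ^+ 2) <= 2 * t.
    rewrite -[leRHS]ger0_norm ?mulr_ge0 ?(ltW t0)// -sqrtr_sqr ler_sqrt ?sqr_ge0//.
    by have := sqr_ge0 t; nra.
  have tk : t ^+ 2 * k <= t * k.
    by rewrite ler_wpM2r// expr2 ler_piMl ?(ltW t0)//; lra.
  have l1 : L * (t ^+ 2 * k + Num.sqrt (1 - (1 - t ^+ 2) ^+ 2)) <= L * (t * k + 2 * t).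
    by rewrite ler_wpM2l// lerD.
  apply: le_trans te; rewrite [leRHS]mulrDr mulr1.
  apply: (@le_trans _ _ (t * C)); last by rewrite lerDl ltW.
  apply: le_trans (lerD l1 (lexx _)) _; apply: le_of_eq.
  by rewrite /C; ring.
apply/eqP; rewrite eq_le; apply/andP; split; apply/lee_addgt0Pr => e /small[r [r2 rl re]].
  by apply: le_trans (main r r2 rl).1 _; rewrite leeD2l.
by apply: le_trans (main r r2 rl).2 _; rewrite leeD2l.
Qed.

End LipschitzTest.
End DensityLimit.

(** * Lipschitz approximation of half-open intervals *)

Section Trapezoid.
Context (R : realType).
Variables (a c : R).
Hypothesis ac : a < c.

(** The slopes lie just to the right of a and just to the right of c, so the pointwise limit is the
    indicator of ]a, c], while all supports stay in [a, c + 1]. *)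
Definition trapz (k : nat) (x : R) : R :=
  Num.max 0 (Num.min (Num.min 1 (k.+1%:R * (x - a))) (1 - k.+1%:R * (x - c))).

Lemma measurable_trapz k : measurable_fun [set: R] (trapz k).
Proof.
apply: measurable_maxr; first exact: measurable_cst.
apply: measurable_minr.
  apply: measurable_minr; first exact: measurable_cst.
  by apply: measurable_funM; [exact: measurable_cst|apply: measurable_funB => //; exact: measurable_cst].
apply: measurable_funB; first exact: measurable_cst.
by apply: measurable_funM; [exact: measurable_cst|apply: measurable_funB => //; exact: measurable_cst].
Qed.

Lemma trapz_ge0 k x : 0 <= trapz k x.
Proof. by rewrite /trapz le_max lexx. Qed.

Lemma trapz_le1 k x : trapz k x <= 1.
Proof. by rewrite /trapz ge_max ler01/= !ge_min lexx. Qed.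

Lemma trapz_out k x : ~~ (a <= x <= c + 1) -> trapz k x = 0.
Proof.
have k1 : 1 <= k.+1%:R :> R by rewrite ler1n.
rewrite negb_and -!ltNge => /orP[h|h]; apply/eqP; rewrite eq_le trapz_ge0 andbT /trapz ge_max lexx/=.
  rewrite !ge_min; apply/orP; left; apply/orP; right.
  by rewrite mulr_ge0_le0//; lra.
rewrite !ge_min; apply/orP; right.
by have : 1 * 1 <= k.+1%:R * (x - c) by [apply: ler_pM => //; lra]; lra.
Qed.

Lemma trapz_lipschitz k x y : trapz k x <= trapz k y + k.+1%:R * `|x - y|.
Proof.
have K0 : 0 < k.+1%:R :> R by rewrite ltr0n.
set K := k.+1%:R in K0 *; set D := K * `|x - y|.
have D0 : 0 <= D by rewrite mulr_ge0// ltW.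
have D1 : K * (x - a) <= K * (y - a) + D.
  by rewrite -mulrDr ler_pM2l//; have := ler_norm (x - y); lra.
have D2 : 1 - K * (x - c) <= 1 - K * (y - c) + D.
  rewrite -addrA lerD2l -lerN2 opprK opprD opprK -mulrBr ler_pM2l//.
  by have := ler_norm (y - x); rewrite distrC; lra.
rewrite /trapz -/K ge_max; apply/andP; split.
  by rewrite addr_ge0// le_max lexx.
rewrite -lerBlDr le_max; apply/orP; right; rewrite !le_min; apply/andP; split.
  apply/andP; split; rewrite lerBlDr !ge_min.
    by apply/orP; left; apply/orP; left; rewrite lerDl.
  by apply/orP; left; apply/orP; right.
by rewrite lerBlDr !ge_min; apply/orP; right.
Qed.

Lemma trapz_near x : \forall k \near \oo, trapz k x = \1_(`]a, c]%classic) x.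
Proof.
rewrite indicE.
have -> : (x \in `]a, c]%classic) = (a < x <= c).
  by apply/idP/idP; rewrite inE/= in_itv.
have [xa|xa] := leP x a.
  apply: nearW => k; apply/eqP; rewrite eq_le trapz_ge0 andbT /trapz ge_max lexx/= !ge_min.
  by apply/orP; left; apply/orP; right; rewrite mulr_ge0_le0// subr_le0.
have [xc|xc] /= := leP x c.
  near=> k; have kx : (x - a)^-1 <= k%:R by near: k; exact: nbhs_infty_ger.
  have h1 : 1 <= k.+1%:R * (x - a).
    rewrite -ler_pdivrMr ?subr_gt0// mul1r (le_trans kx)//.
    by rewrite ler_nat.
  have h2 : 1 <= 1 - k.+1%:R * (x - c).
    by rewrite lerBrDr gerDl mulr_ge0_le0// subr_le0.
  by rewrite /trapz (min_idPl h1) (min_idPl h2) (max_idPr ler01).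
near=> k; have kx : (x - c)^-1 <= k%:R by near: k; exact: nbhs_infty_ger.
have h1 : 1 <= k.+1%:R * (x - c).
  by rewrite -ler_pdivrMr ?subr_gt0// mul1r (le_trans kx)// ler_nat.
apply/eqP; rewrite eq_le trapz_ge0 andbT /trapz ge_max lexx/= !ge_min.
by apply/orP; right; lra.
Unshelve. all: by end_near. Qed.

End Trapezoid.

Section Density.
Context d (W : measurableType d) (R : realType) (P : probability W R).
Notation leb := (@lebesgue_measure R).
Variables (U : W -> R) (K : R).
Hypothesis bU : bmf U.
Hypothesis K0 : 0 <= K.
Hypothesis dmixK : forall r x, 2^-1 <= r -> r < 1 -> `|dmix P U r x| <= K / Num.sqrt (1 - r).

Let mU : measurable_fun [set: W] U := proj1 bU.
Notation f1 := (dens P U).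
Let mf1 : measurable_fun [set: R] f1 := measurable_dens bU K0 dmixK.
Let f10 x : 0 <= f1 x := dens_ge0 bU K0 dmixK x.

(** Dominated convergence on both sides of [test_dens] for the trapezoidal functions; on the
    Lebesgue side the dominating function is an upper bound of the density on [a, c + 1]. *)
Lemma dens_itv (a c : R) : a < c ->
  P (U @^-1` `]a, c]%classic) = (\int[leb]_(x in `]a, c]%classic) (f1 x)%:E)%E.
Proof.
move=> ac; have [_ [k Uk]] := bU; have [M fM] := dens_le bU K0 dmixK.
have test n : (\int[leb]_x (trapz a c n x * f1 x)%:E = (Ex P (fun w => trapz a c n (U w)))%:E)%E.
  apply: (@test_dens _ _ _ _ U K bU K0 dmixK (trapz a c n) a (c + 1) n.+1%:R) => //.
  - exact: measurable_trapz.
  - exact: trapz_ge0.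
  - exact: trapz_le1.
  - lra.
  - by move=> x; exact: trapz_out.
  - by move=> x y; exact: trapz_lipschitz.
have bt n : bmf (fun w => trapz a c n (U w)).
  split; first exact: (measurableT_comp (measurable_trapz a c n) mU).
  by exists 1 => w; rewrite ger0_norm ?trapz_ge0 ?trapz_le1.
have mI : measurable `]a, c]%classic by exact: measurable_itv.
have lim1 : (\int[P]_w (trapz a c n (U w))%:E @[n --> \oo] --> \int[P]_w (\1_(`]a, c]%classic) (U w))%:E)%E.
  apply: (@dominated_cvg _ _ _ P setT measurableT _ _ (cst 1%E)) => //.
  - by move=> n; apply/measurable_EFinP; exact: (proj1 (bt n)).
  - move=> w _; apply: cvg_near_cst; near=> n; congr EFin.
    by near: n; exact: trapz_near.
  - exact/bmf_int/(bmf_cst _ 1).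
  - by move=> n w _; rewrite /= lee_fin ger0_norm ?trapz_ge0 ?trapz_le1.
have lim2 : (\int[leb]_x (trapz a c n x * f1 x)%:E @[n --> \oo] -->
    \int[leb]_x (\1_(`]a, c]%classic) x * f1 x)%:E)%E.
  apply: (@dominated_cvg _ _ _ leb setT measurableT _ _ (fun x => (M * \1_(`[a, c + 1]%classic) x)%:E)) => //.
  - by move=> n; apply/measurable_EFinP/measurable_funM => //; exact: measurable_trapz.
  - move=> x _; apply: cvg_near_cst; near=> n; congr (_ * _)%:E.
    by near: n; exact: trapz_near.
  - apply/integrableP; split.
      apply/measurable_EFinP/measurable_funM; first exact: measurable_cst.
      by apply: measurable_indic; exact: measurable_itv.
    have M0 : 0 <= M by exact: le_trans (f10 0) (fM 0).
    under eq_integral do rewrite gee0_abs ?lee_fin ?mulr_ge0// ?indicE//.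
    under eq_integral do rewrite -indicE.
    by rewrite (integral_strip (a := a) (c := c + 1)) ?ltry//; lra.
  - move=> n x _; rewrite /= lee_fin normrM ger0_norm ?trapz_ge0// (ger0_norm (f10 x)).
    rewrite indicE; have -> : (x \in `[a, c + 1]%classic) = (a <= x <= c + 1).
      by apply/idP/idP; rewrite inE/= in_itv.
    have [_|/trapz_out ->] := boolP (a <= x <= c + 1); last by rewrite mul0r mulr0.
    by rewrite mulr1 (le_trans _ (fM x))// ler_piMl// trapz_le1.
have E n : (\int[P]_w (trapz a c n (U w))%:E = \int[leb]_x (trapz a c n x * f1 x)%:E)%E.
  by rewrite test (EFin_Ex (bmf_int P (bt n))).
move: lim1; rewrite (_ : (fun n => \int[P]_w _)%E = (fun n => \int[leb]_x (trapz a c n x * f1 x)%:E)%E); last first.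
  by apply/funext => n; exact: E.
move=> lim1; have := cvg_unique _ lim1 lim2.
have -> : (\int[P]_w (\1_(`]a, c]%classic) (U w))%:E = P (U @^-1` `]a, c]%classic))%E.
  rewrite -[X in P X]setIT -integral_indic//.
  by rewrite -[X in measurable X]setTI; exact: mU.
move=> ->//; rewrite [RHS]integral_mkcond; apply: eq_integral => x _.
by rewrite indicE patchE; case: ifP => _; rewrite ?mul1r ?mul0r.
Unshelve. all: by end_near. Qed.

(** Half-open intervals form a generating pi-system on which the law and the measure of density [f1]
    agree by [dens_itv]; the intervals [g n] exhaust the line with finite mass. *)
Lemma is_density_dens : is_density P U f1.
Proof.
split => // A mA.
have mf1E : measurable_fun [set: R] (EFin \o f1) by exact/measurable_EFinP.
have f1E0 x : (0 <= (EFin \o f1) x)%E by rewrite lee_fin.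
pose lam : set (measurableTypeR R) -> \bar R := fun A => (\int[leb]_(x in A) (f1 x)%:E)%E.
have lam0 : lam set0 = 0%E by rewrite /lam integral_set0.
have lam_ge0 B : (0 <= lam B)%E by apply: integral_ge0 => x _; rewrite lee_fin.
have lamS : semi_sigma_additive lam.
  exact: (@semi_sigma_additive_nng_induced _ (measurableTypeR R) R leb (EFin \o f1) mf1E f1E0).
pose lamM : {measure set (measurableTypeR R) -> \bar R} :=
  HB.pack lam (isMeasure.Build _ _ _ lam lam0 lam_ge0 lamS).
pose Y : {RV P >-> measurableTypeR R} :=
  HB.pack U (isMeasurableFun.Build _ _ W (measurableTypeR R) U mU).
pose muM : {measure set (measurableTypeR R) -> \bar R} := distribution P Y.
pose g (n : nat) : set R := `]- n%:R, n%:R]%classic.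
suff : muM A = lamM A by [].
apply: (@measure_unique _ R (measurableTypeR R) (@ocitv R) g) => //.
- exact: ocitvI.
- by move=> n; exists (- n%:R, n%:R).
- apply/seteqP; split => // x _; have [n xn] : exists n : nat, `|x| < n%:R.
    by exists (Num.truncn `|x|).+1; exact: truncnS_gt.
  exists n => //; rewrite /g/= in_itv/=.
  by move: xn; rewrite ltr_norml => /andP[-> /ltW].
- move=> _ [[a c] _ <-] /=; have [ac|ca] := ltP a c; first exact: dens_itv.
  by rewrite set_itv_ge ?bnd_simp -?leNgt// lam0 measure0.
- move=> n; apply: le_lt_trans (ltry 1).
  by apply: (probability_le1 (distribution P Y)); exact: measurable_itv.
Qed.

(** [density] is an arbitrary choice, but a genuine density because one exists; two densities have
    the same integral over every Borel set. *)
Lemma density_ae : {ae leb, forall x, density P U x = f1 x}.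
Proof.
have [md d0 dE] : is_density P U (density P U).
  by apply: (@getPex _ (is_density P U)); exists f1; exact: is_density_dens.
have [_ _ f1E] := is_density_dens.
have : ae_eq leb setT (EFin \o density P U) (EFin \o f1).
  apply: integral_ae_eq => //.
  - apply/integrableP; split; first exact/measurable_EFinP.
    have := dE setT measurableT; under eq_integral do rewrite /= ger0_norm//.
    by rewrite preimage_setT probability_setT => <-; rewrite ltry.
  - exact/measurable_EFinP.
  - by move=> A _ mA; rewrite /= -dE// f1E.
by apply: filterS => x /= /(_ I) [].
Qed.

End Density.

(** * The Hellinger bounds *)

Section Hellinger.
Context d (W : measurableType d) (R : realType) (P : probability W R).
Notation leb := (@lebesgue_measure R).
Variables (U : W -> R) (s I : R -> R).
Hypothesis bU : bmf U.
Hypothesis scU : is_score P U s.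
Hypothesis sL2 : in_Lp_of P U 2 s.
Hypothesis sc2U : is_score2 P U I.
Hypothesis IL2 : in_Lp_of P U 2 I.

Let mU : measurable_fun [set: W] U := proj1 bU.
Let L := score_norm P U s I.

Lemma score_norm_gt0 : 0 < L.
Proof. by rewrite /L /score_norm ltr_wpDl ?pnorm_ge0// ltr_pwDl// pnorm_ge0. Qed.

Let K := 200 * Ex P (fun w => `|tot U s I w|).
Let K0 : 0 <= K.
Proof. by rewrite /K mulr_ge0//; apply: Ex_ge0 => w; exact: normr_ge0. Qed.

(** In [dmix_score] the factor 1 / r is at most 2 and the kernel is at most 100 / sqrt (1 - r^2),
    hence 200 in [K]. *)
Lemma dmix_le_sqrt r x : 2^-1 <= r -> r < 1 -> `|dmix P U r x| <= K / Num.sqrt (1 - r).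
Proof.
move=> r2 rl; have r0 : 0 < r by lra.
have r1 : -1 < r < 1 by lra.
have r01 : 0 < r < 1 by rewrite r0.
have bg : bmf (fun w => gk r (U w) x) := @bmf_gk _ _ R U mU r x r1.
have it := integrable_tot bU scU sc2U.
have gle w : `|gk r (U w) x| <= 100 / Num.sqrt (1 - r).
  have rc : 0 <= r < 1 by lra.
  have rr : - r <= r <= r by lra.
  apply: le_trans (gk_le (U w) x rc rr) _; rewrite ler_wpM2l//.
  rewrite lef_pV2 ?posrE ?sqrtr_gt0 ?subr_gt0//; last by rewrite -subr_gt0 onem_sqr_gt0.
  by rewrite ler_wsqrtr// lerD2l lerN2 expr2 ler_piMl ?ltW.
rewrite (dmix_score bU scU sc2U x r01) normrM normrN [`|r^-1|]ger0_norm ?invr_ge0 ?(ltW r0)//.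
have h : `|Ex P (fun w => tot U s I w * gk r (U w) x)| <=
    Ex P (fun w => `|tot U s I w|) * (100 / Num.sqrt (1 - r)).
  apply: le_trans (norm_Ex (integrableM_bmf it bg)) _.
  have ia : P.-integrable [set: W] (EFin \o (fun w => `|tot U s I w|)).
    by have := integrable_abse it.
  rewrite [leRHS]mulrC -ExZ//; apply: le_Ex.
  - by have := integrable_abse (integrableM_bmf it bg).
  - have := integrableM_bmf ia (bmf_cst W (100 / Num.sqrt (1 - r))).
    by apply: eq_integrable => // w _ /=; rewrite mulrC.
  - by move=> w; rewrite normrM mulrC ler_wpM2r.
have rV : r^-1 <= 2 by rewrite invf_ple ?posrE.
apply: le_trans (ler_wpM2l _ h) _; first by rewrite invr_ge0 ltW.
rewrite (_ : K / _ = 2 * (Ex P (fun w => `|tot U s I w|) * (100 / Num.sqrt (1 - r)))); last first.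
  by rewrite /K; field; rewrite gt_eqF// sqrtr_gt0 subr_gt0.
rewrite ler_wpM2r// mulr_ge0//; first by apply: Ex_ge0 => w; exact: normr_ge0.
Qed.

Notation f1 := (dens P U).
Let mf1 : measurable_fun [set: R] f1 := measurable_dens bU K0 dmix_le_sqrt.
Let f10 x : 0 <= f1 x := dens_ge0 bU K0 dmix_le_sqrt x.
Let m0 (r x : R) : -1 < r < 1 -> 0 < mix P U r x := mix_gt0 P mU x.
Let mm r : measurable_fun [set: R] (mix P U r) := measurable_mixr P bU r.

Lemma score_path a b : 0 < a -> a < b -> b < 1 ->
  (\int[leb]_x ((Num.sqrt (mix P U b x) - Num.sqrt (mix P U a x)) ^+ 2)%:E <=
  (((L * ln b - L * ln a) / 2) ^+ 2)%:E)%E.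
Proof.
move=> a0 ab b1; have [_ [k Uk]] := bU.
have r0 r : a <= r <= b -> 0 < r by move=> /andP[ar _]; exact: lt_le_trans a0 ar.
apply: (@mix_path _ _ R P U k mU Uk (fun r => L / r) (fun r => L * ln r)) => //.
- lra.
- by move=> r /r0 rr; rewrite divr_gt0// score_norm_gt0.
- move=> r /r0 rr; have dl := is_derive1_ln rr; apply: is_derive_eq.
  by [].
- move=> r /r0 rr; apply: cvgM; first exact: cvg_cst.
  by apply: cvgV; [rewrite gt_eqF|exact: cvg_id].
- by apply: measurable_funM; [exact: measurable_cst|apply: measurable_funV].
- move=> r rab; have rr := r0 r rab; apply: score_bound => //.
  by rewrite rr; case/andP: rab => _ /le_lt_trans; exact.
Qed.

Lemma limn_einf_le (v : (\bar R)^nat) (c : \bar R) : (forall n, (v n <= c)%E) -> (limn_einf v <= c)%E.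
Proof.
move=> vc; rewrite limn_einf_lim; apply: lime_le; first exact: is_cvg_einfs.
apply: nearW => n; apply: le_trans (vc n); apply: ereal_inf_lbound.
by exists n => //=.
Qed.

(** Fatou's lemma along r = rn n: the bound of [score_path] stays below L (- ln a) / 2 because ln is
    nonpositive on (0, 1). *)
Lemma score_path_limit a : 0 < a -> a < 1 ->
  (\int[leb]_x ((Num.sqrt (f1 x) - Num.sqrt (mix P U a x)) ^+ 2)%:E <= ((L * (- ln a) / 2) ^+ 2)%:E)%E.
Proof.
move=> a0 a1.
(* Beyond the midpoint of a and 1, so that the shifted sequence is strictly larger than a. *)
have [N _ HN] : \forall n \near \oo, (a + 1) / 2 <= rn R n by apply: rn_near; lra.
have aN n : a < rn R (n + N) by have := HN (n + N)%N (leq_addl _ _); lra.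
pose F n x := ((Num.sqrt (mix P U (rn R (n + N)) x) - Num.sqrt (mix P U a x)) ^+ 2)%:E.
have cF x : F n x @[n --> \oo] --> ((Num.sqrt (f1 x) - Num.sqrt (mix P U a x)) ^+ 2)%:E.
  apply: cvg_EFin; first by apply: nearW.
  have c1 : mix P U (rn R (n + N)) x @[n --> \oo] --> f1 x.
    by rewrite (cvg_shiftn N (fun n => mix P U (rn R n) x)); exact: cvg_mix bU K0 dmix_le_sqrt x.
  have c2 : Num.sqrt (mix P U (rn R (n + N)) x) @[n --> \oo] --> Num.sqrt (f1 x).
    by apply: continuous_cvg c1; exact: sqrt_continuous.
  have c3 : Num.sqrt (mix P U (rn R (n + N)) x) - Num.sqrt (mix P U a x) @[n --> \oo] -->
      Num.sqrt (f1 x) - Num.sqrt (mix P U a x).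
    by apply: cvgB => //; exact: cvg_cst.
  by rewrite expr2; exact: (cvgM c3 c3).
have mF n : measurable_fun [set: R] (F n).
  apply/measurable_EFinP/measurable_funX/measurable_funB; apply: measurable_fun_sqrt; exact: mm.
have F0 n x : setT x -> (0 <= F n x)%E by move=> _; rewrite lee_fin sqr_ge0.
have := @fatou _ _ _ leb setT measurableT F mF F0.
have -> : (\int[leb]_x limn_einf (F^~ x) =
    \int[leb]_x ((Num.sqrt (f1 x) - Num.sqrt (mix P U a x)) ^+ 2)%:E)%E.
  by apply: eq_integral => x _; rewrite (cvg_limn_einf_sup (cF x)).1.
move/le_trans; apply; apply: limn_einf_le => n.
apply: le_trans (score_path a0 (aN n) (rn_lt1 _ _)) _; rewrite lee_fin.
have l1 : ln (rn R (n + N)) <= 0 by apply: ln_le0; exact/ltW/rn_lt1.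
have l2 : ln a <= ln (rn R (n + N)).
  by rewrite ler_ln ?posrE ?(ltW (aN n))// (lt_trans a0).
have L0 := ltW score_norm_gt0.
rewrite lerXn2r// ?nnegrE.
- by rewrite divr_ge0// -mulrBr mulr_ge0// subr_ge0.
- by rewrite divr_ge0// mulr_ge0// oppr_ge0 ln_le0// ltW.
- by rewrite ler_wpM2r// -mulrBr ler_wpM2l// lerBlDr; lra.
Qed.

Lemma mix0E x : mix P U 0 x = normal_pdf 0 1 x.
Proof.
rewrite /mix -[RHS](Ex_cst P); congr Ex; apply/funext => w.
rewrite gkE; first by rewrite mul0r /sg expr0n subr0 sqrtr1.
by rewrite ltrN10 ltr01.
Qed.

Lemma hellingerZE : hellingerZ P U = Num.sqrt (2^-1 *
  fine (\int[leb]_x ((Num.sqrt (f1 x) - Num.sqrt (normal_pdf 0 1 x)) ^+ 2)%:E)%E).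
Proof.
have [md _ _] : is_density P U (density P U).
  apply: (@getPex _ (is_density P U)); exists f1.
  exact: (is_density_dens bU K0 dmix_le_sqrt).
have mn : measurable_fun [set: R] (normal_pdf (0 : R) 1) by exact: measurable_normal_pdf.
rewrite /hellingerZ /Rintegral; congr (Num.sqrt (_ * fine _)); apply: ae_eq_integral => //.
- by apply/measurable_EFinP/measurable_funX/measurable_funB; exact: measurable_fun_sqrt.
- by apply/measurable_EFinP/measurable_funX/measurable_funB; exact: measurable_fun_sqrt.
- have F := ae_filter_ringOfSetsType leb.
  apply: (@filterS _ _ F _ _ _ (density_ae bU K0 dmix_le_sqrt)) => x /= -> _.
  by [].
Qed.

Lemma hellinger_le (A : R) : 0 <= A ->
  (\int[leb]_x ((Num.sqrt (f1 x) - Num.sqrt (normal_pdf 0 1 x)) ^+ 2)%:E <= (A ^+ 2)%:E)%E ->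
  hellingerZ P U <= A / Num.sqrt 2.
Proof.
move=> A0 h; rewrite hellingerZE.
have -> : A / Num.sqrt 2 = Num.sqrt (2^-1 * A ^+ 2).
  by rewrite sqrtrM// sqrtr_sqr ger0_norm// sqrtrV// mulrC.
rewrite ler_wsqrtr// ler_wpM2l// -[leRHS]/(fine (A ^+ 2)%:E) fine_le//.
rewrite ge0_fin_numE; first exact: le_lt_trans h (ltry _).
by apply: integral_ge0 => x _; rewrite lee_fin sqr_ge0.
Qed.

Lemma hellinger_le1 : hellingerZ P U <= 1.
Proof.
have [_ _ f1E] := is_density_dens bU K0 dmix_le_sqrt.
have s20 : Num.sqrt 2 != 0 :> R by rewrite gt_eqF// sqrtr_gt0.
rewrite -(divff s20); apply: hellinger_le => //.
have mn : measurable_fun [set: R] (normal_pdf (0 : R) 1) by exact: measurable_normal_pdf.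
have n0 x : 0 <= normal_pdf 0 1 x :> R by exact: normal_pdf_ge0.
rewrite sqr_sqrtr//.
apply: (@le_trans _ _ (\int[leb]_x ((f1 x)%:E + (normal_pdf 0 1 x)%:E))%E).
  apply: ge0_le_integral => //.
  - by move=> x _; rewrite lee_fin sqr_ge0.
  - by apply/measurable_EFinP/measurable_funX/measurable_funB; exact: measurable_fun_sqrt.
  - by apply: emeasurable_funD; exact/measurable_EFinP.
  - move=> x _; rewrite -EFinD lee_fin sqrrB !sqr_sqrtr//.
    by rewrite addrAC gerDl oppr_le0 mulrn_wge0// mulr_ge0 ?sqrtr_ge0.
rewrite ge0_integralD//; last 4 first.
- by move=> x _; rewrite lee_fin.
- exact/measurable_EFinP.
- by move=> x _; rewrite lee_fin.
- exact/measurable_EFinP.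
rewrite -(f1E setT measurableT) preimage_setT probability_setT integral_normal_pdf ?oner_neq0//.
Qed.

(** The triangle inequality in L^2 of Lebesgue measure, as [wnorm_leD] with constant weight 1; at r
    = 0 the mixture is the standard normal density. *)
Lemma hellinger_combine (a B : R) : 0 < a -> a < 1 -> 0 < B ->
    (\int[leb]_x ((Num.sqrt (mix P U a x) - Num.sqrt (mix P U 0 x)) ^+ 2)%:E <= (B ^+ 2)%:E)%E ->
  hellingerZ P U <= (L * (- ln a) / 2 + B) / Num.sqrt 2.
Proof.
move=> a0 a1 B0 hB.
have la : 0 < - ln a by rewrite oppr_gt0 ln_lt0// a0.
have A0 : 0 < L * (- ln a) / 2 by rewrite divr_gt0// mulr_gt0// score_norm_gt0.
apply: hellinger_le; first by rewrite addr_ge0// ltW.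
have m1 : measurable_fun [set: R] (fun=> 1 : R) by exact: measurable_cst.
have msq (f g : R -> R) : measurable_fun [set: R] f -> measurable_fun [set: R] g ->
    measurable_fun [set: R] (fun x => Num.sqrt (f x) - Num.sqrt (g x)).
  by move=> mf mg; apply: measurable_funB; exact: measurable_fun_sqrt.
have W1 : wnorm_le (fun=> 1) (fun x => Num.sqrt (f1 x) - Num.sqrt (mix P U a x)) (L * (- ln a) / 2).
  split; first exact: msq.
  by under eq_integral do rewrite divr1; exact: score_path_limit.
have W2 : wnorm_le (fun=> 1) (fun x => Num.sqrt (mix P U a x) - Num.sqrt (mix P U 0 x)) B.
  by split; [exact: msq|under eq_integral do rewrite divr1].
have [_] := wnorm_leD m1 (fun=> ltr01) A0 B0 W1 W2.
apply: le_trans; apply: le_of_eq; apply: eq_integral => x _.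
by rewrite divr1 mix0E addrA subrK.
Qed.

(* The path [0, 1 - rho] is controlled by the Stein bound, [1 - rho, 1] by the scores. *)
Lemma hellinger_two_paths (a1 b1 rho : R) : 0 < rho -> rho < 1 -> 0 < a1 -> 0 < b1 ->
    (forall r, 0 <= r <= 1 - rho -> (\int[leb]_x (dmix P U r x ^+ 2 / mix P U r x)%:E <=
      ((a1 / (1 - r) + b1 / (1 - r) ^+ 2) ^+ 2)%:E)%E) ->
  hellingerZ P U <= (2 * Num.sqrt 2)^-1 * (L * (- ln (1 - rho)) + a1 * (- ln rho) + b1 / rho).
Proof.
move=> p0 p1 a10 b10 H; have [_ [k Uk]] := bU.
have lp : 0 < - ln rho by rewrite oppr_gt0 ln_lt0// p0.
have ip : 1 < rho^-1 by rewrite invf_gt1.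
pose Om r := a1 * (- ln (1 - r)) + b1 * (1 - r)^-1.
pose B := (Om (1 - rho) - Om 0) / 2.
have EB : B = (a1 * (- ln rho) + b1 * (rho^-1 - 1)) / 2.
  by rewrite /B /Om subKr subr0 ln1 invr1 oppr0 mulr0 add0r; ring.
have B0 : 0 < B.
  by rewrite EB divr_gt0// addr_gt0// mulr_gt0// subr_gt0.
have r0 r : 0 <= r <= 1 - rho -> 0 < 1 - r by move=> /andP[_ h]; lra.
have hB : (\int[leb]_x ((Num.sqrt (mix P U (1 - rho) x) - Num.sqrt (mix P U 0 x)) ^+ 2)%:E <= (B ^+ 2)%:E)%E.
  apply: (@mix_path _ _ R P U k mU Uk (fun r => a1 / (1 - r) + b1 / (1 - r) ^+ 2) Om) => //.
  - lra.
  - lra.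
  - by move=> r /r0 rr; rewrite addr_gt0// divr_gt0// exprn_gt0.
  - move=> r /r0 rr.
    have d1 : is_derive r 1 (fun r : R => 1 - r) (-1).
      by rewrite -[X in is_derive _ _ _ X]add0r; apply: is_deriveB.
    have dl : is_derive r 1 (fun r => ln (1 - r)) ((1 - r)^-1 * -1).
      exact: (@is_derive1_comp R (@ln R) (fun r => 1 - r) r _ _ (is_derive1_ln rr) d1).
    have rn : 1 - r != 0 by rewrite gt_eqF.
    have dv := @is_deriveV R (fun r : R => 1 - r) r (-1) 1 rn d1.
    rewrite /Om; apply: is_derive_eq; rewrite /GRing.scale/=.
    by field.
  - move=> r /r0 rr.
    have c1 : (fun r : R => 1 - r) y @[y --> r] --> 1 - r by apply: cvgB; [exact: cvg_cst|exact: cvg_id].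
    apply: cvgD; apply: cvgM; try exact: cvg_cst; apply: cvgV.
    + by rewrite gt_eqF.
    + exact: c1.
    + by rewrite gt_eqF// exprn_gt0.
    + by rewrite expr2; under eq_fun do rewrite expr2; exact: cvgM.
  - have mr : measurable_fun [set: R] (fun r : R => 1 - r).
      by apply: measurable_funB => //; exact: measurable_cst.
    apply: measurable_funD; apply: measurable_funM; try exact: measurable_cst.
      exact: measurable_funV.
    by apply: measurable_funV; exact: measurable_funX.
have p1' : 1 - rho < 1 by lra.
have p0' : 0 < 1 - rho by lra.
apply: le_trans (hellinger_combine p0' p1' B0 hB) _.
have s0 : 0 < Num.sqrt 2 :> R by rewrite sqrtr_gt0.
rewrite (_ : (2 * Num.sqrt 2)^-1 * _ =
  ((L * (- ln (1 - rho)) + a1 * (- ln rho) + b1 / rho) / 2) / Num.sqrt 2); last first.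
  by field; rewrite !gt_eqF.
rewrite ler_wpM2r ?invr_ge0 ?(ltW s0)// EB.
(* The integral of b1 / (1 - r)^2 gives b1 (1 / rho - 1); the negative part is dropped. *)
by rewrite -mulrDl ler_wpM2r// mulrBr mulr1 -!addrA !lerD2l gerDl oppr_le0 ltW.
Qed.

End Hellinger.

(** * Comparison of the constants *)

Section Numerics.
Context (R : realType).
Implicit Types t v q l m b : R.

Lemma ln_ge_onem_inv t : 0 < t -> 1 - t^-1 <= ln t.
Proof.
move=> t0; have i0 : 0 < t^-1 by rewrite invr_gt0.
have : ln (1 + (t^-1 - 1)) <= t^-1 - 1 by apply: le_ln1Dx; lra.
by rewrite [1 + _]addrC subrK lnV ?posrE//; lra.
Qed.

(** exp (-1/8) >= 7/8 gives exp (1/8) <= 8/7; the sixteenth power is taken by repeated squaring,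
    rounding up each time. *)
Lemma expR2_le12 : expR 2 <= 12 :> R.
Proof.
have h : expR (8^-1) <= 8 / 7 :> R.
  have h1 := expR_ge1Dx (- 8^-1 : R).
  have e0 : 0 < expR (8^-1 : R) by exact: expR_gt0.
  move: h1; rewrite expRN -(ler_pM2r e0) mulVf ?gt_eqF//; lra.
have -> : (2 : R) = 16%:R * 8^-1 by field.
rewrite expRM_natl.
apply: (@le_trans _ _ ((8 / 7) ^+ 16)); first by rewrite lerXn2r// nnegrE ?expR_ge0.
rewrite (_ : 16%N = (2 * 8)%N)// exprM.
have h2 : (8 / 7 : R) ^+ 2 <= 131 / 100 by lra.
apply: (@le_trans _ _ ((131 / 100) ^+ 8)); first by rewrite lerXn2r// nnegrE.
rewrite (_ : 8%N = (2 * 4)%N)// exprM.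
have h3 : (131 / 100 : R) ^+ 2 <= 172 / 100 by lra.
apply: (@le_trans _ _ ((172 / 100) ^+ 4)); first by rewrite lerXn2r// nnegrE.
rewrite (_ : 4%N = (2 * 2)%N)// exprM.
have h4 : (172 / 100 : R) ^+ 2 <= 3 by lra.
apply: (@le_trans _ _ (3 ^+ 2)); first by rewrite lerXn2r// nnegrE.
lra.
Qed.

(** 332/25 = 8 * 1.41 + 2 is a rational lower bound of 8 sqrt 2 + 2. Up to 12 the inequality ln t >=
    1 - 1 / t suffices; beyond, ln t >= 2 does, since 2 * 332/25 > 49/2. *)
Lemma ln_lower t : 7 / 5 <= t -> t <= 49 / 2 -> t <= 332 / 25 * ln t.
Proof.
move=> t1 t2; have t0 : 0 < t by lra.
have [t12|t12] := leP t 12.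
  have := ln_ge_onem_inv t0.
  set i := t^-1; have ti : t * i = 1 by rewrite /i divff// gt_eqF.
  move=> h; have : 0 <= (12 - t) * (t - 7 / 5) by rewrite mulr_ge0//; lra.
  move=> hp; have : t <= 332 / 25 * (1 - i); last lra.
  by rewrite -(ler_pM2r t0) mulrBr mulrBl -!mulrA [i * t]mulrC ti; nra.
have h : 2 <= ln t.
  by rewrite -[leLHS]expRK ler_ln ?posrE ?expR_gt0// (le_trans expR2_le12)// ltW.
lra.
Qed.

(** The maximum is 1.4641, at b = 11/10; the decomposition into squares is a certificate adapted to
    that point. *)
Lemma quartic_ge b : 22 / 5 * b ^+ 3 - 3 * b ^+ 4 <= 3 / 2.
Proof.
have h1 := sqr_ge0 (b ^+ 2 - 11 / 15 * b - 2 / 5).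
have h2 := sqr_ge0 (b - 28 / 25).
rewrite -subr_ge0 (_ : _ - _ = 3 * (b ^+ 2 - 11 / 15 * b - 2 / 5) ^+ 2
  + 59 / 75 * (b - 28 / 25) ^+ 2 + (3 / 2 - 12 / 25 - 59 / 75 * (28 / 25) ^+ 2)
  + (59 / 75 * 56 / 25 - 44 / 25) * b); last by field.
nra.
Qed.

(** The path gives b^3 where the target has b^4. By [quartic_ge] the shortfall is at most a constant
    over t, and it is paid by the slack of the logarithmic term, where l m >= 1/8. *)
Lemma main_numerics t v q l m b : 0 < q -> q ^+ 2 = 2 -> 0 < v -> v <= t -> 4^-1 <= l ->
    2^-1 <= m -> 0 < b ->
  (2 * q)^-1 * ((2 * m / v + 48 * m / t / q) * l + 44 / 5 * b ^+ 3 / t) <=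
  3 * b ^+ 4 / (q * t) + 2 * l / (q * v) * m * (16 + 2 * q).
Proof.
move=> q0 q2 v0 vt l0 m0 b0; have t0 := lt_le_trans v0 vt.
have qV : q^-1 = q / 2 by rewrite -[X in _ / X]q2; field; rewrite gt_eqF.
have q32 : q <= 3 / 2 by nra.
set iv := v^-1; set it := t^-1.
have it0 : 0 < it by rewrite invr_gt0.
have iti : it <= iv by rewrite lef_pV2.
rewrite !invfM !mulrA qV -/iv -/it.
have lm : 8^-1 <= l * m by nra.
have key : 0 <= l * m * (iv * (31 / 2 + 2 * q) - 6 * q * it) + it * (3 / 2 * b ^+ 4 - 11 / 5 * b ^+ 3).
  have b1 : - (3 / 4) <= 3 / 2 * b ^+ 4 - 11 / 5 * b ^+ 3 by have := quartic_ge b; lra.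
  have s1 : it * (31 / 2 - 4 * q) <= iv * (31 / 2 + 2 * q) - 6 * q * it.
    have : it * (31 / 2 + 2 * q) <= iv * (31 / 2 + 2 * q) by rewrite ler_wpM2r//; lra.
    by lra.
  have s2 : it * (19 / 2) <= iv * (31 / 2 + 2 * q) - 6 * q * it by nra.
  have s3 : 8^-1 * (it * (19 / 2)) <= l * m * (iv * (31 / 2 + 2 * q) - 6 * q * it).
    by apply: ler_pM => //; rewrite mulr_ge0 ?(ltW it0).
  have s4 : it * - (3 / 4) <= it * (3 / 2 * b ^+ 4 - 11 / 5 * b ^+ 3) by rewrite ler_wpM2l// ltW.
  lra.
rewrite -subr_ge0 (_ : _ - _ = q * (l * m * (iv * (31 / 2 + 2 * q) - 6 * q * it)
  + it * (3 / 2 * b ^+ 4 - 11 / 5 * b ^+ 3))); last first.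
  by field.
by rewrite mulr_ge0// ltW.
Qed.

(** For t <= 49/2 the logarithmic term alone reaches 1 by [ln_lower], as m >= 1/2. Beyond, b^4 >=
    t^2 / 64 and an exponential factor at least 5/4 make the first term at least 15 t / (256 sqrt
    2), which is then larger than 1. *)
Lemma trivial_numerics t v q m b : 0 < q -> q ^+ 2 = 2 -> 0 < v -> v <= t -> q <= t ->
    2^-1 <= m -> 0 < b -> t < 8 * b ^+ 2 ->
  1 <= 3 * b ^+ 4 / (q * t) * expR (2 * b ^+ 2 / t) + 2 * ln t / (q * v) * m * (16 + 2 * q).
Proof.
move=> q0 q2 v0 vt qt m0 b0 tb; have t0 := lt_le_trans v0 vt.
have qV : q^-1 = q / 2 by rewrite -[X in _ / X]q2; field; rewrite gt_eqF.
have q75 : 141 / 100 <= q by nra.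
have q32 : q <= 71 / 50 by nra.
have l0 : 0 <= ln t by rewrite ln_ge0//; lra.
have T2 : 332 / 25 * ln t / t <= 2 * ln t / (q * v) * m * (16 + 2 * q).
  have e1 : 332 / 25 * ln t / t <= 332 / 25 * ln t / v.
    by rewrite ler_wpM2l ?mulr_ge0// lef_pV2.
  apply: le_trans e1 _.
  rewrite (_ : 2 * ln t / (q * v) * m * (16 + 2 * q) = (2 * m * (16 / q + 2)) * ln t / v); last first.
    by field; rewrite !gt_eqF.
  rewrite ler_wpM2r ?invr_ge0 ?(ltW v0)// ler_wpM2r//.
  have : 2 * 2^-1 * (16 / q + 2) <= 2 * m * (16 / q + 2).
    by rewrite ler_wpM2r// ?addr_ge0 ?divr_ge0 ?(ltW q0)// ler_wpM2l.
  by apply: le_trans; rewrite qV; have -> : 16 * (q / 2) + 2 = 8 * q + 2 by [field]; lra.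
have p1 : 0 <= 3 * b ^+ 4 / (q * t) * expR (2 * b ^+ 2 / t).
  by rewrite mulr_ge0 ?expR_ge0// divr_ge0 ?mulr_ge0 ?exprn_ge0// ltW.
have [t24|t24] := leP t (49 / 2).
  have t75 : 7 / 5 <= t by lra.
  have h := ln_lower t75 t24.
  have : 1 <= 332 / 25 * ln t / t by rewrite ler_pdivlMr// mul1r.
  lra.
have e54 : 5 / 4 <= expR (2 * b ^+ 2 / t).
  apply: le_trans (expR_ge1Dx _).
  have : 4^-1 <= 2 * b ^+ 2 / t by rewrite ler_pdivlMr//; lra.
  lra.
have b4 : t ^+ 2 / 64 <= b ^+ 4.
  rewrite (_ : b ^+ 4 = (b ^+ 2) ^+ 2); last by rewrite -exprM.
  rewrite (_ : t ^+ 2 / 64 = (t / 8) ^+ 2); last by field.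
  by rewrite lerXn2r ?nnegrE ?sqr_ge0 ?divr_ge0 ?(ltW t0)//; lra.
have T1 : 1 <= 3 * b ^+ 4 / (q * t) * expR (2 * b ^+ 2 / t).
  apply: (@le_trans _ _ (3 * (t ^+ 2 / 64) / (q * t) * (5 / 4))).
    rewrite (_ : 3 * (t ^+ 2 / 64) / (q * t) * (5 / 4) = 15 / 256 * t / q); last first.
      by field; rewrite !gt_eqF.
    rewrite qV; nra.
  apply: ler_pM => //.
    by rewrite divr_ge0 ?mulr_ge0 ?divr_ge0 ?sqr_ge0// ltW.
  by rewrite ler_wpM2r ?invr_ge0 ?mulr_ge0 ?(ltW q0) ?(ltW t0)// ler_wpM2l.
have : 0 <= 332 / 25 * ln t / t by rewrite divr_ge0 ?mulr_ge0// ltW.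
lra.
Qed.

Lemma oppr_ln_onem_le (p : R) : 0 < p -> p < 1 -> - ln (1 - p) <= p / (1 - p).
Proof.
move=> p0 p1; have q0 : 0 < 1 - p by lra.
have := ln_ge_onem_inv q0.
have -> : p / (1 - p) = (1 - p)^-1 - 1 by field; rewrite gt_eqF.
lra.
Qed.

Lemma alpha_ge1 : 1 <= expR (19 / 300) * pi `^ (4^-1) :> R.
Proof.
have h1 : 1 <= expR (19 / 300) :> R.
  by have := expR_ge1Dx (19 / 300 : R); lra.
have h2 : 1 <= (pi : R) `^ (4^-1).
  have p1 : 1 <= pi :> R by have := pi_ge2 R; lra.
  have r0 : 0 <= 4^-1 :> R by [].
  have := ge0_ler_powR r0 (_ : 1 \is Num.nneg) (_ : pi \is Num.nneg) p1.
  by rewrite powR1; apply; rewrite nnegrE ?pi_ge0.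
by rewrite -[leLHS]mulr1; apply: ler_pM.
Qed.

End Numerics.

(** * The explicit and the asymptotic bound for the U-statistic *)

Section MainBound.
Context (R : realType) (d d' : measure_display) (W : measurableType d) (T : measurableType d').
Context (P : probability W R) (X : nat -> {RV P >-> T}) (u : T * T -> R) (b : R).
Hypothesis iidX : iid X.
Hypothesis meas_u : measurable_fun [set: T * T] u.
Hypothesis sym_u : forall x y : T, u (x, y) = u (y, x).
Hypothesis bnd_u : bounded_fun u.
Hypothesis bound_b : {ae P, forall w, `|u (X 0%N w, X 1%N w)| <= b}.
Hypothesis cov_u : (4%:E * covariance P (fun w => u (X 0%N w, X 1%N w))
                                  (fun w => u (X 0%N w, X 2%N w)) = 1)%E.
Variable n : nat.
Hypothesis n1 : (1 < n)%N.
Variables s I : R -> R.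
Hypothesis scU : is_score P (Ustat X u n) s.
Hypothesis sL2 : in_Lp_of P (Ustat X u n) 2 s.
Hypothesis sc2U : is_score2 P (Ustat X u n) I.
Hypothesis IL2 : in_Lp_of P (Ustat X u n) 2 I.

Let U := Ustat X u n.
Let m := pnorm P 4 (fun w => u (X 0%N w, X 1%N w)) ^+ 2.
Let t := Num.sqrt n%:R : R.
Let v := Num.sqrt (n%:R - 1) : R.
Let q := Num.sqrt 2 : R.
Let bU : bmf U := bmf_Ustat X meas_u bnd_u n.

Lemma hellinger_rate rho : 0 < rho -> rho < 1 -> 8 * b ^+ 2 <= n%:R * rho ->
  hellingerZ P U <= (2 * q)^-1 *
    (score_norm P U s I * (- ln (1 - rho)) + (2 * m / v + 48 * m / t / q) * (- ln rho)
     + 44 / 5 * b ^+ 3 / n%:R / rho).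
Proof.
move=> p0 p1 hb.
have n0 : 0 < n%:R :> R by rewrite ltr0n ltnW.
have mp : 0 < m by apply: lt_le_trans (norm_u_ge iidX meas_u sym_u bnd_u bound_b cov_u n1).
have bp := b_gt0 iidX meas_u sym_u bnd_u bound_b cov_u.
have v0 : 0 < v by rewrite sqrtr_gt0 subr_gt0 ltr1n.
have t0 : 0 < t by rewrite sqrtr_gt0.
have q0 : 0 < q by rewrite sqrtr_gt0.
apply: (hellinger_two_paths bU scU sL2 sc2U IL2 p0 p1).
- by rewrite addr_gt0// !divr_gt0// mulr_gt0.
- by rewrite !divr_gt0// mulr_gt0// exprn_gt0.
- move=> r /andP[r0 rr]; have r1 : r < 1 by lra.
  apply: (stein_bound iidX meas_u sym_u bnd_u bound_b cov_u n1); first by rewrite r0.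
  have or0 : 0 < 1 - r by lra.
  rewrite ler_pdivrMr ?mul1r ?mulr_gt0// (le_trans hb)// ler_wpM2l ?(ltW n0)//; lra.
Qed.

Lemma hellinger_explicit :
  hellingerZ P U <=
      3 * (expR (19 / 300) * pi `^ (4^-1)) * b ^+ 3 / Num.sqrt (2 * n%:R)
        * (b + b * ln (4 * Num.sqrt n%:R) / (2 * Num.sqrt n%:R)
             + 4 / n%:R `^ (4^-1))
        * expR (2 * b ^+ 2 / Num.sqrt n%:R)
      + ln n%:R / (Num.sqrt 2 * Num.sqrt (n%:R - 1)) * m
        * (16 + 2 * Num.sqrt 2 + 8 / Num.sqrt (n%:R - 1))
      - (2 * Num.sqrt 2)^-1 * ln (1 - (Num.sqrt n%:R)^-1) * (1 + pnorm P 2 (fun w => s (U w) * U w))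
      + (Num.sqrt 2 * (Num.sqrt n%:R - 1))^-1 * pnorm P 2 (fun w => I (U w))
      + (3 * Num.sqrt 2 * (Num.sqrt n%:R - 1) `^ (3 / 2))^-1 * pnorm P 2 (fun w => s (U w)).
Proof.
have mge := norm_u_ge iidX meas_u sym_u bnd_u bound_b cov_u n1; rewrite -/m in mge.
have bp := b_gt0 iidX meas_u sym_u bnd_u bound_b cov_u.
have n0 : 0 < n%:R :> R by rewrite ltr0n ltnW.
have n2 : 2 <= n%:R :> R by rewrite ler_nat.
have n10 : 0 < n%:R - 1 :> R by lra.
have q0 : 0 < q by rewrite sqrtr_gt0.
have q2 : q ^+ 2 = 2 by rewrite sqr_sqrtr.
have v0 : 0 < v by rewrite sqrtr_gt0.
have t0 : 0 < t by rewrite sqrtr_gt0.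
have t2 : t ^+ 2 = n%:R by rewrite sqr_sqrtr// ltW.
have vt : v <= t by rewrite ler_wsqrtr// lerBlDr lerDl.
have qt : q <= t by rewrite ler_wsqrtr.
have t1 : 1 < t by nra.
set A := expR (19 / 300) * _; have A1 : 1 <= A := alpha_ge1 R.
rewrite sqrtrM// -/t -/v -/q.
set NS := pnorm P 2 (fun w => s (U w) * U w); set NI := pnorm P 2 (fun w => I (U w)).
set N1 := pnorm P 2 (fun w => s (U w)).
have NS0 : 0 <= NS := pnorm_ge0 _ _ _; have NI0 : 0 <= NI := pnorm_ge0 _ _ _.
have N10 : 0 <= N1 := pnorm_ge0 _ _ _.
have ln_n : ln n%:R = 2 * ln t :> R by rewrite -t2 lnXn// mulr_natl.
have lt0 : 0 <= ln t by rewrite ln_ge0// ltW.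
have T1 : 3 * b ^+ 4 / (q * t) * expR (2 * b ^+ 2 / t) <=
    3 * A * b ^+ 3 / (q * t) * (b + b * ln (4 * t) / (2 * t) + 4 / n%:R `^ (4^-1)) * expR (2 * b ^+ 2 / t).
  rewrite ler_wpM2r ?expR_ge0//.
  have l4 : 0 <= ln (4 * t) by rewrite ln_ge0//; lra.
  have e1 : b <= b + b * ln (4 * t) / (2 * t) + 4 / n%:R `^ (4^-1).
    rewrite -addrA lerDl addr_ge0// divr_ge0 ?powR_ge0// ?mulr_ge0// ltW//.
  rewrite (_ : 3 * b ^+ 4 / (q * t) = 3 * 1 * b ^+ 3 / (q * t) * b); last by field; rewrite !gt_eqF.
  apply: ler_pM => //; first by rewrite divr_ge0 ?mulr_ge0 ?exprn_ge0// ltW.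
    exact: ltW.
  by rewrite ler_wpM2r ?invr_ge0 ?mulr_ge0 ?(ltW q0) ?(ltW t0)// ler_wpM2r ?exprn_ge0 ?(ltW bp)// ler_wpM2l.
have T2 : 2 * ln t / (q * v) * m * (16 + 2 * q) <= ln n%:R / (q * v) * m * (16 + 2 * q + 8 / v).
  rewrite ln_n ler_wpM2l//; last by rewrite lerDl divr_ge0// ltW.
  apply: mulr_ge0; last by lra.
  by apply: divr_ge0; apply: mulr_ge0 => //; exact: ltW.
have i0 : 0 < t^-1 by rewrite invr_gt0.
have i1 : t^-1 < 1 by rewrite invf_lt1.
have li0 : 0 <= - ln (1 - t^-1) by rewrite oppr_ge0 ln_le0// lerBlDr lerDl ltW.
have T5 : 0 <= (3 * q * (t - 1) `^ (3 / 2))^-1 * N1.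
  by rewrite mulr_ge0// invr_ge0 !mulr_ge0 ?powR_ge0// ltW.
have c0 : 0 <= (2 * q)^-1 by rewrite invr_ge0 mulr_ge0// ltW.
have T3 : 0 <= (2 * q)^-1 * (- ln (1 - t^-1)) * (1 + NS) by rewrite !mulr_ge0// addr_ge0.
have qt1 : 0 < q * (t - 1) by rewrite mulr_gt0// subr_gt0.
have T4 : (2 * q)^-1 * (NI * - ln (1 - t^-1)) <= (q * (t - 1))^-1 * NI.
  have h := oppr_ln_onem_le i0 i1.
  have E : t^-1 / (1 - t^-1) = (t - 1)^-1 by field; rewrite !gt_eqF// subr_gt0.
  rewrite E in h.
  have h2 : NI * - ln (1 - t^-1) <= NI * (t - 1)^-1 by rewrite ler_wpM2l.
  apply: le_trans (ler_wpM2l c0 h2) _.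
  rewrite (_ : (2 * q)^-1 * _ = 2^-1 * ((q * (t - 1))^-1 * NI)); last first.
    by field; rewrite !gt_eqF// subr_gt0.
  have : 0 <= (q * (t - 1))^-1 * NI by rewrite mulr_ge0// invr_ge0 ltW.
  lra.
have T40 : 0 <= (q * (t - 1))^-1 * NI by rewrite mulr_ge0// invr_ge0 ltW.
(* At rho = 1 / t the condition of [hellinger_rate] reads 8 b^2 <= n / t = t. *)
have [tb|bt] := ltP t (8 * b ^+ 2).
  have h1 := hellinger_le1 bU scU sc2U.
  have h2 := trivial_numerics q0 q2 v0 vt qt mge bp tb.
  apply: le_trans h1 _; lra.
have nt : n%:R * t^-1 = t by rewrite -t2 expr2 mulfK// gt_eqF.
have hb : 8 * b ^+ 2 <= n%:R * t^-1 by rewrite nt.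
apply: le_trans (hellinger_rate i0 i1 hb) _.
rewrite (lnV (x := t)) ?posrE// opprK.
rewrite (_ : 44 / 5 * b ^+ 3 / n%:R / t^-1 = 44 / 5 * b ^+ 3 / t); last first.
  by rewrite -t2; field; rewrite gt_eqF.
(* t >= sqrt 2 gives 1 / t <= 3/4, and ln t >= 1 - 1 / t. *)
have l4 : 4^-1 <= ln t.
  have := ln_ge_onem_inv t0; have : t^-1 <= 3 / 4; last lra.
  rewrite invf_ple ?posrE//; nra.
have h2 := main_numerics q0 q2 v0 vt l4 mge bp.
have e1 : 1 <= expR (2 * b ^+ 2 / t).
  by apply: le_trans (expR_ge1Dx _); rewrite lerDl divr_ge0 ?mulr_ge0 ?sqr_ge0// ltW.
have h3 : 3 * b ^+ 4 / (q * t) <= 3 * b ^+ 4 / (q * t) * expR (2 * b ^+ 2 / t).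
  by rewrite ler_peMr// divr_ge0 ?mulr_ge0 ?exprn_ge0// ltW.
rewrite /score_norm -/NI -/NS.
set l1 := - ln (1 - t^-1) in li0 T3 T4 *.
have -> : ln (1 - t^-1) = - l1 by rewrite opprK.
rewrite (_ : (2 * q)^-1 * ((NI + (1 + NS)) * l1 + _ + _) =
  (2 * q)^-1 * (NI * l1) + (2 * q)^-1 * l1 * (1 + NS) +
  (2 * q)^-1 * ((2 * m / v + 48 * m / t / q) * ln t + 44 / 5 * b ^+ 3 / t)); last by ring.
clearbody l1; rewrite mulrN mulNr opprK; lra.
Qed.

(* With K bounding the score norms by K ln n, take rho = eps / sqrt n where eps K is small: all
   terms but m ln n / sqrt n times 39 / (4 sqrt 2) are then O(1 / sqrt n). *)
Lemma hellinger_asymptotic (K : R) : let eps := (2 * (K + 1))^-1 in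
    let C := 2 * eps + 39 * m * (- ln eps) + 44 / 5 * b ^+ 3 / eps in
    0 <= K -> 1 <= ln n%:R :> R -> C <= ln n%:R -> 8 * b ^+ 2 <= eps * t ->
    score_norm P U s I <= 1 + 2 * K * ln n%:R ->
  hellingerZ P U <= ln n%:R / t * m * (8 * q + 2).
Proof.
move=> eps C K0 ln1 CL hb HL.
have mge := norm_u_ge iidX meas_u sym_u bnd_u bound_b cov_u n1; rewrite -/m in mge.
have bp := b_gt0 iidX meas_u sym_u bnd_u bound_b cov_u.
have n0 : 0 < n%:R :> R by rewrite ltr0n ltnW.
have n2 : 2 <= n%:R :> R by rewrite ler_nat.
have n10 : 0 < n%:R - 1 :> R by lra.
have q0 : 0 < q by rewrite sqrtr_gt0.
have q2 : q ^+ 2 = 2 by rewrite sqr_sqrtr.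
have v0 : 0 < v by rewrite sqrtr_gt0.
have v2 : v ^+ 2 = n%:R - 1 by rewrite sqr_sqrtr// ltW.
have t0 : 0 < t by rewrite sqrtr_gt0.
have t2 : t ^+ 2 = n%:R by rewrite sqr_sqrtr// ltW.
have t1 : 1 < t by nra.
have tv : t <= 2 * v by nra.
have K1 : 0 < 2 * (K + 1) by lra.
have e0 : 0 < eps by rewrite invr_gt0.
have e2 : eps <= 2^-1 by rewrite lef_pV2 ?posrE//; lra.
(* The score norms may grow like K ln n, which is the order of the target; this choice of eps caps
   their contribution by a fixed multiple of ln n / t. *)
have eK : 2 * eps * K <= 1.
  have E : eps * (2 * (K + 1)) = 1 by rewrite mulVf// gt_eqF.
  lra.
set r := eps / t.
have r0 : 0 < r by rewrite divr_gt0.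
have r2 : r <= 2^-1.
  by rewrite /r ler_pdivrMr//; nra.
have rl : r < 1 by lra.
have hb' : 8 * b ^+ 2 <= n%:R * r.
  by have -> : n%:R * r = eps * t by rewrite /r -t2; field; rewrite gt_eqF.
apply: le_trans (hellinger_rate r0 rl hb') _.
have lr : - ln (1 - r) <= 2 * eps / t.
  apply: le_trans (oppr_ln_onem_le r0 rl) _.
  rewrite ler_pdivrMr; last by lra.
  rewrite (_ : 2 * eps / t = 2 * r); last by rewrite /r mulrA.
  by nra.
have lr0 : 0 <= - ln (1 - r) by rewrite oppr_ge0 ln_le0// lerBlDr lerDl ltW.
have ln_n : ln n%:R = 2 * ln t :> R by rewrite -t2 lnXn// mulr_natl.
have lrho : - ln r = - ln eps + ln t.
  have ti : 0 < t^-1 by rewrite invr_gt0.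
  by rewrite (lnM (x := eps) (y := t^-1)) ?posrE// (lnV (x := t)) ?posrE// opprD opprK.
have le0 : 0 <= - ln eps by rewrite oppr_ge0 ln_le0//; lra.
set l := ln n%:R in ln1 CL HL ln_n *.
have lt : ln t = l / 2 by rewrite ln_n; field.
have L0 := ltW (score_norm_gt0 P U s I).
have S1 : score_norm P U s I * - ln (1 - r) <= (1 + 2 * K * l) * (2 * eps / t) by exact: ler_pM.
have q75 : 7 / 5 <= q by nra.
(* With v >= t / 2 and q >= 7/5 the sum is at most (4 + 240/7) m / t, and 4 + 240/7 < 39. *)
have a1 : 2 * m / v + 48 * m / t / q <= 39 * m / t.
  have h1 : v^-1 <= 2 / t by rewrite ler_pdivlMr// mulrC ler_pdivrMr.
  have h2 : q^-1 <= 5 / 7 by rewrite invf_ple ?posrE// invf_div.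
  have h3 : 2 * m / v <= 2 * m * (2 / t) by apply: ler_wpM2l => //; lra.
  have h4 : 48 * m / t / q <= 48 * m / t * (5 / 7).
    by apply: ler_wpM2l => //; apply: divr_ge0; [lra | exact: ltW].
  have h5 : 0 <= m / t by rewrite divr_ge0 ?(ltW t0)//; lra.
  rewrite (_ : 39 * m / t = 39 * (m / t)); last by rewrite mulrA.
  rewrite (_ : 2 * m * (2 / t) = 4 * (m / t)) in h3; last by ring.
  rewrite (_ : 48 * m / t * (5 / 7) = 240 / 7 * (m / t)) in h4; last by ring.
  lra.
have a0 : 0 <= 2 * m / v + 48 * m / t / q.
  have [v1 t3 q1] := And3 (ltW v0) (ltW t0) (ltW q0).
  by apply: addr_ge0; do ?apply: divr_ge0 => //; lra.
have S2 : (2 * m / v + 48 * m / t / q) * - ln r <= 39 * m / t * (- ln eps + l / 2).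
  by rewrite lrho lt ler_wpM2r// addr_ge0//; lra.
have S3 : 44 / 5 * b ^+ 3 / n%:R / r = 44 / 5 * b ^+ 3 / eps / t.
  by rewrite /r -t2; field; rewrite !gt_eqF.
have ml : 0 <= m * l by rewrite mulr_ge0//; lra.
(* As m >= 1/2, the score part costs at most 4 m l and C at most 2 m l; with 39/2 m l this stays
   below 26 m l. The target corresponds to 2 q (8 q + 2) = 32 + 4 q. *)
have tot : score_norm P U s I * - ln (1 - r) + (2 * m / v + 48 * m / t / q) * - ln r
    + 44 / 5 * b ^+ 3 / n%:R / r <= 26 * (m * l) / t.
  rewrite S3; apply: le_trans (lerD (lerD S1 S2) (lexx _)) _.
  rewrite [leLHS](_ : _ = (2 * (2 * eps * K) * l + 39 / 2 * (m * l) + C) / t); last first.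
    by rewrite /C; ring.
  rewrite ler_wpM2r ?invr_ge0 ?(ltW t0)//.
  have h1 : 2 * eps * K * l <= 1 * l by rewrite ler_wpM2r//; lra.
  have h2 : 2^-1 * l <= m * l by rewrite ler_wpM2r//; lra.
  lra.
have c0 : 0 <= (2 * q)^-1 by rewrite invr_ge0 mulr_ge0// ltW.
apply: le_trans (ler_wpM2l c0 tot) _.
rewrite [leRHS](_ : _ = (2 * q)^-1 * ((32 + 4 * q) * (m * l) / t)); last first.
  rewrite (_ : 32 = 16 * q ^+ 2 :> R); last by rewrite q2; ring.
  by field; rewrite !gt_eqF.
rewrite ler_wpM2l// ler_wpM2r ?invr_ge0 ?(ltW t0)// ler_wpM2r//; lra.
Qed.

End MainBound.

Theorem theorem2p5 (R : realType) (d d' : measure_display)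
    (W : measurableType d) (T : measurableType d') (P : probability W R)
    (X : nat -> {RV P >-> T}) (u : T * T -> R) (b : R) (s I : nat -> R -> R)
    (iidX : iid X)
    (meas_u : measurable_fun [set: T * T] u)
    (sym_u : forall x y : T, u (x, y) = u (y, x))
    (bnd_u : bounded_fun u)
    (bound_b : {ae P, forall w, `|u (X 0%N w, X 1%N w)| <= b})
    (cov_u : (4%:E * covariance P (fun w => u (X 0%N w, X 1%N w))
                                  (fun w => u (X 0%N w, X 2%N w)) = 1)%E) :
  let U := Ustat X u in
  let admits_scores (n : nat) :=
    [/\ is_score P (U n) (s n), in_Lp_of P (U n) 2 (s n),
        is_score2 P (U n) (I n) & in_Lp_of P (U n) 2 (I n)] in
  let norm_s (n : nat) := pnorm P 2 (fun w => s n (U n w)) in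
  let norm_I (n : nat) := pnorm P 2 (fun w => I n (U n w)) in
  let norm_sU (n : nat) := pnorm P 2 (fun w => s n (U n w) * U n w) in
  let norm_u := pnorm P 4 (fun w => u (X 0%N w, X 1%N w)) in
  let alpha : R := expR (19 / 300) * pi `^ (4^-1) in
  (forall n : nat, (2 <= n)%N -> admits_scores n ->
    hellingerZ P (U n) <=
      3 * alpha * b ^+ 3 / Num.sqrt (2 * n%:R)
        * (b + b * ln (4 * Num.sqrt n%:R) / (2 * Num.sqrt n%:R)
             + 4 / n%:R `^ (4^-1))
        * expR (2 * b ^+ 2 / Num.sqrt n%:R)
      + ln n%:R / (Num.sqrt 2 * Num.sqrt (n%:R - 1)) * norm_u ^+ 2
        * (16 + 2 * Num.sqrt 2 + 8 / Num.sqrt (n%:R - 1))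
      - (2 * Num.sqrt 2)^-1 * ln (1 - (Num.sqrt n%:R)^-1) * (1 + norm_sU n)
      + (Num.sqrt 2 * (Num.sqrt n%:R - 1))^-1 * norm_I n
      + (3 * Num.sqrt 2 * (Num.sqrt n%:R - 1) `^ (3 / 2))^-1 * norm_s n) /\
  ((forall n : nat, (2 <= n)%N -> admits_scores n) ->
   (fun n : nat => Num.max (norm_s n) (Num.max (norm_I n) (norm_sU n)))
     =O_\oo (fun n : nat => ln n%:R : R) ->
   lessapprox (fun n : nat => hellingerZ P (U n))
     (fun n : nat => ln n%:R / Num.sqrt n%:R * norm_u ^+ 2
                       * (8 * Num.sqrt 2 + 2))).
Proof.
move=> U admits_scores norm_s norm_I norm_sU norm_u alpha; split.
  move=> n n1 [sc sL2 sc2 IL2].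
  exact: (hellinger_explicit iidX meas_u sym_u bnd_u bound_b cov_u n1 sc sL2 sc2 IL2).
move=> adm /eqO_exP[K K0 HK].
(* The inequality eventually holds with no error term, because 8 sqrt 2 + 2 is strictly larger than
   the constant reached by the path argument. *)
exists (fun=> 0).
  apply/eqoP => e e0; apply: nearW => k.
  by rewrite normr0 mulr_ge0// ltW.
set eps : R := (2 * (K + 1))^-1.
have e0 : 0 < eps by rewrite invr_gt0; lra.
pose C := 2 * eps + 39 * norm_u ^+ 2 * (- ln eps) + 44 / 5 * b ^+ 3 / eps.
have big (D : R) : \forall n \near \oo, D <= n%:R.
  by apply: nbhs_infty_ger.
near=> n.
have n1 : (1 < n)%N by near: n; exact: nbhs_infty_gt.
have n0 : 0 < n%:R :> R by rewrite ltr0n ltnW.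
have lnge (D : R) : expR D <= n%:R -> D <= ln n%:R.
  by move=> h; rewrite -[leLHS]expRK ler_ln ?posrE ?expR_gt0.
have ln1 : 1 <= ln n%:R :> R by apply: lnge; near: n; exact: big.
have lnC : C <= ln n%:R by apply: lnge; near: n; exact: big.
have hb : 8 * b ^+ 2 <= eps * Num.sqrt n%:R.
  rewrite -ler_pdivrMl//.
  have c0 : 0 <= eps^-1 * (8 * b ^+ 2)
    by apply: mulr_ge0; [rewrite invr_ge0 ltW | have := sqr_ge0 b; lra].
  rewrite -(ger0_norm c0) -sqrtr_sqr ler_wsqrtr//.
  by near: n; exact: big.
have [sc sL2 sc2 IL2] := adm n n1.
have hK : `|Num.max (norm_s n) (Num.max (norm_I n) (norm_sU n))| <= K * `|ln n%:R| :> R.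
  by near: n; exact: HK.
rewrite addr0.
apply: (hellinger_asymptotic iidX meas_u sym_u bnd_u bound_b cov_u n1 sc sL2 sc2 IL2 (ltW K0) ln1 lnC hb).
rewrite (ger0_norm (le_trans ler01 ln1)) in hK.
have {hK} := le_trans (ler_norm _) hK.
rewrite !ge_max => /and3P[_ hI hsU].
rewrite /score_norm -/(U n) -/(norm_I n) -/(norm_sU n); lra.
Unshelve. all: by end_near.
Qed.
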